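(* Let $\mathcal C$ be a semisimple strict rigid C*-tensor category with at most countably many isomorphism classes of simple objects, and let $\Lambda\subseteq[Obj(\mathcal C)]$ be a full weight set. Then $Rep(\mathcal A\Lambda)\cong Rep(\mathcal A)$ as additive categories, i.e. the category of non-degenerate $*$-representations of the annular algebra $\mathcal A\Lambda$ is equivalent, as an additive category, to that of the tube algebra $\mathcal A$.
   Context: Categories. $\mathcal C$ is a C*-category with finite-dimensional morphism spaces $Mor(X,Y)$, finite direct sums and subobjects, a strict tensor functor $\otimes$ compatible with $*$, simple tensor unit $id$, duals, and at most countably many isomorphism classes of simple objects. $\mathrm{Irr}(\mathcal C)$ is the set of isomorphism classes of simple objects, $X_k$ a chosen representative of $k\in \mathrm{Irr}(\mathcal C)$, $0$ the class of the unit, $X_0=id$. $[Obj(\mathcal C)]$ is the set of isomorphism classes of objects. $R_k\in Mor(id,\overline X_k\otimes X_k)$, $\overline R_k\in Mor(id,X_k\otimes\overline X_k)$ are standard solutions of the conjugate equations, with $\overline X_k$ identified with $X_{\overline k}$. Annular algebra. For a weight set $\Lambda\subseteq[Obj(\mathcal C)]$ with chosen representatives $Y_i\in i$ ($i\in\Lambda$), $\mathcal A\Lambda=\bigoplus_{i,j\in\Lambda,\,k\in \mathrm{Irr}(\mathcal C)}\mathcal A\Lambda^k_{i,j}$, $\mathcal A\Lambda^k_{i,j}=Mor(X_k\otimes Y_i,Y_j\otimes X_k)$. It is a $*$-algebra with product $$(x\cdot y)^k_{i,j}=\sum_{s\in\Lambda,\ m,l\in \mathrm{Irr}(\mathcal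 C)}\ \sum_{V\in onb(X_k,X_m\otimes X_l)}(1_j\otimes V^* )(x^m_{s,j}\otimes 1_l)(1_m\otimes y^l_{i,s})(V\otimes 1_i)$$ and involution $$(x^\#)^k_{i,j}=(\overline R_k^*\otimes 1_j\otimes 1_k)(1_k\otimes (x^{\overline k}_{j,i})^*\otimes 1_k)(1_k\otimes 1_i\otimes R_k),$$ where $onb(X_k,\beta)$ is an orthonormal basis of $Mor(X_k,\beta)$ for the inner product $\eta^*\xi=\langle\xi,\eta\rangle 1_{X_k}$. The tube algebra $\mathcal A$ is the annular algebra with weight set $\mathrm{Irr}(\mathcal C)$. $\Lambda$ is full if every simple object is isomorphic to a subobject of some $Y_i$, $i\in\Lambda$. Representations. A non-degenerate representation of $\mathcal A\Lambda$ is a $*$-homomorphism $\pi:\mathcal A\Lambda\to B(H)$, $H$ a Hilbert space, such that $\pi(\mathcal A\Lambda)\xi=0$ implies $\xi=0$. $Rep(\mathcal A\Lambda)$ is the category of non-degenerate representations with bounded intertwiners as morphisms. *)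

(* Defs.v *)
From HB Require Import structures.
From mathcomp Require Import all_boot all_order all_algebra.
From mathcomp Require Import sesquilinear complex.
From mathcomp Require Import all_classical reals topology normedtype.
From mathcomp Require Import ring.

Set Implicit Arguments.
Unset Strict Implicit.
Unset Printing Implicit Defensive.

Import Order.TTheory GRing.Theory Num.Theory.

Local Open Scope classical_set_scope.
Local Open Scope ring_scope.

Record cstarCategory (R : realType) := CStarCategory {
  obj :> Type ;
  mor : obj -> obj -> completeNormedModType R[i] ;
  idm : forall X, mor X X ;
  mcomp : forall X Y Z, mor Y Z -> mor X Y -> mor X Z ;
  adj : forall X Y, mor X Y -> mor Y X ;
  compA : forall X Y Z T (h : mor Z T) (g : mor Y Z) (f : mor X Y),
    mcomp h (mcomp g f) = mcomp (mcomp h g) f ;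
  comp1m : forall X Y (f : mor X Y), mcomp (idm Y) f = f ;
  compm1 : forall X Y (f : mor X Y), mcomp f (idm X) = f ;
  comp_linearl : forall X Y Z (f : mor X Y), linear (fun g : mor Y Z => mcomp g f) ;
  comp_linearr : forall X Y Z (g : mor Y Z), linear (fun f : mor X Y => mcomp g f) ;
  adj_antilinear : forall X Y (a : R[i]) (f g : mor X Y),
    adj (a *: f + g) = Num.conj a *: adj f + adj g ;
  adjK : forall X Y (f : mor X Y), adj (adj f) = f ;
  adj_comp : forall X Y Z (g : mor Y Z) (f : mor X Y),
    adj (mcomp g f) = mcomp (adj f) (adj g) ;
  norm_comp : forall X Y Z (g : mor Y Z) (f : mor X Y),
    `|mcomp g f| <= `|g| * `|f| ;
  cstar_identity : forall X Y (f : mor X Y), `|mcomp (adj f) f| = `|f| ^+ 2 ;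
  (* f^* f is a positive element of the C*-algebra End X. *)
  adj_positive : forall X Y (f : mor X Y),
    exists h : mor X X, mcomp (adj f) f = mcomp (adj h) h }.

Arguments mor {R _} _ _.
Arguments idm {R _} X.
Arguments mcomp {R _ X Y Z} _ _.
Arguments adj {R _ X Y} _.

Declare Scope cstar_scope.
Delimit Scope cstar_scope with cstar.
Notation "g ∘ f" := (mcomp g f) (at level 40, left associativity) : cstar_scope.
Notation "f ^†" := (adj f) (at level 1, format "f ^†") : cstar_scope.
Notation "1_[ X ]" := (idm X) (at level 0, format "1_[ X ]") : cstar_scope.

Local Open Scope cstar_scope.

Section CStarCategory.
Context {R : realType} {C : cstarCategory R}.
Implicit Types X Y Z : C.

Definition isomorphic X Y : Prop :=
  exists (f : mor X Y) (g : mor Y X), g ∘ f = 1_[X] /\ f ∘ g = 1_[Y].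

Definition isometry X Y (v : mor X Y) : Prop := v^† ∘ v = 1_[X].

Definition simple X : Prop :=
  1_[X] <> 0 /\ forall f : mor X X, exists c : R[i], f = c *: 1_[X].

(* The u_a are isometries S_a -> X with mutually orthogonal ranges summing up
   to X. *)
Definition is_direct_sum X n (S : 'I_n -> C) (u : forall a, mor (S a) X) : Prop :=
  [/\ forall a, isometry (u a),
      forall a b, a <> b -> (u a)^† ∘ u b = 0
    & \sum_a u a ∘ (u a)^† = 1_[X]].

Definition is_projection X (p : mor X X) : Prop := p ∘ p = p /\ p^† = p.

(* For X simple: orthonormal basis of [mor X Y] for the inner product
   determined by g^* f = <f, g> 1_X. *)
Definition is_onb X Y n (V : 'I_n -> mor X Y) : Prop :=
  (forall a b, (V a)^† ∘ V b = (a == b)%:R *: 1_[X]) /\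
  (forall f : mor X Y, exists c : 'I_n -> R[i], f = \sum_a c a *: V a).

Definition iso_class X : set C := [set Y | isomorphic X Y].

Definition to_eq X Y (e : X = Y) : mor X Y := ecast T (mor X T) e 1_[X].

End CStarCategory.

Definition Obj_classes {R : realType} (C : cstarCategory R) : set (set C) :=
  range (@iso_class R C).

Definition Irr {R : realType} (C : cstarCategory R) : set (set C) :=
  [set iso_class X | X in @simple R C].

Arguments Obj_classes {R} C.
Arguments Irr {R} C.

Record cstarTensorCategory (R : realType) := CStarTensorCategory {
  tensor_cat :> cstarCategory R ;
  tensor : tensor_cat -> tensor_cat -> tensor_cat ;
  tunit : tensor_cat ;
  tensorm : forall X X' Y Y' : tensor_cat,
    mor X X' -> mor Y Y' -> mor (tensor X Y) (tensor X' Y') ;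
  tensorm_linearl : forall (X X' Y Y' : tensor_cat) (g : mor Y Y'),
    linear (fun f : mor X X' => tensorm f g) ;
  tensorm_linearr : forall (X X' Y Y' : tensor_cat) (f : mor X X'),
    linear (fun g : mor Y Y' => tensorm f g) ;
  tensorm1 : forall X Y : tensor_cat, tensorm 1_[X] 1_[Y] = 1_[tensor X Y] ;
  tensorm_comp : forall (X X' X'' Y Y' Y'' : tensor_cat)
    (f' : mor X' X'') (f : mor X X') (g' : mor Y' Y'') (g : mor Y Y'),
    tensorm (f' ∘ f) (g' ∘ g) = tensorm f' g' ∘ tensorm f g ;
  tensorm_adj : forall (X X' Y Y' : tensor_cat) (f : mor X X') (g : mor Y Y'),
    (tensorm f g)^† = tensorm f^† g^† ;
  (* Strictness; equalities between morphisms hold up to the identifications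
     [to_eq] induced by the equalities between objects. *)
  tensorA : forall X Y Z : tensor_cat, tensor X (tensor Y Z) = tensor (tensor X Y) Z ;
  tensor1o : forall X : tensor_cat, tensor tunit X = X ;
  tensoro1 : forall X : tensor_cat, tensor X tunit = X ;
  tensormA : forall (X X' Y Y' Z Z' : tensor_cat)
    (f : mor X X') (g : mor Y Y') (h : mor Z Z'),
    to_eq (tensorA X' Y' Z') ∘ tensorm f (tensorm g h) =
    tensorm (tensorm f g) h ∘ to_eq (tensorA X Y Z) ;
  tensor1m : forall (X X' : tensor_cat) (f : mor X X'),
    to_eq (tensor1o X') ∘ tensorm 1_[tunit] f = f ∘ to_eq (tensor1o X) ;
  tensorm1r : forall (X X' : tensor_cat) (f : mor X X'),
    to_eq (tensoro1 X') ∘ tensorm f 1_[tunit] = f ∘ to_eq (tensoro1 X) }.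

Arguments tensor {R _} _ _.
Arguments tunit {R} _.
Arguments tensorm {R _ X X' Y Y'} _ _.

Notation "X ⊗ Y" := (tensor X Y) (at level 39, left associativity) : cstar_scope.
Notation "f ⊠ g" := (tensorm f g) (at level 39, left associativity) : cstar_scope.

Section Duals.
Context {R : realType} {C : cstarTensorCategory R}.
Implicit Types X Y Z : C.

(* (Rbar^* ⊗ 1_X)(1_X ⊗ R) = 1_X and (R^* ⊗ 1_Xbar)(1_Xbar ⊗ Rbar) = 1_Xbar *)
Definition conjugate_equations X Xbar
    (r : mor (tunit C) (Xbar ⊗ X)) (rbar : mor (tunit C) (X ⊗ Xbar)) : Prop :=
  to_eq (tensor1o X) ∘ (rbar^† ⊠ 1_[X]) ∘ to_eq (tensorA X Xbar X)
    ∘ (1_[X] ⊠ r) ∘ to_eq (esym (tensoro1 X)) = 1_[X] /\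
  to_eq (tensor1o Xbar) ∘ (r^† ⊠ 1_[Xbar]) ∘ to_eq (tensorA Xbar X Xbar)
    ∘ (1_[Xbar] ⊠ rbar) ∘ to_eq (esym (tensoro1 Xbar)) = 1_[Xbar].

(* For X simple, standardness of a solution is the normalization
   ||R|| = ||Rbar||. *)
Definition standard_solution X Xbar
    (r : mor (tunit C) (Xbar ⊗ X)) (rbar : mor (tunit C) (X ⊗ Xbar)) : Prop :=
  conjugate_equations r rbar /\ `|r| = `|rbar|.

End Duals.

Record rigidTensorCategory (R : realType) := RigidTensorCategory {
  rigid_cat :> cstarTensorCategory R ;
  mor_findim : forall X Y : rigid_cat, exists n (e : 'I_n -> mor X Y),
    forall f, exists c : 'I_n -> R[i], f = \sum_a c a *: e a ;
  direct_sums : forall n (S : 'I_n -> rigid_cat),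
    exists (X : rigid_cat) (u : forall a, mor (S a) X), is_direct_sum u ;
  subobjects : forall (X : rigid_cat) (p : mor X X), is_projection p ->
    exists (Y : rigid_cat) (v : mor Y X), isometry v /\ v ∘ v^† = p ;
  unit_simple : simple (tunit rigid_cat) ;
  duals : forall X : rigid_cat, exists (Xbar : rigid_cat)
    (r : mor (tunit rigid_cat) (Xbar ⊗ X)) (rbar : mor (tunit rigid_cat) (X ⊗ Xbar)),
    conjugate_equations r rbar ;
  semisimple : forall X : rigid_cat,
    exists n (S : 'I_n -> rigid_cat) (u : forall a, mor (S a) X),
      (forall a, simple (S a)) /\ is_direct_sum u }.

(* Choices entering the definition of the annular algebras: X_k is [irr k], and
   the conjugate of X_k is identified with X_kbar, where kbar is [conj_irr k].
   That kbarbar = k is automatic, a conjugate being unique up to isomorphism. *)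
Record irrData (R : realType) (C : rigidTensorCategory R) := IrrData {
  irr : Irr C -> C ;
  irr_in : forall k : Irr C, val k (irr k) ;
  irr_unit : forall k : Irr C, val k (tunit C) -> irr k = tunit C ;
  conj_irr : Irr C -> Irr C ;
  conj_irrK : involutive conj_irr ;
  sol : forall k, mor (tunit C) (irr (conj_irr k) ⊗ irr k) ;
  solbar : forall k, mor (tunit C) (irr k ⊗ irr (conj_irr k)) ;
  sol_standard : forall k, standard_solution (sol k) (solbar k) ;
  onb_size : Irr C -> Irr C -> Irr C -> nat ;
  onb : forall k m l, 'I_(onb_size k m l) -> mor (irr k) (irr m ⊗ irr l) ;
  onbP : forall k m l, is_onb (@onb k m l) }.

Section Schur.
Context {R : realType} {C : cstarCategory R}.
Implicit Types X Y Z : C.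

Lemma comp0m X Y Z (f : mor X Y) : (0 : mor Y Z) ∘ f = 0.
Proof.
by have := comp_linearl f (-1) 0 (0 : mor Y Z); rewrite !scaleN1r !addr0 !oppr0 addNr.
Qed.

Lemma compm0 X Y Z (f : mor Y Z) : f ∘ (0 : mor X Y) = 0.
Proof.
by have := comp_linearr f (-1) 0 (0 : mor X Y); rewrite !scaleN1r !addr0 !oppr0 addNr.
Qed.

Lemma compZm X Y Z a (g : mor Y Z) (f : mor X Y) : (a *: g) ∘ f = a *: (g ∘ f).
Proof. by have := comp_linearl f a g 0; rewrite comp0m !addr0. Qed.

Lemma compmZ X Y Z a (g : mor Y Z) (f : mor X Y) : g ∘ (a *: f) = a *: (g ∘ f).
Proof. by have := comp_linearr g a f 0; rewrite compm0 !addr0. Qed.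

Lemma compDm X Y Z (g g' : mor Y Z) (f : mor X Y) :
  (g + g') ∘ f = g ∘ f + g' ∘ f.
Proof. by have := comp_linearl f 1 g g'; rewrite !scale1r. Qed.

Lemma comp_suml X Y Z n (g : 'I_n -> mor Y Z) (f : mor X Y) :
  (\sum_a g a) ∘ f = \sum_a g a ∘ f.
Proof. exact: (big_morph (fun h => h ∘ f) (fun g g' => compDm g g' f) (comp0m Z f)). Qed.

Lemma adj0 X Y : (0 : mor X Y)^† = 0.
Proof.
have := adj_antilinear (-1) (0 : mor X Y) 0.
by rewrite scaler0 addr0 rmorphN1 scaleN1r addNr.
Qed.

Lemma isomorphic_refl X : isomorphic X X.
Proof. by exists 1_[X], 1_[X]; rewrite comp1m. Qed.

Lemma isomorphic_sym X Y : isomorphic X Y -> isomorphic Y X.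
Proof. by move=> [f [g [gf fg]]]; exists g, f. Qed.

Lemma isomorphic_trans X Y Z : isomorphic X Y -> isomorphic Y Z -> isomorphic X Z.
Proof.
move=> [f [g [gf fg]]] [f' [g' [gf' fg']]]; exists (f' ∘ f), (g ∘ g'); split.
  by rewrite compA -(compA g) gf' compm1.
by rewrite compA -(compA f') fg compm1.
Qed.

Lemma iso_classP X Y : isomorphic X Y -> iso_class X = iso_class Y.
Proof.
move=> XY; apply/seteqP; split=> Z /=.
  exact/isomorphic_trans/isomorphic_sym.
exact: isomorphic_trans.
Qed.

Lemma simple_iso X Y : isomorphic X Y -> simple X -> simple Y.
Proof.
move=> [f [g [gf fg]]] [nz sX]; split=> [Y0|h].
  by apply: nz; rewrite -gf -(comp1m f) Y0 comp0m compm0.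
have [c hc] := sX (g ∘ h ∘ f); exists c.
have -> : h = f ∘ (g ∘ h ∘ f) ∘ g by rewrite !compA fg comp1m -compA fg compm1.
by rewrite hc compmZ compm1 compZm fg.
Qed.

Lemma Schur X Y (f : mor X Y) : simple X -> simple Y -> f <> 0 -> isomorphic X Y.
Proof.
move=> [_ sX] [_ sY] fN0.
have [c hc] := sX (f^† ∘ f); have [d hd] := sY (f ∘ f^†).
have c0 : c != 0.
  apply/eqP => c0; apply: fN0; apply/eqP; rewrite -normr_eq0 -sqrf_eq0.
  by rewrite -cstar_identity hc c0 scale0r normr0.
have dc : d = c.
  have : d *: f = c *: f.
    by rewrite -{1}(comp1m f) -compZm -hd -compA hc compmZ compm1.
  move=> /eqP; rewrite -subr_eq0 -scalerBl scaler_eq0 subr_eq0.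
  by case/orP=> /eqP.
exists f, (c^-1 *: f^†); split.
  by rewrite compZm hc scalerA mulVf// scale1r.
by rewrite compmZ hd dc scalerA mulVf// scale1r.
Qed.

Lemma val_Irr (k : Irr C) X : val k X -> val k = iso_class X.
Proof.
by have /set_mem [Y _ <-] := valP k => /iso_classP.
Qed.

Lemma simple_Irr (k : Irr C) X : val k X -> simple X.
Proof.
have /set_mem [Y sY <-] := valP k => YX.
exact: simple_iso YX sY.
Qed.

End Schur.

Section Annular.
Context {R : realType} {C : rigidTensorCategory R} (D : irrData C).
Context {I : choiceType} (Y : I -> C).

Definition annular_coef := forall (i j : I) (k : Irr C),
  mor (irr D k ⊗ Y i) (Y j ⊗ irr D k).

Definition annular_support (x : annular_coef) : set (I * I * Irr C) :=
  [set t | x t.1.1 t.1.2 t.2 <> 0].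

Record annular := Annular {
  coef :> forall (i j : I) (k : Irr C), mor (irr D k ⊗ Y i) (Y j ⊗ irr D k) ;
  coef_finite : finite_set (annular_support coef) }.

HB.instance Definition _ := gen_eqMixin annular.
HB.instance Definition _ := gen_choiceMixin annular.

Lemma annularP (x y : annular) : (forall i j k, x i j k = y i j k) -> x = y.
Proof.
case: x y => [x hx] [y hy] /= xy.
have exy : x = y by apply/functional_extensionality_dep => i;
  apply/functional_extensionality_dep => j; apply/functional_extensionality_dep.
by rewrite exy in hx *; congr Annular; exact: Prop_irrelevance.
Qed.

Lemma annular_zero_finite : finite_set (annular_support (fun i j k => 0)).
Proof. by apply: (sub_finite_set _ (finite_set0 _)) => t /=. Qed.

Lemma annular_lin_finite (a : R[i]) (x y : annular) :
  finite_set (annular_support (fun i j k => a *: x i j k + y i j k)).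
Proof.
have : finite_set (annular_support x `|` annular_support y).
  by rewrite finite_setU; split; exact: coef_finite.
apply: sub_finite_set => t /= nz.
have [x0|xn0] := pselect (x t.1.1 t.1.2 t.2 = 0); last by left.
by right=> y0; apply: nz; rewrite x0 y0 scaler0 addr0.
Qed.

Definition annular_zero := Annular annular_zero_finite.
Definition annular_lin a x y := Annular (annular_lin_finite a x y).
Definition annular_add x y := annular_lin 1 x y.
Definition annular_opp x := annular_lin (-1) x annular_zero.
Definition annular_scale a x := annular_lin a x annular_zero.

Lemma annular_addA : associative annular_add.
Proof. by move=> x y z; apply: annularP => i j k /=; rewrite !scale1r addrA. Qed.

Lemma annular_addC : commutative annular_add.
Proof. by move=> x y; apply: annularP => i j k /=; rewrite !scale1r addrC. Qed.

Lemma annular_add0 : left_id annular_zero annular_add.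
Proof. by move=> x; apply: annularP => i j k /=; rewrite !scale1r add0r. Qed.

Lemma annular_addN : left_inverse annular_zero annular_opp annular_add.
Proof.
by move=> x; apply: annularP => i j k /=; rewrite scale1r scaleN1r addr0 addNr.
Qed.

HB.instance Definition _ := GRing.isZmodule.Build annular
  annular_addA annular_addC annular_add0 annular_addN.

Lemma annular_addE (x y : annular) i j k : (x + y) i j k = x i j k + y i j k.
Proof. by rewrite {1}/GRing.add /= scale1r. Qed.

Lemma annular_scaleE a x i j k : annular_scale a x i j k = a *: x i j k.
Proof. by rewrite /= addr0. Qed.

Lemma annular_scaleA a b x :
  annular_scale a (annular_scale b x) = annular_scale (a * b) x.
Proof. by apply: annularP => i j k; rewrite !annular_scaleE scalerA. Qed.

Lemma annular_scale1 : left_id 1 annular_scale.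
Proof. by move=> x; apply: annularP => i j k; rewrite annular_scaleE scale1r. Qed.

Lemma annular_scaleDr : right_distributive annular_scale +%R.
Proof.
move=> a x y; apply: annularP => i j k.
by rewrite annular_addE !annular_scaleE annular_addE scalerDr.
Qed.

Lemma annular_scaleDl x : {morph annular_scale^~ x : a b / a + b}.
Proof.
move=> a b; apply: annularP => i j k.
by rewrite annular_addE !annular_scaleE scalerDl.
Qed.

HB.instance Definition _ := GRing.Zmodule_isLmodule.Build R[i] annular
  annular_scaleA annular_scale1 annular_scaleDr annular_scaleDl.

(* (1_j ⊗ V^* )(x^m_{s,j} ⊗ 1_l)(1_m ⊗ y^l_{i,s})(V ⊗ 1_i) *)
Definition annular_mul_term (x y : annular) (i j s : I) (k m l : Irr C)
    (V : mor (irr D k) (irr D m ⊗ irr D l)) :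
    mor (irr D k ⊗ Y i) (Y j ⊗ irr D k) :=
  (1_[Y j] ⊠ V^†) ∘ to_eq (esym (tensorA (Y j) (irr D m) (irr D l)))
  ∘ (x s j m ⊠ 1_[irr D l]) ∘ to_eq (tensorA (irr D m) (Y s) (irr D l))
  ∘ (1_[irr D m] ⊠ y i s l) ∘ to_eq (esym (tensorA (irr D m) (irr D l) (Y i)))
  ∘ (V ⊠ 1_[Y i]).

Definition annular_mul_coef (x y : annular) (i j : I) (k : Irr C) :
    mor (irr D k ⊗ Y i) (Y j ⊗ irr D k) :=
  \sum_(t \in [set: I * Irr C * Irr C]) \sum_v
    annular_mul_term x y i j t.1.1 (@onb _ _ D k t.1.2 t.2 v).

Lemma tensorm0r (X X' Z Z' : C) (f : mor X X') : f ⊠ (0 : mor Z Z') = 0.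
Proof.
have := tensorm_linearr f (-1) 0 (0 : mor Z Z').
by rewrite !scaleN1r !addr0 !oppr0 addNr.
Qed.

Lemma tensorm0l (X X' Z Z' : C) (f : mor X X') : (0 : mor Z Z') ⊠ f = 0.
Proof.
have := tensorm_linearl f (-1) 0 (0 : mor Z Z').
by rewrite !scaleN1r !addr0 !oppr0 addNr.
Qed.

Lemma finite_constituents (X : C) :
  finite_set [set k : Irr C | exists f : mor (irr D k) X, f <> 0].
Proof.
have [n [S [u [sS [_ _ u1]]]]] := semisimple X.
have fS : finite_set (range (fun a => iso_class (S a))).
  exact/finite_image/finite_finset.
have := @finite_preimage _ _ _ (val : Irr C -> set C) _ fS.
move=> /(_ (in2W val_inj)); apply: sub_finite_set => k [f f0] /=.
have [a ua] : exists a, (u a)^† ∘ f <> 0.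
  apply: contrapT => h; apply: f0; rewrite -(comp1m f) -u1 comp_suml big1// => a _.
  rewrite -compA; have [->|?] := pselect ((u a)^† ∘ f = 0); first by rewrite compm0.
  by exfalso; apply: h; exists a.
exists a => //; rewrite (val_Irr (irr_in D k)); apply/esym/iso_classP.
exact: (Schur (simple_Irr (irr_in D k)) (sS a) ua).
Qed.

Lemma annular_mul_finite x y : finite_set (annular_support (annular_mul_coef x y)).
Proof.
pose F (p q : I * I * Irr C) := [set t : I * I * Irr C |
  t.1 = (q.1.1, p.1.2) /\
  exists f : mor (irr D t.2) (irr D p.2 ⊗ irr D q.2), f <> 0].
have fF p q : finite_set (F p q).
  apply: (sub_finite_set _ (finite_image (fun k => ((q.1.1, p.1.2), k))
    (finite_constituents (irr D p.2 ⊗ irr D q.2)))).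
  by move=> [t k]; rewrite /F /= => -[-> ?]; exists k.
have : finite_set (\bigcup_(p in annular_support x)
  \bigcup_(q in annular_support y) F p q).
  apply: bigcup_finite => [|p _]; first exact: coef_finite.
  by apply: bigcup_finite => [|q _]; [exact: coef_finite|exact: fF].
apply: sub_finite_set => -[[i j] k] /= nz.
have [[[s m] l] [v tN0]] : exists (t : I * Irr C * Irr C) v,
    annular_mul_term x y i j t.1.1 (@onb _ _ D k t.1.2 t.2 v) <> 0.
  apply: contrapT => h; apply: nz; apply: fsbig1 => t _; apply: big1 => v _.
  by apply: contrapT => h'; apply: h; exists t, v.
exists (s, j, m) => /=.
  by move=> x0; apply: tN0; rewrite /annular_mul_term x0 tensorm0l compm0 !comp0m.
exists (i, s, l) => /=.
  by move=> y0; apply: tN0; rewrite /annular_mul_term y0 tensorm0r compm0 !comp0m.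
split=> //; exists (@onb _ _ D k m l v) => V0.
by apply: tN0; rewrite /annular_mul_term /= V0 tensorm0l compm0.
Qed.

Definition annular_mul x y := Annular (annular_mul_finite x y).

Lemma tensorAA (X Z Z' T : C) : X ⊗ (Z ⊗ Z') ⊗ T = X ⊗ Z ⊗ (Z' ⊗ T).
Proof. by rewrite !tensorA. Qed.

(* (Rbar_k^* ⊗ 1_j ⊗ 1_k)(1_k ⊗ (x^kbar_{j,i})^* ⊗ 1_k)(1_k ⊗ 1_i ⊗ R_k) *)
Definition annular_star_coef (x : annular) (i j : I) (k : Irr C) :
    mor (irr D k ⊗ Y i) (Y j ⊗ irr D k) :=
  to_eq (tensor1o (Y j ⊗ irr D k))
  ∘ ((solbar D k)^† ⊠ (1_[Y j] ⊠ 1_[irr D k]))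
  ∘ to_eq (tensorAA (irr D k) (irr D (conj_irr D k)) (Y j) (irr D k))
  ∘ (1_[irr D k] ⊠ (x j i (conj_irr D k))^† ⊠ 1_[irr D k])
  ∘ to_eq (esym (tensorAA (irr D k) (Y i) (irr D (conj_irr D k)) (irr D k)))
  ∘ (1_[irr D k] ⊠ 1_[Y i] ⊠ sol D k)
  ∘ to_eq (esym (tensoro1 (irr D k ⊗ Y i))).

Lemma annular_star_finite x : finite_set (annular_support (annular_star_coef x)).
Proof.
apply: (sub_finite_set _ (finite_image
  (fun t : I * I * Irr C => ((t.1.2, t.1.1), conj_irr D t.2)) (coef_finite x))).
move=> -[[i j] k] /= nz; exists (j, i, conj_irr D k); last by rewrite /= conj_irrK.
move=> /= x0; apply: nz.
by rewrite /annular_star_coef x0 adj0 tensorm0r tensorm0l compm0 !comp0m.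
Qed.

Definition annular_star x := Annular (annular_star_finite x).

End Annular.

Record hilbert (R : realType) := Hilbert {
  hspace :> completeNormedModType R[i] ;
  hdot : {dot hspace for Num.conj} ;
  hdot_norm : forall x, hdot x x = `|x| ^+ 2 }.

Arguments hdot {R _}.

Section HilbertOfForm.
Context {R : realType} {V : lmodType R[i]} (form : {dot V for (@Num.conj R[i])}).

Lemma form_CauchySchwarz (u v : V) :
  `|form u v| <= sqrtC (form u u) * sqrtC (form v v).
Proof.
have [->|vN0] := eqVneq v 0.
  by rewrite !linear0r sqrtC0 mulr0 normr0.
have v_gt0 : 0 < form v v by rewrite dnorm_gt0.
have := dnorm_ge0 form (u - (form u v / form v v) *: v).
rewrite dnormB dnormZ linearZr_LR /= -[form u v * _]mulrC.
have vvR : (form v v)^* = form v v by apply/CrealP; rewrite ger0_real// ltW.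
rewrite normCK !rmorphM /= !fmorphV /= !vvR conjCK.
set a := form u v; set b := form v v in v_gt0 *.
have -> : form u u + b^-1 * a * (b^-1 * a^* ) * b - (b^-1 * a^* * a + b^-1 * a * a^* )
    = form u u - a * a^* / b by field; rewrite gt_eqF.
rewrite -normCK subr_ge0 ler_pdivrMr// => h.
rewrite -(@ler_pXn2r _ 2)// ?nnegrE ?mulr_ge0 ?sqrt_dnorm_ge0//.
by rewrite exprMn !sqrtCK.
Qed.

Definition normed_by_form : Type := (fun _ : V -> V -> R[i] => (V : Type)) form.

HB.instance Definition _ := GRing.Lmodule.on normed_by_form.

Lemma form_norm_triangle (x y : normed_by_form) :
  sqrtC (form (x + y) (x + y)) <= sqrtC (form x x) + sqrtC (form y y).
Proof.
rewrite -(@ler_pXn2r _ 2)// ?nnegrE ?addr_ge0 ?sqrt_dnorm_ge0//.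
rewrite sqrrD !sqrtCK dnormD addrAC lerD2r lerD2l.
have -> : form x y + (form x y)^* = 'Re (form x y) *+ 2.
  by rewrite ReE -mulr_natr divfK ?pnatr_eq0.
rewrite lerMn2r /=; apply: le_trans (form_CauchySchwarz x y).
by have := leif_Re_Creal (form x y); case.
Qed.

Lemma form_normZ (a : R[i]) (x : normed_by_form) :
  sqrtC (form (a *: x) (a *: x)) = `|a| * sqrtC (form x x).
Proof.
by rewrite dnormZ sqrtCM ?nnegrE ?exprn_ge0 ?dnorm_ge0// sqrCK.
Qed.

Lemma form_norm0 (x : normed_by_form) : sqrtC (form x x) = 0 -> x = 0.
Proof. by move=> /eqP; rewrite sqrt_dnorm_eq0 => /eqP. Qed.

HB.instance Definition _ := Lmodule_isNormed.Build R[i] normed_by_form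
  form_norm_triangle form_normZ form_norm0.

Lemma form_normE (x : normed_by_form) : `|x| = sqrtC (form x x).
Proof. by []. Qed.

Definition form_complete := forall F : set_system normed_by_form,
  ProperFilter F -> cauchy F -> cvg F.

End HilbertOfForm.

Section HilbertOfCompleteForm.
Context {R : realType} {V : lmodType R[i]} (form : {dot V for (@Num.conj R[i])}).
Hypothesis formC : form_complete form.

Definition complete_by_form : Type := (fun _ : form_complete form => normed_by_form form) formC.

HB.instance Definition _ := NormedModule.on complete_by_form.
HB.instance Definition _ := Uniform_isComplete.Build complete_by_form formC.

Definition complete_form (x y : complete_by_form) : R[i] := form x y.

Lemma complete_form_bilinear :
  bilinear_for *%R (Num.conj \; *%R) complete_form.
Proof.
split=> [y a x x'|x a y y']; rewrite /complete_form.
  exact: (linearPl form y a x x').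
exact: (linearPr form x a y y').
Qed.

HB.instance Definition _ := @bilinear_isBilinear.Build R[i]
  complete_by_form complete_by_form R[i] *%R (Num.conj \; *%R) complete_form complete_form_bilinear.

Lemma complete_form_hermitian (x y : complete_by_form) :
  complete_form x y = (-1) ^+ false * Num.conj (complete_form y x).
Proof. exact: hermitian_subproof. Qed.

HB.instance Definition _ := @isHermitianSesquilinear.Build R[i] complete_by_form
  false Num.conj complete_form complete_form_hermitian.

Lemma complete_form_gt0 (x : complete_by_form) : x != 0 -> 0 < complete_form x x.
Proof. by move=> xN0; rewrite /complete_form dnorm_gt0. Qed.

HB.instance Definition _ := @isDotProduct.Build R[i] complete_by_form
  complete_form complete_form_gt0.

Lemma form_sqr_norm (x : complete_by_form) : complete_form x x = `|x| ^+ 2.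
Proof. by rewrite [`|x|]form_normE sqrtCK. Qed.

Definition hilbert_of_form : hilbert R :=
  @Hilbert R complete_by_form complete_form form_sqr_norm.

End HilbertOfCompleteForm.

Section HilbertSum.
Context {R : realType} (H K : hilbert R).

Definition sum_form (p q : H * K) : R[i] := hdot p.1 q.1 + hdot p.2 q.2.

Lemma sum_form_bilinear : bilinear_for *%R (Num.conj \; *%R) sum_form.
Proof.
split=> [q a p p'|q a p p']; rewrite /sum_form /=.
  by rewrite !linearPl /=; ring.
by rewrite !linearPr /=; ring.
Qed.

HB.instance Definition _ := @bilinear_isBilinear.Build R[i]
  (H * K)%type (H * K)%type R[i] *%R (Num.conj \; *%R) sum_form sum_form_bilinear.

Lemma sum_form_hermitian (p q : H * K) :
  sum_form p q = (-1) ^+ false * Num.conj (sum_form q p).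
Proof.
by rewrite mul1r /sum_form rmorphD /= (hermC hdot p.1) (hermC hdot p.2) !mul1r.
Qed.

HB.instance Definition _ := @isHermitianSesquilinear.Build R[i] (H * K)%type
  false Num.conj sum_form sum_form_hermitian.

Lemma sum_form_gt0 (p : H * K) : p != 0 -> 0 < sum_form p p.
Proof.
case: p => x y xy; rewrite lt_def addr_ge0 ?dnorm_ge0// andbT.
apply: contraNneq xy; rewrite /sum_form /= => /eqP.
by rewrite paddr_eq0 ?dnorm_ge0// !dnorm_eq0 => /andP[/eqP-> /eqP->].
Qed.

HB.instance Definition _ := @isDotProduct.Build R[i] (H * K)%type
  sum_form sum_form_gt0.

Local Notation HK := (normed_by_form sum_form).

Lemma sum_norm (p : HK) : `|p| ^+ 2 = `|p.1| ^+ 2 + `|p.2| ^+ 2.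
Proof. by rewrite form_normE sqrtCK /= /sum_form !hdot_norm. Qed.

Lemma sum_norm1 (p : HK) : `|p.1| <= `|p|.
Proof. by rewrite -(@ler_pXn2r _ 2)// ?nnegrE// sum_norm lerDl exprn_ge0. Qed.

Lemma sum_norm2 (p : HK) : `|p.2| <= `|p|.
Proof. by rewrite -(@ler_pXn2r _ 2)// ?nnegrE// sum_norm lerDr exprn_ge0. Qed.

Lemma sum_normD (p : HK) : `|p| <= `|p.1| + `|p.2|.
Proof.
rewrite -(@ler_pXn2r _ 2)// ?nnegrE ?addr_ge0// sum_norm sqrrD.
by rewrite -addrA [_ *+ 2 + _]addrC addrA lerDl mulrn_wge0 ?mulr_ge0.
Qed.

Lemma sum_complete : form_complete sum_form.
Proof.
move=> F FF /cauchy_ballP cF.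
have c1 : cvg ((fun p : HK => p.1 : H) @ F).
  apply: cauchy_cvg; apply/cauchy_ballP => e e0.
  have [[A B] /= [FA FB] AB] := cF e e0.
  exists ((fun x : H => exists2 p : HK, A p & p.1 = x),
          (fun x : H => exists2 p : HK, B p & p.1 = x)).
    by split; [apply: filterS FA|apply: filterS FB] => p Ap; exists p.
  move=> [_ _] /= [[p Ap <-] [q Bq <-]].
  have := AB (p, q) (conj Ap Bq); rewrite -!ball_normE /=.
  exact: le_lt_trans (sum_norm1 (p - q)).
have c2 : cvg ((fun p : HK => p.2 : K) @ F).
  apply: cauchy_cvg; apply/cauchy_ballP => e e0.
  have [[A B] /= [FA FB] AB] := cF e e0.
  exists ((fun x : K => exists2 p : HK, A p & p.2 = x),
          (fun x : K => exists2 p : HK, B p & p.2 = x)).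
    by split; [apply: filterS FA|apply: filterS FB] => p Ap; exists p.
  move=> [_ _] /= [[p Ap <-] [q Bq <-]].
  have := AB (p, q) (conj Ap Bq); rewrite -!ball_normE /=.
  exact: le_lt_trans (sum_norm2 (p - q)).
move/cvg_ex: c1 => [x /cvgrPdist_lt cx]; move/cvg_ex: c2 => [y /cvgrPdist_lt cy].
apply/cvg_ex; exists ((x, y) : HK); apply/cvgrPdist_lt => e e0.
have e2 : 0 < e / 2 by rewrite divr_gt0.
apply: filterS2 (cx _ e2) (cy _ e2) => p h1 h2.
rewrite (splitr e); apply: le_lt_trans (ltrD h1 h2).
exact: sum_normD ((x, y) - p : HK).
Qed.

Definition hilbert_sum : hilbert R := hilbert_of_form sum_complete.

End HilbertSum.

Section HilbertZero.
Context {R : realType}.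

Definition zero_form (x y : 'rV[R[i]]_0) : R[i] := 0.

Lemma zero_form_bilinear : bilinear_for *%R (Num.conj \; *%R) zero_form.
Proof. by split=> u a x y /=; rewrite /zero_form mulr0 addr0. Qed.

HB.instance Definition _ := @bilinear_isBilinear.Build R[i]
  'rV[R[i]]_0 'rV[R[i]]_0 R[i] *%R (Num.conj \; *%R) zero_form zero_form_bilinear.

Lemma zero_form_hermitian (x y : 'rV[R[i]]_0) :
  zero_form x y = (-1) ^+ false * Num.conj (zero_form y x).
Proof. by rewrite /zero_form rmorph0 mulr0. Qed.

HB.instance Definition _ := @isHermitianSesquilinear.Build R[i] 'rV[R[i]]_0
  false Num.conj zero_form zero_form_hermitian.

Lemma zero_form_gt0 (x : 'rV[R[i]]_0) : x != 0 -> 0 < zero_form x x.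
Proof. by rewrite thinmx0 eqxx. Qed.

HB.instance Definition _ := @isDotProduct.Build R[i] 'rV[R[i]]_0
  zero_form zero_form_gt0.

Lemma zero_complete : form_complete zero_form.
Proof.
move=> F FF _; apply/cvg_ex; exists 0; apply/cvgrPdist_lt => e e0.
by apply: nearW => x; rewrite (thinmx0 x) subrr normr0.
Qed.

Definition hilbert_zero : hilbert R := hilbert_of_form zero_complete.

Lemma hilbert_zeroE (x : hilbert_zero) : x = 0.
Proof. exact: thinmx0. Qed.

End HilbertZero.

Section BoundedOperators.
Context {R : realType}.
Implicit Types H K L : hilbert R.

Definition bounded_operator H K (f : H -> K) : Prop :=
  linear f /\ exists M : R[i], forall x, `|f x| <= M * `|x|.

Lemma bounded_ge0 H K (f : H -> K) : bounded_operator f ->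
  exists2 M : R[i], 0 <= M & forall x, `|f x| <= M * `|x|.
Proof.
move=> [_ [M fM]]; exists `|M| => // x.
have := fM x; rewrite -(ger0_norm (le_trans (normr_ge0 _) (fM x))).
by rewrite normrM normr_id.
Qed.

Lemma bounded_id H : bounded_operator (fun x : H => x).
Proof. by split=> //; exists 1 => x; rewrite mul1r. Qed.

Lemma bounded_zero H K : bounded_operator (fun _ : H => 0 : K).
Proof.
split; first by move=> a x y; rewrite scaler0 addr0.
by exists 0 => x; rewrite mul0r normr0.
Qed.

Lemma bounded_comp H K L (g : K -> L) (f : H -> K) :
  bounded_operator g -> bounded_operator f -> bounded_operator (g \o f).
Proof.
move=> gb fb; split; first by move=> a x y /=; rewrite fb.1 gb.1.
have [M M0 gM] := bounded_ge0 gb; have [N N0 fN] := bounded_ge0 fb.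
exists (M * N) => x /=; rewrite (le_trans (gM _))// -mulrA ler_wpM2l//.
Qed.

Lemma bounded_sub H K (f g : H -> K) :
  bounded_operator f -> bounded_operator g -> bounded_operator (f - g).
Proof.
move=> [fl [M fM]] [gl [N gN]]; split.
  move=> a x y; rewrite !fctE fl gl scalerBr opprD !addrA; congr (_ + _).
  by rewrite -!addrA; congr (_ + _); rewrite addrC.
exists (M + N) => x; rewrite fctE mulrDl.
exact: le_trans (ler_normB _ _) (lerD (fM x) (gN x)).
Qed.

Lemma bounded_pair H K L (f : H -> K) (g : H -> L) :
  bounded_operator f -> bounded_operator g ->
  bounded_operator (fun x => (f x, g x) : hilbert_sum K L).
Proof.
move=> [fl [M fM]] [gl [N gN]]; split; first by move=> a x y; rewrite fl gl.
exists (M + N) => x; rewrite mulrDl.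
apply: le_trans (lerD (fM x) (gN x)).
exact: (sum_normD ((f x, g x) : normed_by_form (@sum_form _ K L))).
Qed.

Lemma bounded_fst H K : bounded_operator (fun p : hilbert_sum H K => p.1).
Proof. by split=> //; exists 1 => p; rewrite mul1r; exact: sum_norm1. Qed.

Lemma bounded_snd H K : bounded_operator (fun p : hilbert_sum H K => p.2).
Proof. by split=> //; exists 1 => p; rewrite mul1r; exact: sum_norm2. Qed.

End BoundedOperators.

Record additiveCategory := AdditiveCategory {
  aobj :> Type ;
  hom : aobj -> aobj -> zmodType ;
  hid : forall X, hom X X ;
  hcomp : forall X Y Z, hom Y Z -> hom X Y -> hom X Z ;
  hcompA : forall X Y Z T (h : hom Z T) (g : hom Y Z) (f : hom X Y),
    hcomp h (hcomp g f) = hcomp (hcomp h g) f ;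
  hcomp1f : forall X Y (f : hom X Y), hcomp (hid Y) f = f ;
  hcompf1 : forall X Y (f : hom X Y), hcomp f (hid X) = f ;
  hcompDl : forall X Y Z (g g' : hom Y Z) (f : hom X Y),
    hcomp (g + g') f = hcomp g f + hcomp g' f ;
  hcompDr : forall X Y Z (g : hom Y Z) (f f' : hom X Y),
    hcomp g (f + f') = hcomp g f + hcomp g f' ;
  zero_object : exists Z, hid Z = 0 ;
  biproducts : forall X Y, exists P (i : hom X P) (j : hom Y P)
    (p : hom P X) (q : hom P Y),
    [/\ hcomp p i = hid X, hcomp q j = hid Y, hcomp p j = 0, hcomp q i = 0
      & hcomp i p + hcomp j q = hid P] }.

Arguments hom {_} _ _.
Arguments hid {_} X.
Arguments hcomp {_ X Y Z} _ _.

Record additiveFunctor (A B : additiveCategory) := AdditiveFunctor {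
  fobj :> A -> B ;
  fmap : forall X Y : A, hom X Y -> hom (fobj X) (fobj Y) ;
  fmap1 : forall X : A, fmap (hid X) = hid (fobj X) ;
  fmap_comp : forall (X Y Z : A) (g : hom Y Z) (f : hom X Y),
    fmap (hcomp g f) = hcomp (fmap g) (fmap f) ;
  fmapD : forall (X Y : A) (f g : hom X Y), fmap (f + g) = fmap f + fmap g }.

Arguments fmap {A B} _ {X Y} _.

Definition is_iso (A : additiveCategory) (X Y : A) (f : hom X Y) : Prop :=
  exists g : hom Y X, hcomp g f = hid X /\ hcomp f g = hid Y.

Definition additively_equivalent (A B : additiveCategory) : Prop :=
  exists (F : additiveFunctor A B) (G : additiveFunctor B A),
    (exists eta : forall X : A, hom (G (F X)) X,
      (forall X, is_iso (eta X)) /\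
      forall (X Y : A) (f : hom X Y),
        hcomp f (eta X) = hcomp (eta Y) (fmap G (fmap F f))) /\
    (exists eps : forall X : B, hom (F (G X)) X,
      (forall X, is_iso (eps X)) /\
      forall (X Y : B) (f : hom X Y),
        hcomp f (eps X) = hcomp (eps Y) (fmap F (fmap G f))).

Section Representations.
Context {R : realType} {C : rigidTensorCategory R} (D : irrData C).
Context {I : choiceType} (Y : I -> C).

Record representation := Representation {
  carrier :> hilbert R ;
  action : annular D Y -> carrier -> carrier ;
  action_bounded : forall x, bounded_operator (action x) ;
  action_linear : forall (a : R[i]) (x y : annular D Y) (xi : carrier),
    action (a *: x + y) xi = a *: action x xi + action y xi ;
  action_mul : forall (x y : annular D Y) (xi : carrier),
    action (annular_mul x y) xi = action x (action y xi) ;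
  (* pi(x^#) is the adjoint of pi(x) *)
  action_star : forall (x : annular D Y) (xi eta : carrier),
    hdot (action x xi) eta = hdot xi (action (annular_star x) eta) ;
  action_nondegenerate : forall xi : carrier,
    (forall x, action x xi = 0) -> xi = 0 }.

Section Intertwiners.
Variables U V : representation.

Definition is_intertwiner : {pred U -> V} := fun f =>
  `[< bounded_operator f /\ forall x xi, f (action x xi) = action x (f xi) >].

Lemma is_intertwinerP f : reflect
  (bounded_operator f /\ forall x xi, f (action x xi) = action x (f xi))
  (f \in is_intertwiner).
Proof. exact: asboolP. Qed.

Lemma action0 x : action x (0 : V) = 0.
Proof.
by have := (action_bounded V x).1 (-1) 0 0;
  rewrite !scaleN1r !oppr0 !addr0 addNr.
Qed.

Lemma is_intertwiner_zmod_closed : zmod_closed is_intertwiner.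
Proof.
split=> [|f g /is_intertwinerP[fb fi] /is_intertwinerP[gb gi]]; apply/is_intertwinerP.
  by split=> [|x xi]; [exact: bounded_zero|rewrite /= action0].
split=> [|x xi]; first exact: bounded_sub.
rewrite !fctE fi gi; have := (action_bounded V x).1 (-1) (g xi) (f xi).
by rewrite !scaleN1r => e; rewrite [LHS]addrC -e addrC.
Qed.

HB.instance Definition _ :=
  GRing.isZmodClosed.Build (U -> V) is_intertwiner is_intertwiner_zmod_closed.

Record intertwiner := Intertwiner {
  intertwiner_fun :> U -> V ;
  intertwiner_funP : intertwiner_fun \in is_intertwiner }.

HB.instance Definition _ := [isSub for intertwiner_fun].
HB.instance Definition _ := [Choice of intertwiner by <:].
HB.instance Definition _ := [SubChoice_isSubZmodule of intertwiner by <:].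

Lemma intertwiner_eq (f g : intertwiner) : (forall xi, f xi = g xi) -> f = g.
Proof. by move=> fg; apply/val_inj/functional_extensionality_dep. Qed.

End Intertwiners.

Arguments is_intertwiner : clear implicits.

Lemma intertwinerD U V (f g : intertwiner U V) xi : (f + g) xi = f xi + g xi.
Proof. by []. Qed.

Lemma intertwiner_id_subproof (U : representation) :
  (fun xi : U => xi) \in is_intertwiner U U.
Proof. by apply/is_intertwinerP; split=> //; exact: bounded_id. Qed.

Definition intertwiner_id U := Intertwiner (@intertwiner_id_subproof U).

Lemma intertwiner_comp_subproof U V W (g : intertwiner V W) (f : intertwiner U V) :
  g \o f \in is_intertwiner U W.
Proof.
have [/is_intertwinerP[gb gi] /is_intertwinerP[fb fi]] :=
  (intertwiner_funP g, intertwiner_funP f).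
apply/is_intertwinerP; split=> [|x xi /=]; first exact: bounded_comp.
by rewrite fi gi.
Qed.

Definition intertwiner_comp U V W (g : intertwiner V W) (f : intertwiner U V) :=
  Intertwiner (intertwiner_comp_subproof g f).

Lemma intertwiner_compDr U V W (g : intertwiner V W) (f f' : intertwiner U V) :
  intertwiner_comp g (f + f') = intertwiner_comp g f + intertwiner_comp g f'.
Proof.
apply: intertwiner_eq => xi.
have /is_intertwinerP[[gl _] _] := intertwiner_funP g.
have := gl 1 (f xi) (f' xi); rewrite !scale1r; exact.
Qed.

Lemma zero_action_linear (a : R[i]) (x y : annular D Y) (xi : @hilbert_zero R) :
  xi = a *: xi + xi.
Proof. by rewrite [LHS]hilbert_zeroE [RHS]hilbert_zeroE. Qed.

Definition representation_zero : representation :=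
  @Representation (@hilbert_zero R) (fun _ xi => xi)
    (fun=> bounded_id hilbert_zero) zero_action_linear
    (fun _ _ _ => erefl) (fun _ _ _ => erefl) (fun xi _ => hilbert_zeroE xi).

Section Sum.
Variables U V : representation.

Definition sum_action (x : annular D Y) (p : hilbert_sum U V) : hilbert_sum U V :=
  (action x p.1, action x p.2).

Lemma sum_action_bounded x : bounded_operator (sum_action x).
Proof.
apply: bounded_pair.
  exact: (bounded_comp (action_bounded U x) (bounded_fst U V)).
exact: (bounded_comp (action_bounded V x) (bounded_snd U V)).
Qed.

Lemma sum_action_linear a x y p :
  sum_action (a *: x + y) p = a *: sum_action x p + sum_action y p.
Proof. by rewrite /sum_action !action_linear. Qed.

Lemma sum_action_mul x y p :
  sum_action (annular_mul x y) p = sum_action x (sum_action y p).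
Proof. by rewrite /sum_action !action_mul. Qed.

Lemma sum_action_star x p q :
  hdot (sum_action x p) q = hdot p (sum_action (annular_star x) q).
Proof.
rewrite [LHS]/(sum_form _ _) [RHS]/(sum_form _ _) /sum_form /=.
by rewrite !action_star.
Qed.

Lemma sum_action_nondegenerate p : (forall x, sum_action x p = 0) -> p = 0.
Proof.
case: p => u v h; congr pair; apply: action_nondegenerate => x.
  exact: (congr1 fst (h x)).
exact: (congr1 snd (h x)).
Qed.

Definition representation_sum : representation :=
  Representation sum_action_bounded sum_action_linear sum_action_mul
    sum_action_star sum_action_nondegenerate.

Lemma inl_subproof :
  (fun u : U => (u, 0) : representation_sum) \in is_intertwiner U representation_sum.
Proof.
apply/is_intertwinerP; split.
  exact: (bounded_pair (bounded_id U) (bounded_zero U V)).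
by move=> x xi; congr pair; rewrite /= action0.
Qed.

Lemma inr_subproof :
  (fun v : V => (0, v) : representation_sum) \in is_intertwiner V representation_sum.
Proof.
apply/is_intertwinerP; split.
  exact: (bounded_pair (bounded_zero V U) (bounded_id V)).
by move=> x xi; congr pair; rewrite /= action0.
Qed.

Lemma fst_subproof : (fun p : representation_sum => p.1) \in is_intertwiner representation_sum U.
Proof. by apply/is_intertwinerP; split=> //; exact: bounded_fst. Qed.

Lemma snd_subproof : (fun p : representation_sum => p.2) \in is_intertwiner representation_sum V.
Proof. by apply/is_intertwinerP; split=> //; exact: bounded_snd. Qed.

End Sum.

Lemma representation_zero_object : exists Z, intertwiner_id Z = 0.
Proof.
exists representation_zero; apply: intertwiner_eq => xi.
by rewrite [LHS]hilbert_zeroE [RHS]hilbert_zeroE.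
Qed.

Lemma representation_biproducts U V : exists P (i : intertwiner U P)
  (j : intertwiner V P) (p : intertwiner P U) (q : intertwiner P V),
  [/\ intertwiner_comp p i = intertwiner_id U,
      intertwiner_comp q j = intertwiner_id V,
      intertwiner_comp p j = 0, intertwiner_comp q i = 0
    & intertwiner_comp i p + intertwiner_comp j q = intertwiner_id P].
Proof.
exists (representation_sum U V), (Intertwiner (inl_subproof U V)),
  (Intertwiner (inr_subproof U V)), (Intertwiner (fst_subproof U V)),
  (Intertwiner (snd_subproof U V)).
split; apply: intertwiner_eq => // -[u v]; rewrite intertwinerD /=.
by congr pair; rewrite ?addr0 ?add0r.
Qed.

Lemma intertwiner_compA U V W Z (h : intertwiner W Z) (g : intertwiner V W)
    (f : intertwiner U V) :
  intertwiner_comp h (intertwiner_comp g f) = intertwiner_comp (intertwiner_comp h g) f.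
Proof. exact: intertwiner_eq. Qed.

Lemma intertwiner_comp1f U V (f : intertwiner U V) :
  intertwiner_comp (intertwiner_id V) f = f.
Proof. exact: intertwiner_eq. Qed.

Lemma intertwiner_compf1 U V (f : intertwiner U V) :
  intertwiner_comp f (intertwiner_id U) = f.
Proof. exact: intertwiner_eq. Qed.

Lemma intertwiner_compDl U V W (g g' : intertwiner V W) (f : intertwiner U V) :
  intertwiner_comp (g + g') f = intertwiner_comp g f + intertwiner_comp g' f.
Proof. exact: intertwiner_eq. Qed.

Definition Rep : additiveCategory := AdditiveCategory
  intertwiner_compA intertwiner_comp1f intertwiner_compf1
  intertwiner_compDl intertwiner_compDr
  representation_zero_object representation_biproducts.

End Representations.

(* Every simple object is isomorphic to a subobject of some Y_i. *)
Definition full {R : realType} {C : cstarCategory R} {I : Type} (Y : I -> C) : Prop :=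
  forall X : C, simple X -> exists (i : I) (v : mor X (Y i)), isometry v.

(* Main.v *)
Require Import Defs.
From HB Require Import structures.
From mathcomp Require Import all_boot all_order all_algebra.
From mathcomp Require Import sesquilinear complex ring.
From mathcomp Require Import all_classical reals topology normedtype.
(* [compA], among others, is also the name of a lemma of MathComp. *)
Import Defs.

(* All the objects of C are put into one annular category: a morphism A -> B is
   a finitely supported family of morphisms X_k ⊗ A -> B ⊗ X_k, C acts on it
   from both sides, and an annular algebra consists of the finite matrices over
   it.  If every Z_j is a finite sum of pieces of the Y_i, given by maps w with
   sum w^* w = 1 at each j, then c |-> (w' c w^* ) turns matrices indexed by Z
   into matrices indexed by Y, so a representation U of the annular algebra of Y
   induces one of that of Z, on the l^2 functions from pieces to U that are fixed
   by the matrices of the units.  Inducing from Y to Z and back to Y gives again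
   U: x is mapped to the family of its components x_{i,b} = w'_{i,b} x.  This is
   a bounded intertwiner by Bessel's inequality, injective by nondegeneracy, and
   onto because square summable orthogonal families of vectors are summable.
   Two full weight sets dominate each other in this way. *)

Set Implicit Arguments.
Unset Strict Implicit.
Unset Printing Implicit Defensive.

Import Order.TTheory GRing.Theory Num.Theory.

Local Open Scope classical_set_scope.
Local Open Scope ring_scope.
Local Open Scope cstar_scope.

(** * Strict tensor calculus *)

(** Induction is usually the completion of a tensor product of the algebra with the representation,
    for a form whose positivity has to be proved, as well as the boundedness of the action. Cutting
    by [w] gives both directly: since the sum of w^* w is 1 at each j, the matrix (w_b 1 w_a^* ) of
    operators on U is a self-adjoint idempotent, whose range in l^2 inherits a scalar product, and
    an element of the annular algebra has finitely many nonzero blocks, each acting by a finite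
    matrix of bounded operators of U. Identities between matrices come from inserting that sum and
    multiplying inside U.

    An infinite weight set gives an algebra that has only the units 1_i of the single weights. They
    act by mutually orthogonal projections, and nondegeneracy says that no nonzero vector is killed
    by all of them. Hence vectors must be glued from their components, and norms controlled along
    the way.

    The bases [onb] and the solutions [sol] are arbitrary choices. That the units 1_i are neutral
    and self-adjoint whatever these choices takes a computation with scalars; the compatibility with
    the weights is naturality. *)

Section MorphismLinearity.
Context {R : realType} {C : cstarCategory R}.
Implicit Types X Y Z : C.

Lemma compmD X Y Z (g : mor Y Z) (f f' : mor X Y) :
  g ∘ (f + f') = g ∘ f + g ∘ f'.
Proof. by have := comp_linearr g 1 f f'; rewrite !scale1r. Qed.

Lemma comp_sumr X Y Z (I : Type) (r : seq I) (f : I -> mor X Y) (g : mor Y Z) :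
  g ∘ (\sum_(a <- r) f a) = \sum_(a <- r) g ∘ f a.
Proof. exact: (big_morph (mcomp g) (fun f f' => compmD g f f') (compm0 X g)). Qed.

Lemma comp_suml_seq X Y Z (I : Type) (r : seq I) (g : I -> mor Y Z) (f : mor X Y) :
  (\sum_(a <- r) g a) ∘ f = \sum_(a <- r) g a ∘ f.
Proof. exact: (big_morph (fun h => h ∘ f) (fun g g' => compDm g g' f) (comp0m Z f)). Qed.

Lemma adjZ X Y a (f : mor X Y) : (a *: f)^† = Num.conj a *: f^†.
Proof. by have := adj_antilinear a f 0; rewrite adj0 !addr0. Qed.

Lemma adj1 X : 1_[X]^† = 1_[X].
Proof. by have := adj_comp 1_[X]^† 1_[X]; rewrite adjK !compm1 adjK => <-. Qed.

Lemma to_eq_id X (e : X = X) : to_eq e = 1_[X].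
Proof. by rewrite (Prop_irrelevance e erefl). Qed.

End MorphismLinearity.

Section StrictEquality.
Context {R : realType} {C : rigidTensorCategory R}.
Implicit Types X Y Z T : C.

(* Equality up to the identifications [to_eq]: in this relation the
   associativity and unit isomorphisms disappear. *)
Definition meq X Y X' Y' (f : mor X Y) (f' : mor X' Y') : Prop :=
  exists (eX : X = X') (eY : Y = Y'), to_eq eY ∘ f = f' ∘ to_eq eX.

Local Notation "f ≈ g" := (meq f g) (at level 70).

Lemma meq_refl X Y (f : mor X Y) : f ≈ f.
Proof. by exists erefl, erefl; rewrite /= comp1m compm1. Qed.

Lemma meq_sym X Y X' Y' (f : mor X Y) (f' : mor X' Y') : f ≈ f' -> f' ≈ f.
Proof.
move=> [eX [eY]]; case: _ / eX f' => f'; case: _ / eY f' => f'.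
by rewrite /= comp1m compm1 => ->; exact: meq_refl.
Qed.

Lemma meq_trans X Y X' Y' X'' Y'' (f : mor X Y) (f' : mor X' Y') (f'' : mor X'' Y'') :
  f ≈ f' -> f' ≈ f'' -> f ≈ f''.
Proof.
move=> [eX [eY]]; case: _ / eX f' => f'; case: _ / eY f' => f'.
by rewrite /= comp1m compm1 => ->.
Qed.

Lemma meq_eq X Y (f f' : mor X Y) : f ≈ f' -> f = f'.
Proof. by move=> [eX [eY]]; rewrite !to_eq_id comp1m compm1. Qed.

(** Proof irrelevance lets the casts be prescribed, so that [meq] yields a rewriting rule sliding a
    given [to_eq] past a morphism. *)
Lemma meq_nat X Y X' Y' (f : mor X Y) (f' : mor X' Y') (eX : X = X') (eY : Y = Y') :
  f ≈ f' -> to_eq eY ∘ f = f' ∘ to_eq eX.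
Proof.
move=> [eX' [eY']].
by rewrite (Prop_irrelevance eX' eX) (Prop_irrelevance eY' eY).
Qed.

Lemma meq_tensor X Y Z T X' Y' Z' T' (f : mor X Y) (g : mor Z T)
    (f' : mor X' Y') (g' : mor Z' T') : f ≈ f' -> g ≈ g' -> f ⊠ g ≈ f' ⊠ g'.
Proof.
move=> [eX [eY]]; case: _ / eX f' => f'; case: _ / eY f' => f'.
rewrite /= comp1m compm1 => -> [eZ [eT]].
case: _ / eZ g' => g'; case: _ / eT g' => g'.
by rewrite /= comp1m compm1 => ->; exact: meq_refl.
Qed.

Lemma meq_to_eql X Y Z (e : Y = Z) (f : mor X Y) : to_eq e ∘ f ≈ f.
Proof. by case: _ / e; rewrite comp1m; exact: meq_refl. Qed.

Lemma meq_to_eqr X Y Z (e : X = Y) (f : mor Y Z) : f ∘ to_eq e ≈ f.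
Proof. by case: _ / e f => f; rewrite compm1; exact: meq_refl. Qed.

Lemma meq_assoc X X' Y Y' Z Z' (f : mor X X') (g : mor Y Y') (h : mor Z Z') :
  f ⊠ (g ⊠ h) ≈ f ⊠ g ⊠ h.
Proof.
exists (tensorA X Y Z), (tensorA X' Y' Z'); exact: tensormA.
Qed.

(** The unit object is a variable [T], because X_0 equals [tunit C] only propositionally. *)
Lemma meq_unitl T (eT : T = tunit C) X X' (f : mor X X') : 1_[T] ⊠ f ≈ f.
Proof. by subst T; exists (tensor1o X), (tensor1o X'); exact: tensor1m. Qed.

Lemma meq_unitr T (eT : T = tunit C) X X' (f : mor X X') : f ⊠ 1_[T] ≈ f.
Proof. by subst T; exists (tensoro1 X), (tensoro1 X'); exact: tensorm1r. Qed.

Lemma tensormZl X X' Y Y' a (f : mor X X') (g : mor Y Y') :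
  (a *: f) ⊠ g = a *: (f ⊠ g).
Proof. by have := tensorm_linearl g a f 0; rewrite tensorm0l !addr0. Qed.

Lemma tensormZr X X' Y Y' a (f : mor X X') (g : mor Y Y') :
  f ⊠ (a *: g) = a *: (f ⊠ g).
Proof. by have := tensorm_linearr f a g 0; rewrite tensorm0r !addr0. Qed.

End StrictEquality.

(** * The annular category *)

(** The list may be larger than the support, so that several sums can be brought to a common
    range. *)
Lemma fsumE (T : choiceType) (V : nmodType) (r : seq T) (F : T -> V) :
  uniq r -> (forall t, t \notin r -> F t = 0) ->
  \sum_(t \in [set: T]) F t = \sum_(t <- r) F t.
Proof.
move=> ur F0; rewrite (fsbigE r)//=; last by move=> t _ /F0.
by apply: eq_bigl => t; rewrite in_setT.
Qed.

Lemma finite_set_uniq_seq (T : choiceType) (A : set T) : finite_set A ->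
  exists2 r : seq T, uniq r & forall t, A t -> t \in r.
Proof.
move=> /finite_seqP[s ->]; exists (undup s); rewrite ?undup_uniq// => t /=.
by rewrite mem_undup.
Qed.

Section AnnularCategory.
Context {R : realType} {C : rigidTensorCategory R} (D : irrData C).

(* The annular algebra weighted by all objects: [ann A B] is the space of
   morphisms from A to B in the annular category. *)
Record ann (A B : C) := Ann {
  acoef :> forall k : Irr C, mor (irr D k ⊗ A) (B ⊗ irr D k) ;
  acoef_finite : finite_set [set k | acoef k <> 0] }.

Section Lmodule.
Context {A B : C}.

HB.instance Definition _ := gen_eqMixin (ann A B).
HB.instance Definition _ := gen_choiceMixin (ann A B).

Lemma annP (x y : ann A B) : (forall k, x k = y k) -> x = y.
Proof.
case: x y => [x hx] [y hy] /= xy.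
have exy : x = y by apply/functional_extensionality_dep.
by rewrite exy in hx *; congr Ann; exact: Prop_irrelevance.
Qed.

Lemma ann_zero_finite : finite_set [set k | (0 : mor (irr D k ⊗ A) (B ⊗ irr D k)) <> 0].
Proof. by apply: (sub_finite_set _ (finite_set0 _)) => t /=. Qed.

Lemma ann_lin_finite (a : R[i]) (x y : ann A B) :
  finite_set [set k | a *: x k + y k <> 0].
Proof.
have : finite_set ([set k | x k <> 0] `|` [set k | y k <> 0]).
  by rewrite finite_setU; split; exact: acoef_finite.
apply: sub_finite_set => k /= nz.
have [x0|xn0] := pselect (x k = 0); last by left.
by right=> y0; apply: nz; rewrite x0 y0 scaler0 addr0.
Qed.

Definition ann_zero := Ann ann_zero_finite.
Definition ann_lin a x y := Ann (ann_lin_finite a x y).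
Definition ann_add x y := ann_lin 1 x y.
Definition ann_opp x := ann_lin (-1) x ann_zero.
Definition ann_scale a x := ann_lin a x ann_zero.

Lemma ann_addA : associative ann_add.
Proof. by move=> x y z; apply: annP => k /=; rewrite !scale1r addrA. Qed.

Lemma ann_addC : commutative ann_add.
Proof. by move=> x y; apply: annP => k /=; rewrite !scale1r addrC. Qed.

Lemma ann_add0 : left_id ann_zero ann_add.
Proof. by move=> x; apply: annP => k /=; rewrite !scale1r add0r. Qed.

Lemma ann_addN : left_inverse ann_zero ann_opp ann_add.
Proof. by move=> x; apply: annP => k /=; rewrite scale1r scaleN1r addr0 addNr. Qed.

HB.instance Definition _ := GRing.isZmodule.Build (ann A B)
  ann_addA ann_addC ann_add0 ann_addN.

Lemma annDE (x y : ann A B) k : (x + y) k = x k + y k.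
Proof. by rewrite {1}/GRing.add /= scale1r. Qed.

Lemma ann_scaleE a (x : ann A B) k : ann_scale a x k = a *: x k.
Proof. by rewrite /= addr0. Qed.

Lemma ann_scaleA a b x : ann_scale a (ann_scale b x) = ann_scale (a * b) x.
Proof. by apply: annP => k; rewrite !ann_scaleE scalerA. Qed.

Lemma ann_scale1 : left_id 1 ann_scale.
Proof. by move=> x; apply: annP => k; rewrite ann_scaleE scale1r. Qed.

Lemma ann_scaleDr : right_distributive ann_scale +%R.
Proof. by move=> a x y; apply: annP => k; rewrite annDE !ann_scaleE annDE scalerDr. Qed.

Lemma ann_scaleDl x : {morph ann_scale^~ x : a b / a + b}.
Proof. by move=> a b; apply: annP => k; rewrite annDE !ann_scaleE scalerDl. Qed.

HB.instance Definition _ := GRing.Zmodule_isLmodule.Build R[i] (ann A B)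
  ann_scaleA ann_scale1 ann_scaleDr ann_scaleDl.

Lemma annZE a (x : ann A B) k : (a *: x) k = a *: x k.
Proof. exact: ann_scaleE. Qed.

Lemma annLE a (x y : ann A B) k : (a *: x + y) k = a *: x k + y k.
Proof. by rewrite (annDE (a *: x) y k) annZE. Qed.

Lemma ann0E k : (0 : ann A B) k = 0.
Proof. by []. Qed.

Lemma ann_sumE (I : Type) (r : seq I) (F : I -> ann A B) k :
  (\sum_(a <- r) F a) k = \sum_(a <- r) F a k.
Proof. exact: (big_morph (fun x : ann A B => x k) (fun x y => annDE x y k) (ann0E k)). Qed.

End Lmodule.

Lemma lact_finite A B B' (g : mor B B') (x : ann A B) :
  finite_set [set k | (g ⊠ 1_[irr D k]) ∘ x k <> 0].
Proof.
by apply: sub_finite_set (acoef_finite x) => k /= nz x0; apply: nz; rewrite x0 compm0.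
Qed.

Lemma ract_finite A A' B (x : ann A B) (g : mor A' A) :
  finite_set [set k | x k ∘ (1_[irr D k] ⊠ g) <> 0].
Proof.
by apply: sub_finite_set (acoef_finite x) => k /= nz x0; apply: nz; rewrite x0 comp0m.
Qed.

(** [lact g] amounts to multiplication by [lact g (ru _)], the morphism [g] seen in the component
    X_0 ([rmul_lact], [rmul1l]). *)
Definition lact A B B' (g : mor B B') (x : ann A B) := Ann (lact_finite g x).
Definition ract A A' B (x : ann A B) (g : mor A' A) := Ann (ract_finite x g).

(** [annular_mul_term] is an instance of this by conversion, which is how [block_mul] passes from
    the algebra to the annular category. With single coefficients [x] and [y], naturality and
    linearity can be stated termwise. *)
Definition aterm A S B (k m l : Irr C) (V : mor (irr D k) (irr D m ⊗ irr D l))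
    (x : mor (irr D m ⊗ S) (B ⊗ irr D m)) (y : mor (irr D l ⊗ A) (S ⊗ irr D l)) :
    mor (irr D k ⊗ A) (B ⊗ irr D k) :=
  (1_[B] ⊠ V^†) ∘ to_eq (esym (tensorA B (irr D m) (irr D l)))
  ∘ (x ⊠ 1_[irr D l]) ∘ to_eq (tensorA (irr D m) S (irr D l))
  ∘ (1_[irr D m] ⊠ y) ∘ to_eq (esym (tensorA (irr D m) (irr D l) A))
  ∘ (V ⊠ 1_[A]).

Lemma aterm0l A S B k m l (V : mor (irr D k) (irr D m ⊗ irr D l))
    (y : mor (irr D l ⊗ A) (S ⊗ irr D l)) : aterm V (0 : mor _ (B ⊗ _)) y = 0.
Proof. by rewrite /aterm tensorm0l compm0 !comp0m. Qed.

Lemma aterm0r A S B k m l (V : mor (irr D k) (irr D m ⊗ irr D l))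
    (x : mor (irr D m ⊗ S) (B ⊗ irr D m)) : aterm V x (0 : mor (_ ⊗ A) _) = 0.
Proof. by rewrite /aterm tensorm0r compm0 !comp0m. Qed.

Lemma aterm_linear_r A S B k m l (V : mor (irr D k) (irr D m ⊗ irr D l))
    (x : mor (irr D m ⊗ S) (B ⊗ irr D m)) :
  linear (aterm (A := A) V x).
Proof.
move=> a y y'; rewrite /aterm.
by rewrite tensorm_linearr comp_linearr !comp_linearl.
Qed.

(** By the interchange law [g] leaves past V^*, [h] crosses the middle from one factor to the other,
    and [f] leaves past V; [eg], [eh] and [ef] are these three moves. *)
Lemma aterm_nat A A' S S' B B' k m l (V : mor (irr D k) (irr D m ⊗ irr D l))
    (x : mor (irr D m ⊗ S) (B ⊗ irr D m)) (y : mor (irr D l ⊗ A) (S' ⊗ irr D l))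
    (g : mor B B') (h : mor S' S) (f : mor A' A) :
  aterm V ((g ⊠ 1_[_]) ∘ x ∘ (1_[_] ⊠ h)) (y ∘ (1_[_] ⊠ f)) =
  (g ⊠ 1_[_]) ∘ aterm V x ((h ⊠ 1_[_]) ∘ y) ∘ (1_[_] ⊠ f).
Proof.
have eg : (1_[B'] ⊠ V^†) ∘ to_eq (esym (tensorA B' (irr D m) (irr D l)))
    ∘ ((g ⊠ 1_[irr D m]) ⊠ 1_[irr D l])
  = (g ⊠ 1_[irr D k]) ∘ (1_[B] ⊠ V^†) ∘ to_eq (esym (tensorA B (irr D m) (irr D l))).
  rewrite -compA (@meq_nat _ _ _ _ _ _ _ (g ⊠ (1_[irr D m] ⊠ 1_[irr D l]))
    (esym (tensorA B (irr D m) (irr D l)))); last exact/meq_sym/meq_assoc.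
  by rewrite compA -!tensorm_comp tensorm1 !comp1m !compm1.
have eh : ((1_[irr D m] ⊠ h) ⊠ 1_[irr D l]) ∘ to_eq (tensorA (irr D m) S' (irr D l))
  = to_eq (tensorA (irr D m) S (irr D l)) ∘ (1_[irr D m] ⊠ (h ⊠ 1_[irr D l])).
  by rewrite tensormA.
have ef : (1_[irr D m] ⊠ (1_[irr D l] ⊠ f)) ∘ to_eq (esym (tensorA (irr D m) (irr D l) A'))
    ∘ (V ⊠ 1_[A'])
  = to_eq (esym (tensorA (irr D m) (irr D l) A)) ∘ (V ⊠ 1_[A]) ∘ (1_[irr D k] ⊠ f).
  rewrite -(@meq_nat _ _ _ _ _ _ ((1_[irr D m] ⊠ 1_[irr D l]) ⊠ f) _ _
    (esym (tensorA (irr D m) (irr D l) A))); last exact/meq_sym/meq_assoc.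
  by rewrite -!compA -!tensorm_comp tensorm1 !comp1m !compm1.
rewrite /aterm.
have -> : ((g ⊠ 1_[irr D m]) ∘ x ∘ (1_[irr D m] ⊠ h)) ⊠ 1_[irr D l]
  = ((g ⊠ 1_[irr D m]) ⊠ 1_[irr D l]) ∘ (x ⊠ 1_[irr D l])
    ∘ ((1_[irr D m] ⊠ h) ⊠ 1_[irr D l]) by rewrite -!tensorm_comp !comp1m.
have -> : 1_[irr D m] ⊠ (y ∘ (1_[irr D l] ⊠ f))
  = (1_[irr D m] ⊠ y) ∘ (1_[irr D m] ⊠ (1_[irr D l] ⊠ f)).
  by rewrite -!tensorm_comp !comp1m.
have -> : 1_[irr D m] ⊠ ((h ⊠ 1_[irr D l]) ∘ y)
  = (1_[irr D m] ⊠ (h ⊠ 1_[irr D l])) ∘ (1_[irr D m] ⊠ y).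
  by rewrite -!tensorm_comp !comp1m.
have := (eg, eh, ef).
set a1 := 1_[B'] ⊠ _; set a2 := to_eq _; set a3 := (g ⊠ _) ⊠ _.
set a4 := x ⊠ _; set a5 := (_ ⊠ h) ⊠ _; set a6 := to_eq _.
set a7 := _ ⊠ y; set a8 := _ ⊠ (_ ⊠ f); set a9 := to_eq _; set a10 := V ⊠ _.
move=> [[egg ehh] eff].
rewrite !compA egg -!compA; congr (_ ∘ (_ ∘ (_ ∘ (_ ∘ _)))).
rewrite !compA in ehh eff *; rewrite ehh -!compA.
by congr (_ ∘ (_ ∘ (_ ∘ _))); rewrite !compA eff.
Qed.

End AnnularCategory.

(** * Bases of one-dimensional morphism spaces *)

Section Orthonormal.
Context {R : realType} {C : cstarCategory R}.
Implicit Types X Y Z : C.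

Lemma simple_scaler_inj X a b : simple X -> a *: 1_[X] = b *: 1_[X] -> a = b.
Proof.
move=> [/eqP nz _] /eqP; rewrite -subr_eq0 -scalerBl scaler_eq0 (negPf nz) orbF.
by rewrite subr_eq0 => /eqP.
Qed.

(** Mor(X, Y) is the line through [u], and expanding [u] in the basis gives u = (sum of |c_a|^2) u.
    This normalization is what sums over [onb] require, since V enters them once and V^* once. *)
Lemma onb_unitary X Y n (V : 'I_n -> mor X Y) (u : mor X Y) :
  simple X -> is_onb V -> u^† ∘ u = 1_[X] -> u ∘ u^† = 1_[Y] ->
  exists c : 'I_n -> R[i],
    (forall a, V a = c a *: u) /\ \sum_a c a * Num.conj (c a) = 1.
Proof.
move=> sX [Vo Vs] uu1 uu2.
have Vu a : exists c, V a = c *: u.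
  have [c hc] := sX.2 (u^† ∘ V a); exists c.
  by rewrite -[LHS]comp1m -uu2 -compA hc compmZ compm1.
have [c hc] := choice Vu; exists c; split=> //.
have [d hd] := Vs u; apply: (simple_scaler_inj sX); rewrite scale1r.
(* The coefficients of [u] in the basis are conjugate to those of the basis in [u], both being
   scalar products. *)
have dc a : d a = Num.conj (c a).
  apply: (simple_scaler_inj sX).
  transitivity ((V a)^† ∘ u); last by rewrite hc adjZ compZm uu1.
  rewrite {1}hd comp_sumr (bigD1 a)//= big1 => [|b ba].
    by rewrite compmZ (Vo a a) eqxx scale1r addr0.
  by rewrite compmZ (Vo a b) eq_sym (negPf ba) scale0r scaler0.
rewrite -{1}uu1 -compmZ scaler_suml.
suff -> : \sum_a (c a * Num.conj (c a)) *: u = u by [].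
rewrite {2}hd; apply: eq_bigr => a _.
by rewrite hc dc scalerA mulrC.
Qed.

End Orthonormal.

(** * The product of the annular category *)

Section AnnularProduct.
Context {R : realType} {C : rigidTensorCategory R} (D : irrData C).

Definition rmul_coef A S B (x : ann D S B) (y : ann D A S) (k : Irr C) :
    mor (irr D k ⊗ A) (B ⊗ irr D k) :=
  \sum_(t \in [set: Irr C * Irr C]) \sum_v
    aterm (@onb _ _ D k t.1 t.2 v) (x t.1) (y t.2).

Lemma rmul_finite A S B (x : ann D S B) (y : ann D A S) :
  finite_set [set k | rmul_coef x y k <> 0].
Proof.
have : finite_set (\bigcup_(m in [set k | x k <> 0]) \bigcup_(l in [set k | y k <> 0])
    [set k : Irr C | exists f : mor (irr D k) (irr D m ⊗ irr D l), f <> 0]).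
  apply: bigcup_finite => [|m _]; first exact: acoef_finite.
  apply: bigcup_finite => [|l _]; first exact: acoef_finite.
  exact: finite_constituents.
apply: sub_finite_set => k /= nz.
have [[m l] [v tN0]] : exists (t : Irr C * Irr C) v,
    aterm (@onb _ _ D k t.1 t.2 v) (x t.1) (y t.2) <> 0.
  apply: contrapT => h; apply: nz; apply: fsbig1 => t _; apply: big1 => v _.
  by apply: contrapT => h'; apply: h; exists t, v.
exists m => /=; first by move=> x0; apply: tN0; rewrite x0 aterm0l.
exists l => /=; first by move=> y0; apply: tN0; rewrite y0 aterm0r.
exists (@onb _ _ D k m l v) => V0.
by apply: tN0; rewrite /aterm /= V0 tensorm0l compm0.
Qed.

Definition rmul A S B (x : ann D S B) (y : ann D A S) : ann D A B :=
  Ann (rmul_finite x y).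

Lemma rmulE A S B (x : ann D S B) (y : ann D A S) (r : seq (Irr C * Irr C)) k :
  uniq r ->
  (forall t v, t \notin r -> aterm (@onb _ _ D k t.1 t.2 v) (x t.1) (y t.2) = 0) ->
  rmul x y k = \sum_(t <- r) \sum_v aterm (@onb _ _ D k t.1 t.2 v) (x t.1) (y t.2).
Proof.
by move=> ur h; apply: fsumE => // t tr; apply: big1 => v _; exact: h.
Qed.

Lemma ann_support A B (x : ann D A B) :
  exists2 r : seq (Irr C), uniq r & forall k : Irr C, k \notin r -> x k = 0.
Proof.
have [r ur hr] := finite_set_uniq_seq (acoef_finite x); exists r => // k.
by apply: contraNP => x0; exact: hr.
Qed.

Lemma rmul_sum A S B (x : ann D S B) (y : ann D A S) (rx ry : seq (Irr C)) k :
  uniq rx -> uniq ry -> (forall m : Irr C, m \notin rx -> x m = 0) ->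
  (forall l : Irr C, l \notin ry -> y l = 0) ->
  rmul x y k = \sum_(m <- rx) \sum_(l <- ry) \sum_v
    aterm (@onb _ _ D k m l v) (x m) (y l).
Proof.
move=> urx ury hx hy; rewrite (rmulE (r := [seq (m, l) | m <- rx, l <- ry])).
- by rewrite big_allpairs_dep.
- by rewrite allpairs_uniq// => -[a b] [a' b'] _ _ [-> ->].
- move=> [m l] v tr /=; have [mr|/hx->] := boolP (m \in rx); last exact: aterm0l.
  have [lr|/hy->] := boolP (l \in ry); last exact: aterm0r.
  by exfalso; move/negP: tr; apply; apply/allpairsP; exists (m, l).
Qed.

(** All compatibilities of the product with the two actions at once; [rmul_lact], [rmul_ract] and
    [rmul_mid] follow by setting the other maps to 1. *)
Lemma rmul_nat A A' S S' B B' (x : ann D S B) (y : ann D A S')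
    (g : mor B B') (h : mor S' S) (f : mor A' A) :
  rmul (ract (lact g x) h) (ract y f) = ract (lact g (rmul x (lact h y))) f.
Proof.
have [rx urx hx] := ann_support x; have [ry ury hy] := ann_support y.
apply: annP => k /=.
rewrite -![rmul_coef _ _ k]/(rmul _ _ k) !(rmul_sum k urx ury)/=; first last.
- by move=> l /hy ->; rewrite comp0m.
- by move=> l /hx ->; rewrite compm0 comp0m.
- by move=> l /hy ->; rewrite compm0.
- exact: hx.
rewrite comp_sumr comp_suml_seq; apply: eq_bigr => m _.
rewrite comp_sumr comp_suml_seq; apply: eq_bigr => l _.
rewrite comp_sumr comp_suml_seq; apply: eq_bigr => v _.
exact: aterm_nat.
Qed.

Lemma rmul_linear_r A S B (x : ann D S B) a (y y' : ann D A S) :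
  rmul x (a *: y + y') = a *: rmul x y + rmul x y'.
Proof.
have [rx urx hx] := ann_support x; have [ry ury hy] := ann_support y.
have [ry' ury' hy'] := ann_support y'.
have hr (z : Irr C) : z \notin undup (ry ++ ry') -> y z = 0 /\ y' z = 0.
  by rewrite mem_undup mem_cat negb_or => /andP[/hy ? /hy' ?].
have ur := undup_uniq (ry ++ ry').
apply: annP => k; rewrite annLE.
rewrite (rmul_sum k urx ur hx (y := y)); last by move=> l /hr [].
rewrite (rmul_sum k urx ur hx (y := y')); last by move=> l /hr [].
rewrite (rmul_sum k urx ur hx); last first.
  by move=> l /hr [y0 y0']; rewrite annLE y0 y0' scaler0 addr0.
rewrite scaler_sumr -big_split; apply: eq_bigr => m _ /=.
rewrite scaler_sumr -big_split; apply: eq_bigr => l _ /=.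
rewrite scaler_sumr -big_split; apply: eq_bigr => v _ /=.
by rewrite -[RHS]aterm_linear_r; congr aterm; exact: annLE.
Qed.

Lemma rmul_sumr A S B (x : ann D S B) (I : Type) (r : seq I) (F : I -> ann D A S) :
  rmul x (\sum_(a <- r) F a) = \sum_(a <- r) rmul x (F a).
Proof.
have rD y y' : rmul x (y + y') = rmul x y + rmul x y'.
  by have := rmul_linear_r x 1 y y'; rewrite !scale1r.
have r0 : rmul x (0 : ann D A S) = 0.
  by have := rmul_linear_r x (-1) (0 : ann D A S) 0; rewrite !scaleN1r !oppr0 !addr0 addNr.
by elim/big_rec2 : _ => [//|a y1 y2 _ <-]; rewrite rD.
Qed.

Lemma rmul0l A S B (y : ann D A S) : rmul (0 : ann D S B) y = 0.
Proof.
by apply: annP => k; apply: fsbig1 => t _; apply: big1 => v _; exact: aterm0l.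
Qed.

Lemma rmul0r A S B (x : ann D S B) : rmul x (0 : ann D A S) = 0.
Proof.
by apply: annP => k; apply: fsbig1 => t _; apply: big1 => v _; exact: aterm0r.
Qed.

Section Actions.
Context {A B : C}.
Implicit Types x : ann D A B.

Lemma lact1 x : lact 1_[B] x = x.
Proof. by apply: annP => k /=; rewrite tensorm1 comp1m. Qed.

Lemma ract1 x : ract x 1_[A] = x.
Proof. by apply: annP => k /=; rewrite tensorm1 compm1. Qed.

Lemma lactA B' B'' (g : mor B' B'') (h : mor B B') x : lact g (lact h x) = lact (g ∘ h) x.
Proof. by apply: annP => k /=; rewrite compA -tensorm_comp comp1m. Qed.

Lemma lract A' B' (g : mor B B') (h : mor A' A) x : ract (lact g x) h = lact g (ract x h).
Proof. by apply: annP => k /=; rewrite compA. Qed.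

Lemma lact_suml B' (I : Type) (r : seq I) (g : I -> mor B B') x :
  lact (\sum_(a <- r) g a) x = \sum_(a <- r) lact (g a) x.
Proof.
apply: annP => k; rewrite ann_sumE /= -comp_suml_seq; congr (_ ∘ _).
elim/big_rec2 : _ => [|a f1 f2 _ <-]; first exact: tensorm0l.
by have := tensorm_linearl 1_[irr D k] 1 (g a) f2; rewrite !scale1r.
Qed.

Lemma lact_linear B' (g : mor B B') a x y : lact g (a *: x + y) = a *: lact g x + lact g y.
Proof.
apply: annP => k; rewrite annLE; transitivity ((g ⊠ 1_[irr D k]) ∘ (a *: x k + y k)).
  by congr (_ ∘ _); exact: annLE.
exact: comp_linearr.
Qed.

Lemma ract_linear A' (g : mor A' A) a x y : ract (a *: x + y) g = a *: ract x g + ract y g.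
Proof.
apply: annP => k; rewrite annLE; transitivity ((a *: x k + y k) ∘ (1_[irr D k] ⊠ g)).
  by congr (_ ∘ _); exact: annLE.
exact: (comp_linearl (1_[irr D k] ⊠ g)).
Qed.

End Actions.

Lemma rmul_lact A S B B' (g : mor B B') (x : ann D S B) (y : ann D A S) :
  rmul (lact g x) y = lact g (rmul x y).
Proof. by have := rmul_nat x y g 1_[S] 1_[A]; rewrite !ract1 lact1. Qed.

Lemma rmul_ract A A' S B (x : ann D S B) (y : ann D A S) (g : mor A' A) :
  rmul x (ract y g) = ract (rmul x y) g.
Proof. by have := rmul_nat x y 1_[B] 1_[S] g; rewrite !lact1 ract1. Qed.

Lemma rmul_mid A S S' B (x : ann D S B) (y : ann D A S') (h : mor S' S) :
  rmul (ract x h) y = rmul x (lact h y).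
Proof. by have := rmul_nat x y 1_[B] h 1_[A]; rewrite !lact1 !ract1. Qed.

End AnnularProduct.

(** * Coherence of the identifications of objects *)

Section Casts.
Context {R : realType} {C : rigidTensorCategory R}.
Implicit Types X Y Z : C.

(** The property is stable under composition, tensor product and adjoint, and by proof irrelevance a
    source and a target admit at most one such morphism ([cast_eq]); diagrams of identifications
    therefore commute. *)
Definition is_cast X Y (f : mor X Y) : Prop := exists e : X = Y, f = to_eq e.

Lemma cast_to_eq X Y (e : X = Y) : is_cast (to_eq e).
Proof. by exists e. Qed.

Lemma cast_id X : is_cast 1_[X].
Proof. by exists erefl. Qed.

Lemma cast_comp X Y Z (g : mor Y Z) (f : mor X Y) :
  is_cast g -> is_cast f -> is_cast (g ∘ f).
Proof.
move=> [e' ->] [e ->]; case: _ / e' ; case: _ / e.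
by rewrite comp1m; exact: cast_id.
Qed.

Lemma cast_adj X Y (f : mor X Y) : is_cast f -> is_cast f^†.
Proof. by move=> [e ->]; case: _ / e; rewrite adj1; exact: cast_id. Qed.

Lemma cast_tensor X Y X' Y' (f : mor X Y) (g : mor X' Y') :
  is_cast f -> is_cast g -> is_cast (f ⊠ g).
Proof.
move=> [e ->] [e' ->]; case: _ / e; case: _ / e'.
by rewrite tensorm1; exact: cast_id.
Qed.

Lemma cast_eq X Y (f g : mor X Y) : is_cast f -> is_cast g -> f = g.
Proof. by move=> [e ->] [e' ->]; rewrite (Prop_irrelevance e e'). Qed.

Lemma meq_castl X Y Z (g : mor Y Z) (f : mor X Y) : is_cast g -> meq (g ∘ f) f.
Proof. by move=> [e ->]; exact: meq_to_eql. Qed.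

Lemma meq_castr X Y Z (g : mor Y Z) (f : mor X Y) : is_cast f -> meq (g ∘ f) g.
Proof. by move=> [e ->]; exact: meq_to_eqr. Qed.

Lemma cast_adjK X Y (f : mor X Y) : is_cast f -> f^† ∘ f = 1_[X].
Proof.
by move=> cf; apply: cast_eq (cast_id _); apply: cast_comp => //; exact: cast_adj.
Qed.

End Casts.

(** * Units and involution of the annular category *)

Section UnitAndStar.
Context {R : realType} {C : rigidTensorCategory R} (D : irrData C).

Ltac casts := repeat first
  [ exact: cast_to_eq | exact: cast_id | apply: cast_comp | apply: cast_tensor
  | apply: cast_adj ].

Definition unit_Irr : Irr C :=
  exist _ (iso_class (tunit C)) (mem_set (ex_intro2 _ _ _ (unit_simple C) erefl)).

Lemma irr_unit_Irr : irr D unit_Irr = tunit C.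
Proof. by apply: irr_unit; exact: isomorphic_refl. Qed.

Lemma irr_eq_unit k : irr D k = tunit C -> k = unit_Irr.
Proof.
move=> e; apply: val_inj; apply: val_Irr.
by rewrite -e; exact: irr_in.
Qed.

Lemma irr_simple k : simple (irr D k).
Proof. exact: simple_Irr (irr_in D k). Qed.

Lemma mor_irr_neq k l (f : mor (irr D k) (irr D l)) : k <> l -> f = 0.
Proof.
move=> kl; apply: contrapT => f0; apply: kl; apply: val_inj.
rewrite (val_Irr (irr_in D k)) (val_Irr (irr_in D l)); apply: iso_classP.
exact: Schur (irr_simple k) (irr_simple l) f0.
Qed.

Lemma unit_swap (k : Irr C) A : irr D k = tunit C -> irr D k ⊗ A = A ⊗ irr D k.
Proof. by move=> ->; rewrite tensor1o tensoro1. Qed.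

(** The unit of [A] sits in the component X_0. The test is on objects rather than on classes because
    it supplies the equality to cast along; by [irr_unit_Irr] and [irr_eq_unit] the two tests
    agree. *)
Definition ru_coef (A : C) (k : Irr C) : mor (irr D k ⊗ A) (A ⊗ irr D k) :=
  if pselect (irr D k = tunit C) is left e then to_eq (unit_swap A e) else 0.

Lemma ru_coef_neq A k : k <> unit_Irr -> ru_coef A k = 0.
Proof. by rewrite /ru_coef; case: pselect => // e []; exact: irr_eq_unit. Qed.

Lemma ru_cast A k : irr D k = tunit C -> is_cast (ru_coef A k).
Proof. by rewrite /ru_coef; case: pselect => // *; exact: cast_to_eq. Qed.

Lemma ru_finite A : finite_set [set k | ru_coef A k <> 0].
Proof.
apply: (sub_finite_set _ (finite_set1 unit_Irr)) => k /= nz.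
by apply: contrapT => h; apply: nz; exact: ru_coef_neq.
Qed.

Definition ru (A : C) : ann D A A := Ann (ru_finite A).

Lemma atermZV A S B a k m l (V : mor (irr D k) (irr D m ⊗ irr D l))
    (x : mor (irr D m ⊗ S) (B ⊗ irr D m)) (y : mor (irr D l ⊗ A) (S ⊗ irr D l)) :
  aterm (a *: V) x y = (a * Num.conj a) *: aterm V x y.
Proof.
by rewrite /aterm adjZ tensormZl tensormZr !compZm !compmZ scalerA [a * _]mulrC.
Qed.

Lemma aterm_V0 A S B k m l (x : mor (irr D m ⊗ S) (B ⊗ irr D m))
    (y : mor (irr D l ⊗ A) (S ⊗ irr D l)) :
  aterm (0 : mor (irr D k) _) x y = 0.
Proof. by rewrite /aterm tensorm0l compm0. Qed.

(** Each V is a multiple of the unitary [to_eq e]; its scalar enters multiplied by its conjugate,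
    and these products add up to 1. *)
Lemma onb_cast_sum A S B k m l (x : mor (irr D m ⊗ S) (B ⊗ irr D m))
    (y : mor (irr D l ⊗ A) (S ⊗ irr D l)) (e : irr D k = irr D m ⊗ irr D l) :
  \sum_v aterm (@onb _ _ D k m l v) x y = aterm (to_eq e) x y.
Proof.
have [|c [hc c1]] := onb_unitary (irr_simple k) (@onbP _ _ D k m l) (cast_adjK (cast_to_eq e)).
  by have := cast_adjK (cast_adj (cast_to_eq e)); rewrite adjK.
rewrite -[RHS]scale1r -c1 scaler_suml; apply: eq_bigr => v _.
by rewrite hc atermZV.
Qed.

(** Only m = 0, l = k contributes: [ru] vanishes for the other m, and for m = 0 and the other l
    every morphism from X_k to X_0 ⊗ X_l is 0 by Schur's lemma. What remains is [y] surrounded by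
    casts. *)
Lemma rmul1l A B (y : ann D A B) : rmul (ru B) y = y.
Proof.
apply: annP => k; rewrite (rmulE (r := [:: (unit_Irr, k)]))//; last first.
  move=> [m l] v; rewrite inE /= => tN.
  have [mu|mN] := pselect (m = unit_Irr); last by rewrite ru_coef_neq// aterm0l.
  subst m; rewrite xpair_eqE eqxx /= in tN.
  have e : irr D unit_Irr ⊗ irr D l = irr D l by rewrite irr_unit_Irr tensor1o.
  have V0 : to_eq e ∘ @onb _ _ D k unit_Irr l v = 0.
    by apply: mor_irr_neq => kl; rewrite kl eqxx in tN.
  have -> : @onb _ _ D k unit_Irr l v = 0.
    by rewrite -[LHS]comp1m -(cast_adjK (cast_to_eq e)) -compA V0 compm0.
  exact: aterm_V0.
have e : irr D k = irr D unit_Irr ⊗ irr D k by rewrite irr_unit_Irr tensor1o.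
rewrite big_seq1 /= (onb_cast_sum _ _ e); apply: meq_eq; rewrite /aterm.
apply: meq_trans; first by apply: meq_castr; casts.
apply: meq_trans; first by apply: meq_castr; exact: cast_to_eq.
apply: meq_trans; last exact: (meq_unitl irr_unit_Irr).
by apply: meq_castl; casts; exact/ru_cast/irr_unit_Irr.
Qed.

Lemma rmul1r A B (x : ann D A B) : rmul x (ru A) = x.
Proof.
apply: annP => k; rewrite (rmulE (r := [:: (k, unit_Irr)]))//; last first.
  move=> [m l] v; rewrite inE /= => tN.
  have [lu|lN] := pselect (l = unit_Irr); last by rewrite (ru_coef_neq _ lN) aterm0r.
  subst l; rewrite xpair_eqE eqxx andbT /= in tN.
  have e : irr D m ⊗ irr D unit_Irr = irr D m by rewrite irr_unit_Irr tensoro1.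
  have V0 : to_eq e ∘ @onb _ _ D k m unit_Irr v = 0.
    by apply: mor_irr_neq => kl; rewrite kl eqxx in tN.
  have -> : @onb _ _ D k m unit_Irr v = 0.
    by rewrite -[LHS]comp1m -(cast_adjK (cast_to_eq e)) -compA V0 compm0.
  exact: aterm_V0.
have e : irr D k = irr D k ⊗ irr D unit_Irr by rewrite irr_unit_Irr tensoro1.
rewrite big_seq1 /= (onb_cast_sum _ _ e); apply: meq_eq; rewrite /aterm.
apply: meq_trans; first by apply: meq_castr; casts.
apply: meq_trans; first by apply: meq_castr; exact: cast_to_eq.
apply: meq_trans.
  by apply: meq_castr; casts; exact/ru_cast/irr_unit_Irr.
apply: meq_trans; first by apply: meq_castr; exact: cast_to_eq.
apply: meq_trans; last exact: (meq_unitr irr_unit_Irr).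
by apply: meq_castl; casts.
Qed.

Definition star_term A B k (r : mor (tunit C) (irr D (conj_irr D k) ⊗ irr D k))
    (rbar : mor (tunit C) (irr D k ⊗ irr D (conj_irr D k)))
    (x : mor (irr D (conj_irr D k) ⊗ A) (B ⊗ irr D (conj_irr D k))) :
    mor (irr D k ⊗ B) (A ⊗ irr D k) :=
  to_eq (tensor1o (A ⊗ irr D k))
  ∘ (rbar^† ⊠ (1_[A] ⊠ 1_[irr D k]))
  ∘ to_eq (tensorAA (irr D k) (irr D (conj_irr D k)) A (irr D k))
  ∘ (1_[irr D k] ⊠ x^† ⊠ 1_[irr D k])
  ∘ to_eq (esym (tensorAA (irr D k) B (irr D (conj_irr D k)) (irr D k)))
  ∘ (1_[irr D k] ⊠ 1_[B] ⊠ r)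
  ∘ to_eq (esym (tensoro1 (irr D k ⊗ B))).

Definition rs_coef A B (x : ann D A B) k : mor (irr D k ⊗ B) (A ⊗ irr D k) :=
  star_term (sol D k) (solbar D k) (x (conj_irr D k)).

Lemma star_term0 A B k r rbar : @star_term A B k r rbar 0 = 0.
Proof. by rewrite /star_term adj0 tensorm0r tensorm0l compm0 !comp0m. Qed.

Lemma rs_finite A B (x : ann D A B) : finite_set [set k | rs_coef x k <> 0].
Proof.
apply: (sub_finite_set _ (finite_image (conj_irr D) (acoef_finite x))) => k /= nz.
exists (conj_irr D k); last exact: conj_irrK.
by move=> /= x0; apply: nz; rewrite /rs_coef x0 star_term0.
Qed.

Definition rs A B (x : ann D A B) : ann D B A := Ann (rs_finite x).

Lemma rs0 A B : rs (0 : ann D A B) = 0.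
Proof. by apply: annP => k; exact: star_term0. Qed.

(** The involution bends the legs of X_k and leaves the weights alone, so [g] and [h] only change
    sides and become adjoints. *)
Lemma star_term_nat A A' B B' k r rbar
    (x : mor (irr D (conj_irr D k) ⊗ A) (B ⊗ irr D (conj_irr D k)))
    (g : mor B B') (h : mor A' A) :
  star_term r rbar ((g ⊠ 1_[_]) ∘ x ∘ (1_[_] ⊠ h)) =
  (h^† ⊠ 1_[irr D k]) ∘ star_term r rbar x ∘ (1_[irr D k] ⊠ g^†).
Proof.
set K := irr D k; set K' := irr D (conj_irr D k).
have eg : (1_[K] ⊠ (g^† ⊠ 1_[K']) ⊠ 1_[K])
    ∘ to_eq (esym (tensorAA K B' K' K)) ∘ (1_[K] ⊠ 1_[B'] ⊠ r)
    ∘ to_eq (esym (tensoro1 (K ⊗ B')))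
  = to_eq (esym (tensorAA K B K' K)) ∘ (1_[K] ⊠ 1_[B] ⊠ r)
    ∘ to_eq (esym (tensoro1 (K ⊗ B))) ∘ (1_[K] ⊠ g^†).
  rewrite -(@meq_nat _ _ _ _ _ _ ((1_[K] ⊠ g^†) ⊠ (1_[K'] ⊠ 1_[K])) _ _
    (esym (tensorAA K B K' K))); last first.
    apply: meq_sym; apply: meq_trans (meq_sym (meq_assoc _ _ _)).
    by apply: meq_tensor (meq_refl _); exact: meq_assoc.
  rewrite -[in RHS]compA (@meq_nat _ _ _ _ _ _ _ ((1_[K] ⊠ g^†) ⊠ 1_[tunit C])
    (esym (tensoro1 (K ⊗ B')))); last exact/meq_sym/meq_unitr.
  rewrite -!compA; congr (_ ∘ _); rewrite !compA -!tensorm_comp.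
  by rewrite !tensorm1 !comp1m !compm1.
have eh : to_eq (tensor1o (A' ⊗ K)) ∘ (rbar^† ⊠ (1_[A'] ⊠ 1_[K]))
    ∘ to_eq (tensorAA K K' A' K) ∘ (1_[K] ⊠ (1_[K'] ⊠ h^†) ⊠ 1_[K])
  = (h^† ⊠ 1_[K]) ∘ to_eq (tensor1o (A ⊗ K)) ∘ (rbar^† ⊠ (1_[A] ⊠ 1_[K]))
    ∘ to_eq (tensorAA K K' A K).
  rewrite -[LHS]compA (@meq_nat _ _ _ _ _ _ _ ((1_[K] ⊠ 1_[K']) ⊠ (h^† ⊠ 1_[K]))
    (tensorAA K K' A K)); last first.
    apply: meq_trans; last exact/meq_sym/meq_assoc.
    by apply: meq_tensor (meq_refl _); exact: meq_assoc.
  rewrite -(@meq_nat _ _ _ _ _ _ (1_[tunit C] ⊠ (h^† ⊠ 1_[K])) _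
    (tensor1o (A ⊗ K))(tensor1o (A' ⊗ K)) ); last exact: meq_unitl.
  rewrite -!compA; congr (_ ∘ _); rewrite !compA; congr (_ ∘ _).
  by rewrite -!tensorm_comp !tensorm1 !comp1m !compm1.
rewrite /star_term -/K -/K'.
have -> : ((g ⊠ 1_[K']) ∘ x ∘ (1_[K'] ⊠ h))^†
    = (1_[K'] ⊠ h^†) ∘ x^† ∘ (g^† ⊠ 1_[K']).
  by rewrite !adj_comp !tensorm_adj !adj1 compA.
have -> : 1_[K] ⊠ ((1_[K'] ⊠ h^†) ∘ x^† ∘ (g^† ⊠ 1_[K'])) ⊠ 1_[K]
  = (1_[K] ⊠ (1_[K'] ⊠ h^†) ⊠ 1_[K]) ∘ (1_[K] ⊠ x^† ⊠ 1_[K])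
    ∘ (1_[K] ⊠ (g^† ⊠ 1_[K']) ⊠ 1_[K]) by rewrite -!tensorm_comp !comp1m.
rewrite !compA eh -!compA; do 4 congr (_ ∘ _); congr (_ ∘ _).
by rewrite !compA eg.
Qed.

Lemma rs_nat A A' B B' (x : ann D A B) (g : mor B B') (h : mor A' A) :
  rs (ract (lact g x) h) = ract (lact h^† (rs x)) g^†.
Proof. by apply: annP => k /=; rewrite /rs_coef /= star_term_nat. Qed.

(** If the conjugate of 0 were another class, R_0 would be a morphism from the unit to a simple
    object of that class, hence 0 by Schur's lemma, against the conjugate equations. *)
Lemma conj_irr_unit : conj_irr D unit_Irr = unit_Irr.
Proof.
apply: contrapT => h.
have [[+ _] _] := sol_standard D unit_Irr.
have e : irr D (conj_irr D unit_Irr) ⊗ irr D unit_Irr = irr D (conj_irr D unit_Irr).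
  by rewrite irr_unit_Irr tensoro1.
have : to_eq e ∘ sol D unit_Irr ∘ to_eq irr_unit_Irr = 0.
  by apply: mor_irr_neq => h'; apply: h.
move=> r0.
have -> : sol D unit_Irr = 0.
  rewrite -[LHS]comp1m -(cast_adjK (cast_to_eq e)) -[LHS]compm1.
  have := cast_adjK (cast_adj (cast_to_eq irr_unit_Irr)); rewrite adjK => <-.
  by rewrite -!compA [to_eq e ∘ _]compA [_ ∘ (to_eq _ ∘ _)]compA r0 comp0m compm0.
rewrite tensorm0r compm0 comp0m => /esym; case: (irr_simple unit_Irr) => nz _.
exact: nz.
Qed.

(** For the unit object, [sol] and [solbar] are scalars [a] and [b] times casts. The star of the
    unit carries the factor a conj(b), and the conjugate equation says that this is 1, whatever the
    phases. *)
Lemma rs_ru A : rs (ru A) = ru A.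
Proof.
apply: annP => k /=; rewrite /rs_coef /=.
have [ku|kN] := pselect (k = unit_Irr); last first.
  rewrite !ru_coef_neq// ?star_term0// => h; apply: kN.
  by rewrite -[k](conj_irrK D) h conj_irr_unit.
have e1 : irr D k = tunit C by rewrite ku irr_unit_Irr.
have e2 : irr D (conj_irr D k) = tunit C by rewrite ku conj_irr_unit irr_unit_Irr.
have e : tunit C = irr D (conj_irr D k) ⊗ irr D k by rewrite e1 e2 tensor1o.
have e' : tunit C = irr D k ⊗ irr D (conj_irr D k) by rewrite e1 e2 tensor1o.
have cast_of Z (f : mor (tunit C) Z) (eZ : tunit C = Z) : exists c, f = c *: to_eq eZ.
  by case: _ / eZ f => f; exact: (unit_simple C).2.
have [a ha] := cast_of _ (sol D k) e; have [b hb] := cast_of _ (solbar D k) e'.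
have [[+ _] _] := sol_standard D k.
rewrite ha hb adjZ tensormZl tensormZr !(compZm, compmZ) scalerA.
rewrite (@cast_eq _ _ _ _ (_ ∘ _) 1_[_]); [|by casts|by casts].
rewrite -[X in _ = X -> _]scale1r => /(simple_scaler_inj (irr_simple k)) ab1.
rewrite /star_term adjZ tensormZl tensormZr !(compZm, compmZ) scalerA ab1 scale1r.
apply: cast_eq; last exact: ru_cast.
by casts; exact: ru_cast.
Qed.

End UnitAndStar.

(** * Annular algebras and their representations *)

Section Blocks.
Context {R : realType} {C : rigidTensorCategory R} {D : irrData C}.
Context {I : choiceType} {Y : I -> C}.
Implicit Types (x y : annular D Y) (i j s : I).

Lemma block_finite x i j : finite_set [set k : Irr C | x i j k <> 0].
Proof.
apply: (sub_finite_set _ (finite_image snd (coef_finite x))) => k /= nz.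
by exists ((i, j), k).
Qed.

Definition block x i j : ann D (Y i) (Y j) := Ann (block_finite x i j).

Lemma block_eq x y : (forall i j, block x i j = block y i j) -> x = y.
Proof.
by move=> xy; apply: annularP => i j k; have := congr1 (fun c : ann _ _ _ => c k) (xy i j).
Qed.

Lemma blockD x y i j : block (x + y) i j = block x i j + block y i j.
Proof. by apply: annP => k; rewrite annDE; exact: annular_addE. Qed.

Lemma blockL a x y i j : block (a *: x + y) i j = a *: block x i j + block y i j.
Proof.
by apply: annP => k; rewrite annLE -(annular_scaleE a x); exact: annular_addE.
Qed.

Lemma block_sum (K : Type) (r : seq K) (F : K -> annular D Y) i j :
  block (\sum_(a <- r) F a) i j = \sum_(a <- r) block (F a) i j.
Proof.
elim/big_rec2 : _ => [|a x1 x2 _ <-]; first exact: annP.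
by rewrite blockD.
Qed.

Definition blk_coef i j (c : ann D (Y i) (Y j)) i' j' (k : Irr C) :
    mor (irr D k ⊗ Y i') (Y j' ⊗ irr D k) :=
  if pselect (i' = i) is left ei then
    if pselect (j = j') is left ej then
      to_eq (congr1 (fun j => Y j ⊗ irr D k) ej) ∘ c k
        ∘ to_eq (congr1 (fun i => irr D k ⊗ Y i) ei)
    else 0
  else 0.

Lemma blk_finite i j (c : ann D (Y i) (Y j)) :
  finite_set (annular_support (blk_coef c)).
Proof.
apply: (sub_finite_set _ (finite_image (fun k => ((i, j), k)) (acoef_finite c))).
move=> [[i' j'] k]; rewrite /annular_support /blk_coef /=.
case: pselect => // ei; case: pselect => // ej nz; exists k; last by rewrite ei ej.
by move=> /= c0; apply: nz; rewrite c0 compm0 comp0m.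
Qed.

Definition blk i j (c : ann D (Y i) (Y j)) : annular D Y := Annular (blk_finite c).

Lemma blkK i j (c : ann D (Y i) (Y j)) : block (blk c) i j = c.
Proof.
apply: annP => k /=; rewrite /blk_coef.
case: pselect => // ei; case: pselect => // ej.
by rewrite !to_eq_id comp1m compm1.
Qed.

Lemma blk_neq i j (c : ann D (Y i) (Y j)) i' j' :
  (i', j') <> (i, j) -> block (blk c) i' j' = 0.
Proof.
move=> h; apply: annP => k /=; rewrite /blk_coef.
by case: pselect => // ei; case: pselect => // ej; exfalso; apply: h; rewrite ei ej.
Qed.

Lemma blkL i j a (c d : ann D (Y i) (Y j)) : blk (a *: c + d) = a *: blk c + blk d.
Proof.
apply: block_eq => i' j'; rewrite blockL.
have [[-> ->]|h] := pselect ((i', j') = (i, j)); first by rewrite !blkK.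
by rewrite !blk_neq// scaler0 addr0.
Qed.

Lemma annular_degrees x : exists2 r : seq I, uniq r &
  forall i j, (i \notin r) || (j \notin r) -> block x i j = 0.
Proof.
have [r ur hr] := finite_set_uniq_seq (coef_finite x).
exists (undup ([seq t.1.1 | t <- r] ++ [seq t.1.2 | t <- r])); first exact: undup_uniq.
move=> i j; rewrite !mem_undup !mem_cat !negb_or => h; apply: annP => k /=.
apply: contrapT => nz; have ht : (i, j, k) \in r by exact: hr.
case/orP: h => /andP[h1 h2]; [move/negP: h1|move/negP: h2]; apply; apply/mapP;
  by exists (i, j, k).
Qed.

Lemma annular_degrees_in x i : exists r : seq I, [/\ uniq r, i \in r &
  forall i j, (i \notin r) || (j \notin r) -> block x i j = 0].
Proof.
have [r ur hr] := annular_degrees x; exists (undup (i :: r)); split.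
- exact: undup_uniq.
- by rewrite mem_undup mem_head.
move=> j j' h; apply: hr; case/orP: h; rewrite mem_undup inE negb_or => /andP[_ ->] //.
by rewrite orbT.
Qed.

Lemma block_mul x y i j (r : seq I) : uniq r ->
  (forall s, s \notin r -> block x s j = 0 \/ block y i s = 0) ->
  block (annular_mul x y) i j = \sum_(s <- r) rmul (block x s j) (block y i s).
Proof.
move=> ur hr; apply: annP => k; rewrite ann_sumE.
have sup s : exists p : seq (Irr C), forall k : Irr C, k \notin p ->
    block x s j k = 0 /\ block y i s k = 0.
  have [px _ hx] := ann_support (block x s j).
  have [py _ hy] := ann_support (block y i s).
  by exists (px ++ py) => k'; rewrite mem_cat negb_or => /andP[/hx ? /hy ?].
have {sup} [ps hps] := choice sup.
(* One range [p] of irreducibles serves all the weights in [r], so that the index set of triples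
   becomes a product and the sum a matrix product. *)
pose p := undup (flatten [seq ps s | s <- r]).
have up : uniq p by exact: undup_uniq.
have hp s (l : Irr C) : s \in r -> l \notin p -> block x s j l = 0 /\ block y i s l = 0.
  move=> sr; rewrite mem_undup => lp; apply: hps; apply: contra lp => lp.
  by apply/flattenP; exists (ps s) => //; apply: map_f.
pose q := [seq (sm, l) | sm <- [seq (s, m) | s <- r, m <- p], l <- p].
have uq : uniq q.
  rewrite allpairs_uniq//; last by move=> [a b] [a' b'] _ _ [-> ->].
  by rewrite allpairs_uniq// => -[a b] [a' b'] _ _ [-> ->].
transitivity (\sum_(t <- q) \sum_v
    annular_mul_term x y i j t.1.1 (@onb _ _ D k t.1.2 t.2 v)).
  apply: fsumE => // -[[s m] l] tq; apply: big1 => v _ /=.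
  rewrite -[annular_mul_term _ _ _ _ _ _]/(aterm (onb v) (block x s j m) (block y i s l)).
  have [sr|/hr[->|->]] := boolP (s \in r); [|exact: aterm0l|exact: aterm0r].
  have [mp|/(hp s _ sr)[-> _]] := boolP (m \in p); last exact: aterm0l.
  have [lp|/(hp s _ sr)[_ ->]] := boolP (l \in p); last exact: aterm0r.
  exfalso; move/negP: tq; apply; apply/allpairsP; exists ((s, m), l); split=> //.
  by apply/allpairsP; exists (s, m).
rewrite !big_allpairs_dep big_seq [RHS]big_seq; apply: eq_bigr => s sr.
rewrite (rmul_sum k up up)//; first by move=> m /(hp s _ sr)[].
by move=> l /(hp s _ sr)[].
Qed.

Lemma block_star x i j : block (annular_star x) i j = rs (block x j i).
Proof. exact: annP. Qed.

Lemma blk_sum x (r : seq I) : uniq r ->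
  (forall i j, (i \notin r) || (j \notin r) -> block x i j = 0) ->
  x = \sum_(i <- r) \sum_(j <- r) blk (block x i j).
Proof.
move=> ur hr; apply: block_eq => i j; rewrite block_sum.
have [h|] := boolP ((i \notin r) || (j \notin r)).
  rewrite hr// big1_seq// => i' /= ir; rewrite block_sum big1_seq// => j' /= jr.
  by rewrite blk_neq// => -[ei ej]; rewrite ei ej ir jr in h.
rewrite negb_or !negbK => /andP[ir jr].
rewrite (bigD1_seq i)//= [X in _ + X]big1 ?addr0 => [|i' ii]; last first.
  rewrite block_sum big1// => j' _; rewrite blk_neq// => -[/esym/eqP ii'].
  by rewrite ii' in ii.
rewrite block_sum (bigD1_seq j)//= [X in _ + X]big1 ?addr0 => [|j' jj]; first by rewrite blkK.
by rewrite blk_neq// => -[/esym/eqP jj']; rewrite jj' in jj.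
Qed.

End Blocks.

Section Operators.
Context {R : realType} {C : rigidTensorCategory R} {D : irrData C}.
Context {I : choiceType} {Y : I -> C} (U : representation D Y).
Implicit Types (i j s : I) (u v : U).

Definition op i j (c : ann D (Y i) (Y j)) (u : U) : U := action (blk c) u.

Lemma opL i j a (c d : ann D (Y i) (Y j)) u : op (a *: c + d) u = a *: op c u + op d u.
Proof. by rewrite /op blkL action_linear. Qed.

Lemma op_bounded i j (c : ann D (Y i) (Y j)) : bounded_operator (op c).
Proof. exact: action_bounded. Qed.

Lemma op0l i j u : op (0 : ann D (Y i) (Y j)) u = 0.
Proof.
by have := opL (-1) (0 : ann D (Y i) (Y j)) 0 u; rewrite !scaleN1r oppr0 addr0 addNr.
Qed.

Lemma opDl i j (c d : ann D (Y i) (Y j)) u : op (c + d) u = op c u + op d u.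
Proof. by have := opL 1 c d u; rewrite !scale1r. Qed.

Lemma op_suml i j (K : Type) (r : seq K) (c : K -> ann D (Y i) (Y j)) u :
  op (\sum_(a <- r) c a) u = \sum_(a <- r) op (c a) u.
Proof. exact: (big_morph (fun c => op c u) (fun c d => opDl c d u) (op0l i j u)). Qed.

Lemma op0r i j (c : ann D (Y i) (Y j)) : op c 0 = 0.
Proof.
by have := (op_bounded c).1 (-1) 0 0; rewrite !scaleN1r oppr0 addr0 addNr.
Qed.

Lemma opDr i j (c : ann D (Y i) (Y j)) u v : op c (u + v) = op c u + op c v.
Proof. by have := (op_bounded c).1 1 u v; rewrite !scale1r. Qed.

Lemma opB i j (c : ann D (Y i) (Y j)) u v : op c (u - v) = op c u - op c v.
Proof. by rewrite addrC -[- v]scaleN1r (op_bounded c).1 scaleN1r addrC. Qed.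

Lemma op_sumr i j (c : ann D (Y i) (Y j)) (K : Type) (r : seq K) (F : K -> U) :
  op c (\sum_(a <- r) F a) = \sum_(a <- r) op c (F a).
Proof. exact: (big_morph (op c) (opDr c) (op0r c)). Qed.

Lemma op_op i j s (c : ann D (Y s) (Y j)) (d : ann D (Y i) (Y s)) u :
  op c (op d u) = op (rmul c d) u.
Proof.
rewrite /op -action_mul; congr (action _ u); apply: block_eq => i' j'.
have -> : block (annular_mul (blk c) (blk d)) i' j'
    = rmul (block (blk c) s j') (block (blk d) i' s).
  rewrite (block_mul (r := [:: s]))// ?big_seq1// => s'; rewrite inE => /eqP ss.
  by left; rewrite blk_neq// => -[].
have [[ii jj]|h] := pselect ((i', j') = (i, j)).
  by rewrite ii jj !blkK.
rewrite (blk_neq _ h).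
have [ii|ii] := pselect (i' = i).
  rewrite (blk_neq c) ?rmul0l// => -[jj]; apply: h; by rewrite ii jj.
by rewrite (blk_neq d) ?rmul0r// => -[].
Qed.

Lemma op_op0 i j s s' (c : ann D (Y s) (Y j)) (d : ann D (Y i) (Y s')) u :
  s <> s' -> op c (op d u) = 0.
Proof.
move=> ss; rewrite /op -action_mul -(op0l i j u) /op; congr (action _ u).
apply: block_eq => i' j'; rewrite (block_mul (r := [:: s]))//; last first.
  by move=> s1; rewrite inE => /eqP s1s; left; rewrite blk_neq// => -[].
rewrite big_seq1 (blk_neq d) ?rmul0r//; last by move=> -[_].
have [[-> ->]|h] := pselect ((i', j') = (i, j)); first by rewrite blkK.
by rewrite (blk_neq _ h).
Qed.

Lemma op_star i j (c : ann D (Y i) (Y j)) u v : hdot (op c u) v = hdot u (op (rs c) v).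
Proof.
rewrite /op action_star; congr (hdot u (action _ v)); apply: block_eq => i' j'.
rewrite block_star; have [[-> ->]|h] := pselect ((i', j') = (j, i)); first by rewrite !blkK.
rewrite (blk_neq _ h) blk_neq ?rs0// => -[ii jj]; apply: h; by rewrite ii jj.
Qed.

Lemma actionE (x : annular D Y) (r : seq I) u : uniq r ->
  (forall i j, (i \notin r) || (j \notin r) -> block x i j = 0) ->
  action x u = \sum_(i <- r) \sum_(j <- r) op (block x i j) u.
Proof.
move=> ur hr; rewrite {1}(blk_sum ur hr).
have aD x1 x2 : action (x1 + x2) u = action x1 u + action x2 u.
  by have := action_linear 1 x1 x2 u; rewrite !scale1r.
have a0 : action (0 : annular D Y) u = 0.
  by have := action_linear (-1) 0 0 u; rewrite !scaleN1r oppr0 addr0 addNr.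
rewrite (big_morph (fun x => action x u) aD a0); apply: eq_bigr => i _.
exact: (big_morph (fun x => action x u) aD a0).
Qed.

(** The action is a finite sum of operators [op c], and each of them factors through the unit of its
    source. *)
Lemma op_nondegenerate u : (forall i, op (ru D (Y i)) u = 0) -> u = 0.
Proof.
move=> h; apply: action_nondegenerate => x.
have [r ur hr] := annular_degrees x.
rewrite (actionE u ur hr) big1// => i _; rewrite big1// => j _.
by rewrite -[block x i j]rmul1r -op_op h op0r.
Qed.

End Operators.

(** * Square summable functions *)

Section Sums.
Context {R : realType} {T : choiceType}.
Implicit Types (f g : T -> R[i]) (s : R[i]) (r : seq T).

(** Unconditional summation: the limit along finite subsets of [T], presented as duplicate-free
    lists. *)
Definition has_sum f s := forall e : R[i], 0 < e -> exists r0 : seq T,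
  forall r, uniq r -> {subset r0 <= r} -> `|\sum_(t <- r) f t - s| < e.

Lemma has_sum_unique f s s' : has_sum f s -> has_sum f s' -> s = s'.
Proof.
move=> fs fs'; apply/eqP; rewrite -subr_eq0 -normr_le0; apply: contrapT => /negP.
rewrite -real_ltNge ?normr_real// => d0.
have d2 : 0 < `|s - s'| / 2 by rewrite divr_gt0.
have [r0 h0] := fs _ d2; have [r1 h1] := fs' _ d2.
have ur := undup_uniq (r0 ++ r1).
have {}h0 := h0 _ ur; have {}h1 := h1 _ ur.
have /h0 {}h0 : {subset r0 <= undup (r0 ++ r1)} by move=> t; rewrite mem_undup mem_cat => ->.
have /h1 {}h1 : {subset r1 <= undup (r0 ++ r1)}.
  by move=> t; rewrite mem_undup mem_cat => ->; rewrite orbT.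
move: h0 h1; set S := \sum_(_ <- _) _ => h0 h1.
have : `|s - s'| < `|s - s'|.
  rewrite [ltRHS]splitr; have -> : s - s' = (s - S) + (S - s') by rewrite addrA subrK.
  apply: le_lt_trans (ler_normD _ _) _; rewrite addrA subrK; apply: ltrD => //.
  by rewrite distrC.
by rewrite ltxx.
Qed.

Lemma has_sumD f g s u : has_sum f s -> has_sum g u -> has_sum (fun t => f t + g t) (s + u).
Proof.
move=> fs gu e e0; have e2 : 0 < e / 2 by rewrite divr_gt0.
have [r0 h0] := fs _ e2; have [r1 h1] := gu _ e2.
exists (r0 ++ r1) => r ur sr; rewrite big_split /= opprD addrACA [ltRHS]splitr.
apply: le_lt_trans (ler_normD _ _) _; apply: ltrD.
  by apply: h0 => // t tr; apply: sr; rewrite mem_cat tr.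
by apply: h1 => // t tr; apply: sr; rewrite mem_cat tr orbT.
Qed.

Lemma has_sumZ a f s : has_sum f s -> has_sum (fun t => a * f t) (a * s).
Proof.
move=> fs e e0; have a1 : 0 < `|a| + 1 by rewrite ltr_wpDl.
have [r0 h0] := fs _ (divr_gt0 e0 a1); exists r0 => r ur sr.
rewrite -mulr_sumr -mulrBr normrM.
apply: (@le_lt_trans _ _ ((`|a| + 1) * `|\sum_(t <- r) f t - s|)).
  by rewrite ler_wpM2r// lerDl.
by rewrite mulrC -ltr_pdivlMr//; exact: h0.
Qed.

Lemma has_sum_conj f s : has_sum f s -> has_sum (fun t => Num.conj (f t)) (Num.conj s).
Proof.
move=> fs e e0; have [r0 h0] := fs _ e0; exists r0 => r ur sr.
by rewrite -rmorph_sum -rmorphB norm_conjC; exact: h0.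
Qed.

Lemma has_sum_finite f r : uniq r -> (forall t, t \notin r -> f t = 0) ->
  has_sum f (\sum_(t <- r) f t).
Proof.
move=> ur f0 e e0; exists r => r' ur' sr.
suff -> : \sum_(t <- r') f t = \sum_(t <- r) f t by rewrite subrr normr0.
rewrite (bigID (mem r)) /= [X in _ + X]big1 => [|t /f0 //]; rewrite addr0 -big_filter.
apply: perm_big; apply: uniq_perm => //; first exact: filter_uniq.
by move=> t; rewrite mem_filter; case: (boolP (t \in r)) => // /sr ->.
Qed.

Lemma sum_subset_le f r r' : uniq r -> uniq r' -> {subset r <= r'} ->
  (forall t, 0 <= f t) -> \sum_(t <- r) f t <= \sum_(t <- r') f t.
Proof.
move=> ur ur' sr f0; rewrite [leRHS](bigID (mem r)) /=.
rewrite -[X in _ <= X + _]big_filter [X in _ <= X + _](perm_big r) /=.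
  by rewrite lerDl sumr_ge0.
apply: uniq_perm => //; first exact: filter_uniq.
by move=> t; rewrite mem_filter; case: (boolP (t \in r)) => // /sr ->.
Qed.

Lemma has_sum_ge0 f (M : R[i]) : (forall t, 0 <= f t) ->
  (forall r, uniq r -> \sum_(t <- r) f t <= M) ->
  exists s, [/\ has_sum f s, forall r, uniq r -> \sum_(t <- r) f t <= s & s <= M].
Proof.
move=> f0 fM; pose S r := \sum_(t <- r) f t.
have S0 r : 0 <= S r by exact: sumr_ge0.
have SR r : (complex.Re (S r))%:C%C = S r by apply: RRe_real; apply: ger0_real.
have M0 : 0 <= M by apply: le_trans (S0 [::]) _; exact: fM.
have MR : (complex.Re M)%:C%C = M by apply: RRe_real; apply: ger0_real.
(* The order of [R[i]] is partial, so the supremum is taken among real parts; nonnegative elements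
   are equal to theirs. *)
pose E := [set complex.Re (S r) | r in [set r | uniq r]].
have Eub : ubound E (complex.Re M).
  by move=> _ [r /= ur <-]; rewrite -lecR SR MR; exact: fM.
have Esup : has_sup E by split; [exists (complex.Re (S [::])), [::]|exists (complex.Re M)].
have Sle r : uniq r -> S r <= (sup E)%:C%C.
  by move=> ur; rewrite -SR lecR; apply: sup_upper_bound => //; exists r.
exists (sup E)%:C%C; split=> //; last first.
  by rewrite -MR lecR; apply: ge_sup => //; case: Esup.
move=> e e0; have eR : (complex.Re e)%:C%C = e by apply: RRe_real; apply: gtr0_real.
have e0' : 0 < complex.Re e by rewrite -ltcR eR.
have [_ [r0 /= ur0 <-] hr0] := sup_adherent e0' Esup.
exists r0 => r ur sr; rewrite distrC ger0_norm ?subr_ge0 ?Sle//.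
rewrite ltrBlDr -ltrBlDl; apply: (@lt_le_trans _ _ (S r0)).
  by rewrite -SR -eR -rmorphB ltcR.
exact: sum_subset_le.
Qed.

End Sums.

Section SquareSummable.
Context {R : realType} {T : choiceType} {H : hilbert R}.
Implicit Types (f g : T -> H) (r : seq T) (x y : H).

Lemma hdotDl x x' y : hdot (x + x') y = hdot x y + hdot x' y.
Proof. exact: linearDl. Qed.

Lemma hdotDr x y y' : hdot x (y + y') = hdot x y + hdot x y'.
Proof. exact: linearDr. Qed.

Lemma hdotZl a x y : hdot (a *: x) y = a * hdot x y.
Proof. exact: linearZl_LR. Qed.

Lemma hdotZr a x y : hdot x (a *: y) = Num.conj a * hdot x y.
Proof. exact: linearZr_LR. Qed.

Lemma hdotC x y : hdot y x = Num.conj (hdot x y).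
Proof. by rewrite (hermC hdot y x) mul1r. Qed.

Lemma sqr_norm_add c x y : `|x + c *: y| ^+ 2 =
  hdot x x + Num.conj c * hdot x y + c * hdot y x + c * Num.conj c * hdot y y.
Proof. by rewrite -hdot_norm hdotDl !hdotDr !hdotZl !hdotZr; ring. Qed.

(** Reduces summability of scalar products to that of four families of squares. The factors 1 and -1
    are kept so that all four have the shape x + a y. *)
Lemma hdot_polarization x y : hdot x y = 4^-1 *
  (`|x + 1 *: y| ^+ 2 + (-1) * `|x + (-1) *: y| ^+ 2 +
   ('i * `|x + 'i *: y| ^+ 2 + (- 'i) * `|x + (- 'i) *: y| ^+ 2)).
Proof.
rewrite !sqr_norm_add !rmorphN !rmorph1 /= !conjCi.
have ii : 'i * 'i = -1 :> R[i] by rewrite -expr2 sqrCi.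
apply: (@mulfI _ 4); rewrite ?pnatr_eq0// mulrA mulfV ?pnatr_eq0// mul1r.
by ring: ii.
Qed.

Definition sqs f := exists M : R[i], forall r, uniq r -> \sum_(t <- r) `|f t| ^+ 2 <= M.

Lemma norm_sqrD x y : `|x + y| ^+ 2 <= 2 * (`|x| ^+ 2 + `|y| ^+ 2).
Proof.
apply: (@le_trans _ _ ((`|x| + `|y|) ^+ 2)).
  by rewrite ler_pXn2r// ?nnegrE ?addr_ge0// ler_normD.
rewrite -subr_ge0.
have -> : 2 * (`|x| ^+ 2 + `|y| ^+ 2) - (`|x| + `|y|) ^+ 2 = (`|x| - `|y|) ^+ 2 by ring.
by rewrite real_exprn_even_ge0// rpredB ?normr_real.
Qed.

Lemma sqs0 : sqs (fun=> 0).
Proof. by exists 0 => r _; rewrite big1// => t _; rewrite normr0 expr0n. Qed.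

Lemma sqsL a f g : sqs f -> sqs g -> sqs (fun t => a *: f t + g t).
Proof.
move=> [M fM] [N gN]; exists (2 * (`|a| ^+ 2 * M + N)) => r ur.
apply: (@le_trans _ _ (\sum_(t <- r) 2 * (`|a| ^+ 2 * `|f t| ^+ 2 + `|g t| ^+ 2))).
  apply: ler_sum => t _; apply: le_trans (norm_sqrD _ _) _.
  by rewrite normrZ exprMn.
rewrite -mulr_sumr ler_wpM2l// big_split /= lerD ?gN// -mulr_sumr.
by rewrite ler_wpM2l ?exprn_ge0// fM.
Qed.

Lemma sqsZ a f : sqs f -> sqs (fun t => a *: f t).
Proof.
move=> sf; have := sqsL a sf sqs0; congr sqs.
by apply/funext => t; rewrite addr0.
Qed.

Lemma sqsD f g : sqs f -> sqs g -> sqs (fun t => f t + g t).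
Proof.
move=> sf sg; have := sqsL 1 sf sg; congr sqs.
by apply/funext => t; rewrite scale1r.
Qed.

Lemma sqs_has_sum f : sqs f -> exists s, has_sum (fun t => `|f t| ^+ 2) s.
Proof.
by move=> [M fM]; have [|s []] := has_sum_ge0 _ fM; [move=> t; exact: exprn_ge0|exists s].
Qed.

Lemma hdot_has_sum f g : sqs f -> sqs g -> exists s, has_sum (fun t => hdot (f t) (g t)) s.
Proof.
move=> sf sg.
have S a : exists s, has_sum (fun t => `|f t + a *: g t| ^+ 2) s.
  by apply: sqs_has_sum; apply: sqsD => //; exact: sqsZ.
have [s1 h1] := S 1; have [s2 h2] := S (-1); have [s3 h3] := S 'i; have [s4 h4] := S (- 'i).
have := has_sumZ 4^-1 (has_sumD (has_sumD h1 (has_sumZ (-1) h2))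
  (has_sumD (has_sumZ 'i h3) (has_sumZ (- 'i) h4))).
set s := _ * _ => hs; exists s; congr has_sum: hs.
by apply/funext => t; rewrite hdot_polarization.
Qed.

(** The value 0 is a default for families that are not summable; [sum_hdotP] excludes it for square
    summable [f] and [g]. *)
Definition sum_hdot f g : R[i] := xget 0 [set s | has_sum (fun t => hdot (f t) (g t)) s].

Lemma sum_hdotP f g : sqs f -> sqs g -> has_sum (fun t => hdot (f t) (g t)) (sum_hdot f g).
Proof. by move=> sf sg; have [s hs] := hdot_has_sum sf sg; exact: (xgetI _ hs). Qed.

End SquareSummable.

(* A linear subspace of [T -> H], closed for pointwise convergence. *)
Record l2_domain (R : realType) (T : choiceType) (H : hilbert R) := L2Domain {
  l2_dom :> (T -> H) -> Prop ;
  l2_dom0 : l2_dom (fun=> 0) ;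
  l2_domL : forall (a : R[i]) f g,
    l2_dom f -> l2_dom g -> l2_dom (fun t => a *: f t + g t) ;
  l2_dom_closed : forall g : T -> H,
    (forall (r : seq T) (e : R[i]), 0 < e ->
      exists2 f, l2_dom f & forall t, t \in r -> `|g t - f t| <= e) ->
    l2_dom g }.

(** * Closed subspaces of l^2 *)

Section L2.
Context {R : realType} {T : choiceType} {H : hilbert R} (K : l2_domain T H).

Definition l2_pred : {pred T -> H} := fun f => `[< sqs f /\ K f >].

Lemma l2_predP f : reflect (sqs f /\ K f) (f \in l2_pred).
Proof. exact: asboolP. Qed.

Lemma l2_submod_closed : submod_closed l2_pred.
Proof.
split; first by apply/l2_predP; split; [exact: sqs0|exact: l2_dom0].
move=> a f g /l2_predP[sf Kf] /l2_predP[sg Kg]; apply/l2_predP.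
by split; [exact: sqsL|exact: l2_domL].
Qed.

HB.instance Definition _ := GRing.isSubmodClosed.Build R[i] (T -> H) l2_pred l2_submod_closed.

Record l2 := L2 { l2_fun :> T -> H ; l2_funP : l2_fun \in l2_pred }.

HB.instance Definition _ := [isSub for l2_fun].
HB.instance Definition _ := [Choice of l2 by <:].
HB.instance Definition _ := [SubChoice_isSubLmodule of l2 by <:].

Implicit Types f g : l2.

Lemma l2_sqs f : sqs f.
Proof. by have /l2_predP[] := l2_funP f. Qed.

Lemma l2_domP f : K f.
Proof. by have /l2_predP[] := l2_funP f. Qed.

Lemma l2_eq f g : (forall t, f t = g t) -> f = g.
Proof. by move=> fg; apply/val_inj/funext. Qed.

Lemma l2LE (a : R[i]) f g t : (a *: f + g) t = a *: f t + g t.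
Proof. by []. Qed.

Lemma l2BE f g t : (f - g) t = f t - g t.
Proof. by []. Qed.

Lemma l20E t : (0 : l2) t = 0.
Proof. by []. Qed.

Definition l2_form f g : R[i] := sum_hdot f g.

Lemma l2_formP f g : has_sum (fun t => hdot (f t) (g t)) (l2_form f g).
Proof. by apply: sum_hdotP; exact: l2_sqs. Qed.

Lemma l2_formC f g : l2_form f g = Num.conj (l2_form g f).
Proof.
apply: has_sum_unique (l2_formP f g) _.
have := has_sum_conj (l2_formP g f); congr has_sum.
by apply/funext => t; rewrite -hdotC.
Qed.

Lemma l2_formL (a : R[i]) f f' g : l2_form (a *: f + f') g = a * l2_form f g + l2_form f' g.
Proof.
apply: has_sum_unique (l2_formP _ g) _.
have := has_sumD (has_sumZ a (l2_formP f g)) (l2_formP f' g); congr has_sum.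
by apply/funext => t; rewrite l2LE hdotDl hdotZl.
Qed.

Lemma l2_form_bilinear : bilinear_for *%R (Num.conj \; *%R) l2_form.
Proof.
split=> [g a f f'|f a g g'] /=; first exact: l2_formL.
by rewrite l2_formC l2_formL rmorphD rmorphM (l2_formC f g) (l2_formC f g').
Qed.

HB.instance Definition _ := @bilinear_isBilinear.Build R[i]
  l2 l2 R[i] *%R (Num.conj \; *%R) l2_form l2_form_bilinear.

Lemma l2_form_hermitian f g : l2_form f g = (-1) ^+ false * Num.conj (l2_form g f).
Proof. by rewrite mul1r; exact: l2_formC. Qed.

HB.instance Definition _ := @isHermitianSesquilinear.Build R[i] l2
  false Num.conj l2_form l2_form_hermitian.

Lemma l2_form_bounds f (M : R[i]) :
  (forall r, uniq r -> \sum_(t <- r) `|f t| ^+ 2 <= M) ->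
  (forall r, uniq r -> \sum_(t <- r) `|f t| ^+ 2 <= l2_form f f) /\ l2_form f f <= M.
Proof.
move=> fM; have [|s [hs hr sM]] := has_sum_ge0 _ fM; first by move=> t; exact: exprn_ge0.
suff -> : l2_form f f = s by [].
apply: has_sum_unique (l2_formP f f) _; move: hs; congr has_sum.
by apply/funext => t; rewrite hdot_norm.
Qed.

Lemma l2_form_sum_le f r : uniq r -> \sum_(t <- r) `|f t| ^+ 2 <= l2_form f f.
Proof. by have [M /l2_form_bounds[+ _]] := l2_sqs f; exact. Qed.

Lemma l2_form_gt0 f : f != 0 -> 0 < l2_form f f.
Proof.
move=> f0; have [t ft] : exists t, f t <> 0.
  apply: contrapT => h; move/eqP: f0; apply; apply: l2_eq => t.
  by rewrite l20E; apply: contrapT => ft; apply: h; exists t.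
apply: lt_le_trans (@l2_form_sum_le f [:: t] isT).
by rewrite big_seq1 exprn_gt0// normr_gt0; apply/eqP.
Qed.

HB.instance Definition _ := @isDotProduct.Build R[i] l2 l2_form l2_form_gt0.

Local Notation V := (normed_by_form l2_form).

Lemma l2_norm (f : V) : `|f| ^+ 2 = l2_form f f.
Proof. by rewrite form_normE sqrtCK. Qed.

Lemma l2_norm_coord (f : V) t : `|(f : l2) t| <= `|f|.
Proof.
rewrite -(@ler_pXn2r _ 2)// ?nnegrE// l2_norm.
by have := @l2_form_sum_le f [:: t] isT; rewrite big_seq1.
Qed.

(** Coordinates converge because the norm dominates them. The limit is compared with [f] on finite
    sets, with a bound independent of the set, and this gives both its square summability and
    convergence in norm. *)
Lemma l2_complete : form_complete l2_form.
Proof.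
move=> F FF /cauchy_ballP cF.
have ct t : cvg ((fun f : V => (f : l2) t : H) @ F).
  apply: cauchy_cvg; apply/cauchy_ballP => e e0.
  have [[A B] /= [FA FB] AB] := cF e e0.
  exists ((fun x : H => exists2 f : V, A f & (f : l2) t = x),
          (fun x : H => exists2 f : V, B f & (f : l2) t = x)).
    by split; [apply: filterS FA|apply: filterS FB] => f Af; exists f.
  move=> [_ _] /= [[f Af <-] [g Bg <-]].
  have := AB (f, g) (conj Af Bg); rewrite -!ball_normE /=.
  exact: le_lt_trans (l2_norm_coord (f - g) t).
have [g0 hg0] := choice (fun t => (iffLR (cvg_ex _)) (ct t)).
have near_r (r : seq T) (e : R[i]) : 0 < e ->
    \forall f \near F, forall t, t \in r -> `|g0 t - (f : l2) t| <= e.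
  move=> e0; elim: r => [|t r IH]; first by apply: nearW => f t; rewrite in_nil.
  have /cvgrPdist_lt := hg0 t; move=> /(_ e e0) ht.
  apply: filterS2 ht IH => f h1 h2 t'; rewrite inE => /orP[/eqP->|]; last exact: h2.
  exact: ltW.
(* The difference g0 - f is split through some [p], chosen after [r], which is close to [f] in norm
   and to [g0] on [r]. By |x + y|^2 <= 2 |x|^2 + 2 |y|^2 each half costs 2 e^2. *)
have est (e : R[i]) : 0 < e -> \forall f \near F, forall r, uniq r ->
    \sum_(t <- r) `|g0 t - (f : l2) t| ^+ 2 <= 4 * e ^+ 2.
  move=> e0; have [[A B] /= [FA FB] AB] := cF e e0.
  apply: filterS FB => f Bf r ur.
  (* With this [d], (size r) d^2 <= e^2; the successor keeps the quotient meaningful for an empty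
     list. *)
  have [d [d0 dN]] : exists d : R[i], 0 < d /\ e = (size r).+1%:R * d.
    by exists (e / (size r).+1%:R); rewrite divr_gt0// mulrC divfK ?pnatr_eq0.
  have [p [Ap hp]] := filter_ex (filterI FA (near_r r d d0)).
  apply: (@le_trans _ _ (\sum_(t <- r) (2 * d ^+ 2 + 2 * `|(p - f : l2) t| ^+ 2))).
    rewrite big_seq [leRHS]big_seq; apply: ler_sum => t tr.
    have -> : g0 t - (f : l2) t = (g0 t - (p : l2) t) + (p - f : l2) t.
      by rewrite l2BE addrA subrK.
    apply: le_trans (norm_sqrD _ _) _; rewrite -mulrDr ler_wpM2l// lerD2r.
    by rewrite ler_pXn2r ?nnegrE ?(ltW d0)// hp.
  have -> : \sum_(t <- r) (2 * d ^+ 2 + 2 * `|(p - f : l2) t| ^+ 2) =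
      2 * ((size r)%:R * d ^+ 2) + 2 * \sum_(t <- r) `|(p - f : l2) t| ^+ 2.
    rewrite big_split /= [in RHS]mulr_sumr; congr (_ + _).
    rewrite big_const_seq count_predT iter_addr_0.
    by rewrite (mulr_natl (d ^+ 2) (size r)) mulrnAr.
  have -> : 4 * e ^+ 2 = 2 * e ^+ 2 + 2 * e ^+ 2 by ring.
  apply: lerD; last first.
    rewrite ler_wpM2l//; apply: (le_trans (l2_form_sum_le (p - f : l2) ur)).
    rewrite -[l2_form _ _](l2_norm (p - f : V)) ler_pXn2r ?nnegrE ?(ltW e0)//.
    by have := AB (p, f) (conj Ap Bf); rewrite -ball_normE => /ltW.
  rewrite ler_wpM2l//.
  rewrite dN exprMn ler_wpM2r ?exprn_ge0 ?(ltW d0)//.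
  rewrite expr2 -natrM ler_nat.
  by rewrite mulnS -addn1 -addnA leq_addr.
have Kg : K g0.
  apply: l2_dom_closed => r e e0; have [f hf] := filter_ex (near_r r e e0).
  by exists (f : l2) => //; exact: l2_domP.
have sg : sqs g0.
  have [f hf] := filter_ex (est 1 ltr01).
  have := sqsD (ex_intro _ _ hf : sqs (fun t => g0 t - (f : l2) t)) (l2_sqs f).
  by congr sqs; apply/funext => t; rewrite subrK.
pose g : V := L2 (introT (l2_predP _) (conj sg Kg)) : l2.
apply/cvg_ex; exists g; apply/cvgrPdist_lt => e e0.
(* The bound 4 (e/4)^2 is (e/2)^2, and e/2 < e gives the strict inequality. *)
have e4 : 0 < e / 4 by rewrite divr_gt0.
apply: filterS (est _ e4) => f hf.
have /le_lt_trans : `|g - f| <= e / 2.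
  rewrite -(@ler_pXn2r _ 2)// ?nnegrE ?divr_ge0 ?(ltW e0)// l2_norm.
  have -> : (e / 2) ^+ 2 = 4 * (e / 4) ^+ 2 by field.
  by have [] := @l2_form_bounds (g - f : l2) _ hf.
by apply; rewrite ltr_pdivrMr// ltr_pMr// ltr1n.
Qed.

Definition hilbert_l2 : hilbert R := hilbert_of_form l2_complete.

Definition l2_mk (f : T -> H) (sf : sqs f) (Kf : K f) : hilbert_l2 :=
  L2 (introT (l2_predP f) (conj sf Kf)).

Definition l2_val (u : hilbert_l2) : T -> H := l2_fun (u : l2).

Implicit Types u v : hilbert_l2.

Lemma l2_val_eq u v : (forall t, l2_val u t = l2_val v t) -> u = v.
Proof. exact: l2_eq. Qed.

Lemma l2_valL (a : R[i]) u v t : l2_val (a *: u + v) t = a *: l2_val u t + l2_val v t.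
Proof. by []. Qed.

Lemma l2_val_dom u : K (l2_val u).
Proof. exact: l2_domP. Qed.

Lemma l2_sum_le u r : uniq r -> \sum_(t <- r) `|l2_val u t| ^+ 2 <= `|u| ^+ 2.
Proof. by rewrite -hdot_norm; exact: l2_form_sum_le. Qed.

Lemma l2_coord_le u t : `|l2_val u t| <= `|u|.
Proof. exact: l2_norm_coord. Qed.

Lemma l2_norm_le u (M : R[i]) : 0 <= M ->
  (forall r, uniq r -> \sum_(t <- r) `|l2_val u t| ^+ 2 <= M ^+ 2) -> `|u| <= M.
Proof.
move=> M0 /l2_form_bounds[_]; rewrite -[l2_form _ _]/(hdot u u) hdot_norm.
by rewrite ler_pXn2r ?nnegrE.
Qed.

Lemma l2_hdot_finite u v r : uniq r ->
  (forall t, t \notin r -> hdot (l2_val u t) (l2_val v t) = 0) ->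
  hdot u v = \sum_(t <- r) hdot (l2_val u t) (l2_val v t).
Proof.
move=> ur h; apply: has_sum_unique (has_sum_finite ur h).
exact: l2_formP.
Qed.

End L2.

(** * Gluing the homogeneous components of a vector *)

Section BoundedSums.
Context {R : realType}.
Implicit Types H K X : hilbert R.

Lemma bounded_add H K (f g : H -> K) : bounded_operator f -> bounded_operator g ->
  bounded_operator (fun x => f x + g x).
Proof.
move=> [fl [M fM]] [gl [N gN]]; split=> [a x y|].
  by rewrite fl gl scalerDr addrACA.
exists (M + N) => x; rewrite mulrDl; apply: le_trans (ler_normD _ _) _.
exact: lerD.
Qed.

Lemma bounded_sum H K (I : Type) (r : seq I) (F : I -> H -> K) :
  (forall i, bounded_operator (F i)) -> bounded_operator (fun x => \sum_(i <- r) F i x).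
Proof.
move=> bF; elim: r => [|i r IH].
  have -> : (fun x : H => \sum_(i <- [::]) F i x) = fun=> 0.
    by apply/funext => x; rewrite big_nil.
  exact: bounded_zero.
have -> : (fun x : H => \sum_(j <- i :: r) F j x) = fun x => F i x + \sum_(j <- r) F j x.
  by apply/funext => x; rewrite big_cons.
exact: bounded_add.
Qed.

Lemma sum_sqr_le (T : Type) (r : seq T) (x : T -> R[i]) : (forall t, 0 <= x t) ->
  \sum_(t <- r) x t ^+ 2 <= (\sum_(t <- r) x t) ^+ 2.
Proof.
move=> x0; elim: r => [|t r IH]; first by rewrite !big_nil expr0n.
rewrite !big_cons sqrrD; have s0 : 0 <= \sum_(j <- r) x j by exact: sumr_ge0.
rewrite -addrA lerD2l; apply: le_trans IH _.
by rewrite lerDr mulrn_wge0// mulr_ge0.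
Qed.

Context {T : choiceType} {H : hilbert R}.

Lemma sqs_finite (f : T -> H) (r : seq T) : uniq r ->
  (forall t, t \notin r -> f t = 0) ->
  forall r', uniq r' -> \sum_(t <- r') `|f t| ^+ 2 <= \sum_(t <- r) `|f t| ^+ 2.
Proof.
move=> ur f0 r' ur'; rewrite (bigID (mem r)) /= [X in _ + X]big1 ?addr0; last first.
  by move=> t /f0 ->; rewrite normr0 expr0n.
rewrite -big_filter; apply: sum_subset_le => //; first exact: filter_uniq.
  by move=> t; rewrite mem_filter => /andP[].
by move=> t; exact: exprn_ge0.
Qed.

(** The sum of the bounds of the finitely many coordinates is a bound, by [sum_sqr_le]. *)
Lemma l2_bounded (K : l2_domain T H) X (f : X -> hilbert_l2 K) (r : seq T) :
  linear f -> uniq r -> (forall x t, t \notin r -> l2_val (f x) t = 0) ->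
  (forall t, bounded_operator (fun x => l2_val (f x) t)) -> bounded_operator f.
Proof.
move=> fl ur f0 fb; split=> //.
have [N hN] := choice (fun t => let: ex_intro2 N N0 h := bounded_ge0 (fb t) in
  ex_intro (fun N => 0 <= N /\ forall x, `|l2_val (f x) t| <= N * `|x|) N (conj N0 h)).
exists (\sum_(t <- r) N t) => x; apply: l2_norm_le => [|r' ur'].
  by rewrite mulr_ge0// sumr_ge0// => t _; case: (hN t).
apply: (le_trans (sqs_finite ur (f0 x) ur')).
rewrite mulr_suml; apply: le_trans (sum_sqr_le _ _); last first.
  by move=> t; rewrite mulr_ge0//; case: (hN t).
apply: ler_sum => t _; have [N0 h] := hN t.
by rewrite ler_pXn2r ?nnegrE ?mulr_ge0.
Qed.

Lemma l2_coord_bounded (K : l2_domain T H) t :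
  bounded_operator (fun u : hilbert_l2 K => l2_val u t).
Proof.
split; first by move=> a u v; exact: l2_valL.
by exists 1 => u; rewrite mul1r; exact: l2_coord_le.
Qed.

Lemma norm_small_eq0 (x : H) (c : R[i]) : 0 <= c ->
  (forall e, 0 < e -> `|x| <= c * e) -> x = 0.
Proof.
move=> c0 h; apply/eqP; rewrite -normr_le0; apply: contrapT => /negP.
rewrite -real_ltNge ?normr_real// => x0.
have c1 : 0 < c + 1 by rewrite ltr_wpDl.
have := h (`|x| / (c + 1)) (divr_gt0 x0 c1).
rewrite mulrCA ler_pMr// ler_pdivlMr// mul1r.
by rewrite gerDl ler10.
Qed.

End BoundedSums.

Section Gluing.
Context {R : realType} {C : rigidTensorCategory R} {D : irrData C}.
Context {I : choiceType} {Y : I -> C} (U : representation D Y).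
Implicit Types (i j : I) (u v : U).

(** The projection onto the part of weight [i]: idempotent because the unit is neutral, self-adjoint
    by [rs_ru]. *)
Definition deg i : U -> U := op (ru D (Y i)).

Lemma op_deg i j (c : ann D (Y i) (Y j)) u : op c (deg i u) = op c u.
Proof. by rewrite op_op rmul1r. Qed.

Lemma deg_idem i u : deg i (deg i u) = deg i u.
Proof. exact: op_deg. Qed.

Lemma deg_neq i j u : i <> j -> deg i (deg j u) = 0.
Proof. exact: op_op0. Qed.

Lemma deg_adj i u v : hdot (deg i u) v = hdot u (deg i v).
Proof. by rewrite /deg op_star rs_ru. Qed.

Lemma hdot0r (H : hilbert R) (x : H) : hdot x 0 = 0.
Proof. by have := hdotZr 0 x 0; rewrite scale0r rmorph0 mul0r. Qed.

Lemma hdot0l (H : hilbert R) (x : H) : hdot 0 x = 0.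
Proof. by have := hdotZl 0 0 x; rewrite scale0r mul0r. Qed.

Lemma hdot_sumr (H : hilbert R) (x : H) (T : Type) (r : seq T) (F : T -> H) :
  hdot x (\sum_(t <- r) F t) = \sum_(t <- r) hdot x (F t).
Proof. exact: (big_morph (hdot x) (hdotDr x) (hdot0r x)). Qed.

Lemma hdot_suml (H : hilbert R) (x : H) (T : Type) (r : seq T) (F : T -> H) :
  hdot (\sum_(t <- r) F t) x = \sum_(t <- r) hdot (F t) x.
Proof. exact: (big_morph (fun y => hdot y x) (fun y z => hdotDl y z x) (hdot0l x)). Qed.

Lemma deg_sum_hdot (F G : I -> U) (r : seq I) : uniq r ->
  (forall i, deg i (F i) = F i) -> (forall i, deg i (G i) = G i) ->
  hdot (\sum_(i <- r) F i) (\sum_(i <- r) G i) = \sum_(i <- r) hdot (F i) (G i).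
Proof.
move=> ur hF hG; rewrite hdot_suml big_seq [RHS]big_seq; apply: eq_bigr => i ir.
rewrite hdot_sumr (bigD1_seq i)//= big1 ?addr0// => j ji.
rewrite -hF deg_adj -hG deg_neq ?hdot0r// => ij.
by rewrite ij eqxx in ji.
Qed.

(** With v the sum of the components, orthogonality gives hdot v v = hdot u v, so that 0 <= |u -
    v|^2 = |u|^2 - hdot u v. *)
Lemma bessel u (r : seq I) : uniq r -> \sum_(i <- r) hdot u (deg i u) <= `|u| ^+ 2.
Proof.
move=> ur; pose v := \sum_(i <- r) deg i u.
have vv : hdot v v = hdot u v.
  rewrite {1 2}/v deg_sum_hdot//; do ?by move=> i; exact: deg_idem.
  by rewrite hdot_sumr; apply: eq_bigr => i _; rewrite deg_adj deg_idem.
rewrite -hdot_sumr -/v.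
have vu : hdot v u = hdot u v by rewrite hdotC -vv -hdotC vv.
have : 0 <= hdot (u - v) (u - v) by rewrite hdot_norm exprn_ge0.
rewrite -scaleN1r hdotDl !hdotDr !hdotZl !hdotZr vv vu rmorphN rmorph1 hdot_norm.
have -> : `|u| ^+ 2 + -1 * hdot u v + (-1 * hdot u v + -1 * (-1 * hdot u v))
  = `|u| ^+ 2 - hdot u v by ring.
by rewrite subr_ge0.
Qed.

Definition finite_sums : set_system (seq I) :=
  filter_from setT (fun r0 : seq I => [set r : seq I | uniq r /\ {subset r0 <= r}]).

Lemma finite_sums_filter : ProperFilter finite_sums.
Proof.
apply: filter_from_proper; last first.
  move=> r _; exists (undup r); split; first exact: undup_uniq.
  by move=> t; rewrite mem_undup.
apply: filter_fromT_filter; first by exists [::].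
move=> r r'; exists (r ++ r') => s [us ss]; split; split=> // t tr; apply: ss;
  by rewrite mem_cat tr ?orbT.
Qed.

(** By orthogonality the square of the norm of a partial sum is the sum of the squares, so partial
    sums are Cauchy along finite subsets; continuity of the projections identifies the components of
    the limit. *)
Lemma glue (x : I -> U) (M : R[i]) : (forall i, deg i (x i) = x i) -> 0 <= M ->
  (forall r, uniq r -> \sum_(i <- r) `|x i| ^+ 2 <= M ^+ 2) ->
  exists2 u, forall i, deg i u = x i & `|u| <= M.
Proof.
move=> hx M0 hM; have FF := finite_sums_filter.
pose S r := \sum_(i <- r) x i.
have S2 r : uniq r -> `|S r| ^+ 2 = \sum_(i <- r) `|x i| ^+ 2.
  move=> ur; rewrite -hdot_norm deg_sum_hdot//.
  by apply: eq_bigr => i _; rewrite hdot_norm.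
have [|s [hs _ _]] := has_sum_ge0 _ hM; first by move=> t; exact: exprn_ge0.
have cS : cvg ((S : seq I -> U) @ finite_sums).
  apply: cauchy_cvg; apply/cauchy_ballP => e e0.
  (* The square of the distance between two partial sums is a difference of two sums of squares,
     each within this bound of [s], hence less than (e/2)^2; two such distances make [e]. *)
  have d0 : 0 < (e / 2) ^+ 2 / 2 by rewrite divr_gt0 ?exprn_gt0 ?divr_gt0.
  have [r0 hr0] := hs _ d0.
  have close r : uniq r -> {subset r0 <= r} -> `|S r - S (undup r0)| < e / 2.
    move=> ur sr; pose r1 := [seq i <- r | i \notin r0].
    have ur1 : uniq r1 by exact: filter_uniq.
    have pr (V : nmodType) (F : I -> V) :
        \sum_(i <- r) F i = \sum_(i <- undup r0) F i + \sum_(i <- r1) F i.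
      rewrite (bigID (fun i => i \in r0)) /= -[X in X + _ = _]big_filter.
      rewrite -[X in _ + X = _]big_filter; congr (_ + _).
      apply: perm_big; apply: uniq_perm; rewrite ?undup_uniq ?filter_uniq//.
      move=> i; rewrite mem_filter mem_undup; case: (boolP (i \in r0)) => //.
      by move=> /sr ->.
    rewrite {1}/S pr -/(S _) addrC addKr -(@ltr_pXn2r _ 2)// ?nnegrE ?divr_ge0 ?(ltW e0)//.
    rewrite -/(S r1) (S2 _ ur1).
    have n0 : 0 <= \sum_(i <- r1) `|x i| ^+ 2.
      by apply: sumr_ge0 => i _; exact: exprn_ge0.
    rewrite -[ltLHS](ger0_norm n0).
    have -> : \sum_(i <- r1) `|x i| ^+ 2 =
        (\sum_(i <- r) `|x i| ^+ 2 - s) - (\sum_(i <- undup r0) `|x i| ^+ 2 - s).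
      by rewrite pr; ring.
    apply: le_lt_trans (ler_normB _ _) _; rewrite [ltRHS]splitr; apply: ltrD.
      exact: hr0.
    by apply: hr0; [exact: undup_uniq|move=> i; rewrite mem_undup].
  pose B := [set v : U | exists r, [/\ uniq r, {subset r0 <= r} & S r = v]].
  have FB : (S @ finite_sums) B.
    by exists r0 => //= r [ur sr]; exists r.
  exists (B, B) => //= -[_ _] /= [[r [ur sr <-]] [r' [ur' sr' <-]]].
  rewrite -ball_normE /= [e]splitr.
  have -> : S r - S r' = (S r - S (undup r0)) - (S r' - S (undup r0)) by rewrite opprB addrA subrK.
  by apply: le_lt_trans (ler_normB _ _) _; apply: ltrD; exact: close.
move/cvg_ex: cS => [u /cvgrPdist_lt hu]; exists u => [i|].
  have [N N0 hN] := bounded_ge0 (op_bounded U (ru D (Y i))).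
  apply/eqP; rewrite -subr_eq0; apply/eqP; apply: (norm_small_eq0 N0) => e e0.
  (* As soon as [r] contains [i], the component of S r of weight [i] is exactly x i. *)
  have Fi : finite_sums [set r | uniq r /\ {subset [:: i] <= r}] by exists [:: i].
  have [r [hr [ur ir]]] := filter_ex (filterI (hu e e0) Fi).
  have {}ir : i \in r by apply: ir; rewrite inE.
  have -> : x i = deg i (S r).
    rewrite /deg op_sumr (bigD1_seq i)//= big1 => [|j ji].
      by rewrite addr0 -/(deg i _) hx.
    rewrite -/(deg i _) -hx deg_neq// => ij; by rewrite ij eqxx in ji.
  rewrite -opB; apply: le_trans (hN _) _.
  by rewrite ler_wpM2l//; exact: ltW.
(* Otherwise a partial sum at distance less than |u| - M from [u] would have norm greater than M. *)
apply: contrapT => /negP; rewrite -real_ltNge ?normr_real ?ger0_real// => Mu.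
have e0 : 0 < `|u| - M by rewrite subr_gt0.
have Ft : finite_sums [set r | uniq r /\ {subset [::] <= r}] by exists [::].
have [r [hr [ur _]]] := filter_ex (filterI (hu _ e0) Ft).
have SM : `|S r| <= M by rewrite -(@ler_pXn2r _ 2)// ?nnegrE// S2// hM.
have : `|u| < `|u|.
  rewrite -{1}[u](subrK (S r)); apply: le_lt_trans (ler_normD _ _) _.
  by rewrite -[ltRHS](subrK M); apply: ltr_leD.
by rewrite ltxx.
Qed.

End Gluing.

(** * Induction *)

(* Each [Z j] is cut into finitely many pieces, each of them a piece of some [Y i]. *)
Record domination (R : realType) (C : rigidTensorCategory R) (I J : choiceType)
    (Y : I -> C) (Z : J -> C) := Domination {
  dom_size : J -> nat ;
  dom_target : forall j, 'I_(dom_size j) -> I ;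
  dom_map : forall j a, mor (Z j) (Y (@dom_target j a)) ;
  dom_sum : forall j, \sum_a (@dom_map j a)^† ∘ @dom_map j a = 1_[Z j] }.

Section ActionSums.
Context {R : realType} {C : rigidTensorCategory R} {D : irrData C}.

Lemma lact_sumr A B B' (g : mor B B') (I : Type) (r : seq I) (F : I -> ann D A B) :
  lact g (\sum_(a <- r) F a) = \sum_(a <- r) lact g (F a).
Proof.
elim/big_rec2 : _ => [|a y1 y2 _ <-].
  by have := lact_linear g (-1) (0 : ann D A B) 0; rewrite !scaleN1r !oppr0 !addr0 addNr.
by have := lact_linear g 1 (F a) y2; rewrite !scale1r.
Qed.

Lemma ract_suml A A' B (g : mor A' A) (I : Type) (r : seq I) (F : I -> ann D A B) :
  ract (\sum_(a <- r) F a) g = \sum_(a <- r) ract (F a) g.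
Proof.
elim/big_rec2 : _ => [|a y1 y2 _ <-].
  by have := ract_linear g (-1) (0 : ann D A B) 0; rewrite !scaleN1r !oppr0 !addr0 addNr.
by have := ract_linear g 1 (F a) y2; rewrite !scale1r.
Qed.

End ActionSums.

Section InducedSpace.
Context {R : realType} {C : rigidTensorCategory R} {D : irrData C}.
Context {I J : choiceType} {Y : I -> C} {Z : J -> C} (W : domination Y Z).
Context (U : representation D Y).

Local Notation n := (dom_size W).
Local Notation w := (@dom_map _ _ _ _ _ _ W _).

Definition dom_index : choiceType := {j : J & 'I_(n j)}.

Definition dom_pair j (a : 'I_(n j)) : dom_index := existT _ j a.

Definition fibers (r : seq J) : seq dom_index :=
  [seq dom_pair a | j <- r, a <- enum 'I_(n j)].

Lemma fibers_uniq r : uniq r -> uniq (fibers r).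
Proof.
move=> ur; apply: allpairs_uniq_dep => //; first by move=> j _; exact: enum_uniq.
by move=> [j a] [j' a'] _ _.
Qed.

Lemma mem_fibers r (t : dom_index) : (t \in fibers r) = (tag t \in r).
Proof.
case: t => j a /=; apply/allpairsPdep/idP => [[j' [a' [jr _]]]|jr].
  by move=> /(congr1 tag) /= ->.
by exists j, a; rewrite mem_enum.
Qed.

Lemma big_fibers (V : nmodType) (r : seq J) (F : dom_index -> V) :
  \sum_(t <- fibers r) F t = \sum_(j <- r) \sum_a F (@dom_pair j a).
Proof. by rewrite big_allpairs_dep; apply: eq_bigr => j _; rewrite big_enum. Qed.

Definition op_matrix j j' (c : ann D (Z j) (Z j')) (h : 'I_(n j) -> U) (b : 'I_(n j')) : U :=
  \sum_a op (ract (lact (w b) c) (w a)^†) (h a).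

(** The relation [dom_sum] inserted between two factors. In this form it contracts the index over
    pieces in products of matrices and of linking operators. *)
Lemma dom_sum_mid A j B (g : mor A B) X X' (c : ann D (Z j) A) (d : ann D X (Z j)) (f : mor X' X) :
  \sum_a ract (lact g (rmul c (lact ((w a)^† ∘ w a) d))) f = ract (lact g (rmul c d)) f.
Proof.
rewrite -ract_suml -lact_sumr -rmul_sumr -lact_suml dom_sum.
by rewrite lact1.
Qed.

Lemma op_matrix_mul j j' j'' (c : ann D (Z j') (Z j'')) (d : ann D (Z j) (Z j')) h b :
  op_matrix c (op_matrix d h) b = op_matrix (rmul c d) h b.
Proof.
rewrite /op_matrix; under eq_bigr => a _ do rewrite op_sumr.
rewrite exchange_big /=; apply: eq_bigr => e _.
rewrite -dom_sum_mid op_suml; apply: eq_bigr => a _.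
by rewrite op_op rmul_nat lactA.
Qed.

Lemma op_matrix_star j j' (c : ann D (Z j) (Z j')) h h' :
  \sum_b hdot (op_matrix c h b) (h' b) = \sum_a hdot (h a) (op_matrix (rs c) h' a).
Proof.
under eq_bigr => b _ do rewrite hdot_suml.
under [RHS]eq_bigr => a _ do rewrite hdot_sumr.
rewrite exchange_big /=; apply: eq_bigr => a _; apply: eq_bigr => b _.
by rewrite op_star rs_nat adjK.
Qed.

Lemma op_matrix_suml j j' (K : Type) (r : seq K) (c : K -> ann D (Z j) (Z j')) h b :
  op_matrix (\sum_(k <- r) c k) h b = \sum_(k <- r) op_matrix (c k) h b.
Proof.
rewrite /op_matrix exchange_big /=; apply: eq_bigr => a _.
by rewrite lact_sumr ract_suml op_suml.
Qed.

Lemma op_matrixLl j j' (x : R[i]) (c d : ann D (Z j) (Z j')) h b :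
  op_matrix (x *: c + d) h b = x *: op_matrix c h b + op_matrix d h b.
Proof.
rewrite /op_matrix scaler_sumr -big_split; apply: eq_bigr => a _ /=.
by rewrite lact_linear ract_linear opL.
Qed.

Lemma op_matrix0l j j' h b : op_matrix (0 : ann D (Z j) (Z j')) h b = 0.
Proof.
by have := op_matrixLl (-1) (0 : ann D (Z j) (Z j')) 0 h b; rewrite !scaleN1r oppr0 addr0 addNr.
Qed.

Lemma op_matrix_sumr j j' (c : ann D (Z j) (Z j')) (K : Type) (r : seq K)
    (h : K -> 'I_(n j) -> U) b :
  op_matrix c (fun a => \sum_(k <- r) h k a) b = \sum_(k <- r) op_matrix c (h k) b.
Proof.
by rewrite /op_matrix exchange_big /=; apply: eq_bigr => a _; rewrite op_sumr.
Qed.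

Lemma op_matrixLr j j' (c : ann D (Z j) (Z j')) (x : R[i]) h h' b :
  op_matrix c (fun a => x *: h a + h' a) b = x *: op_matrix c h b + op_matrix c h' b.
Proof.
rewrite /op_matrix scaler_sumr -big_split; apply: eq_bigr => a _ /=.
by rewrite (op_bounded U (ract (lact (w b) c) (w a)^†)).1.
Qed.

Lemma op_matrix0r j j' (c : ann D (Z j) (Z j')) h b :
  (forall a, h a = 0) -> op_matrix c h b = 0.
Proof. by move=> h0; apply: big1 => a _; rewrite h0 op0r. Qed.

(** The range of the projection given by the matrices of the units. By [op_matrix_mul] and [rmul1r]
    a matrix only sees this part of a column, so on all of l^2 the action would in general be
    degenerate. *)
Definition induced_dom (f : dom_index -> U) : Prop := forall j b,
  op_matrix (ru D (Z j)) (fun a => f (dom_pair a)) b = f (@dom_pair j b).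

Lemma induced_dom0 : induced_dom (fun=> 0).
Proof. by move=> j b; exact: op_matrix0r. Qed.

Lemma induced_domL (x : R[i]) f g : induced_dom f -> induced_dom g ->
  induced_dom (fun t => x *: f t + g t).
Proof. by move=> hf hg j b; rewrite op_matrixLr hf hg. Qed.

Lemma induced_dom_closed (g : dom_index -> U) :
  (forall (r : seq dom_index) (e : R[i]), 0 < e ->
    exists2 f, induced_dom f & forall t, t \in r -> `|g t - f t| <= e) ->
  induced_dom g.
Proof.
move=> hg j b; apply/eqP; rewrite -subr_eq0; apply/eqP.
have [N hN] := choice (fun a : 'I_(n j) =>
  let: ex_intro2 N N0 h := bounded_ge0 (op_bounded U (ract (lact (w b) (ru D (Z j))) (w a)^†)) in
  ex_intro (fun N => 0 <= N /\ forall u, `|op (ract (lact (w b) (ru D (Z j))) (w a)^†) u|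
    <= N * `|u|) N (conj N0 h)).
have N0 : 0 <= \sum_a N a by apply: sumr_ge0 => a _; case: (hN a).
(* The sum of the N_a accounts for the matrix, and 1 for the single coordinate at [b]. *)
apply: (@norm_small_eq0 _ _ _ (\sum_a N a + 1)); first by rewrite addr_ge0.
move=> e e0; have [f hf fg] := hg (fibers [:: j]) e e0.
have fg' a : `|g (@dom_pair j a) - f (dom_pair a)| <= e.
  by apply: fg; rewrite mem_fibers inE /=.
have -> : op_matrix (ru D (Z j)) (fun a => g (dom_pair a)) b - g (dom_pair b) =
    op_matrix (ru D (Z j)) (fun a => (-1) *: f (dom_pair a) + g (dom_pair a)) b
    - (g (dom_pair b) - f (dom_pair b)).
  by rewrite op_matrixLr hf scaleN1r opprB [- _ + _]addrC addrA subrK.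
apply: le_trans (ler_normB _ _) _; rewrite mulrDl mul1r; apply: lerD => //.
apply: le_trans (ler_norm_sum _ _ _) _; rewrite mulr_suml; apply: ler_sum => a _.
have [Na h] := hN a; apply: le_trans (h _) _; rewrite ler_wpM2l//.
by rewrite scaleN1r addrC fg'.
Qed.

Definition induced_domain := L2Domain induced_dom0 induced_domL induced_dom_closed.

Definition induced_space : hilbert R := hilbert_l2 induced_domain.

Implicit Types u v : induced_space.

Definition fiber u j (a : 'I_(n j)) : U := l2_val u (dom_pair a).

Lemma fiberP u j b : op_matrix (ru D (Z j)) (@fiber u j) b = fiber u b.
Proof. exact: (l2_val_dom u). Qed.

Lemma induced_eq u v : (forall j (a : 'I_(n j)), fiber u a = fiber v a) -> u = v.
Proof. by move=> uv; apply: l2_val_eq => -[j a]; exact: uv. Qed.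

Definition act_fun (z : annular D Z) u (t : dom_index) : U :=
  \sum_(j \in [set: J]) op_matrix (block z j (tag t)) (@fiber u j) (tagged t).

Lemma act_funE z u (t : dom_index) (r : seq J) : uniq r ->
  (forall j, j \notin r -> block z j (tag t) = 0) ->
  act_fun z u t = \sum_(j <- r) op_matrix (block z j (tag t)) (@fiber u j) (tagged t).
Proof. by move=> ur hr; apply: fsumE => // j /hr ->; exact: op_matrix0l. Qed.

Lemma degrees_l (z : annular D Z) (r : seq J) j j' :
  (forall i j, (i \notin r) || (j \notin r) -> block z i j = 0) ->
  j \notin r -> block z j j' = 0.
Proof. by move=> hr jr; rewrite hr// jr. Qed.

Lemma act_fun_out z u t (r : seq J) :
  (forall i j, (i \notin r) || (j \notin r) -> block z i j = 0) ->
  t \notin fibers r -> act_fun z u t = 0.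
Proof.
move=> hr; rewrite mem_fibers => tr; rewrite (@act_funE z u t [::])// ?big_nil//.
by move=> j _; rewrite hr// tr orbT.
Qed.

Lemma act_fun_sqs z u : sqs (act_fun z u).
Proof.
have [r ur hr] := annular_degrees z.
eexists; apply: sqs_finite (fibers_uniq ur) _ => t; exact: act_fun_out.
Qed.

Lemma act_fun_dom z u : induced_dom (act_fun z u).
Proof.
move=> j b; have [r ur hr] := annular_degrees z.
rewrite (act_funE _ ur) => [|i ir]; last exact: degrees_l hr ir.
under [X in op_matrix _ X _]funext => a.
  rewrite (act_funE _ ur) => [|i ir]; last exact: degrees_l hr ir.
  over.
rewrite op_matrix_sumr; apply: eq_bigr => i _ /=.
by rewrite op_matrix_mul rmul1l.
Qed.

Definition act z u : induced_space :=
  l2_mk (K := induced_domain) (act_fun_sqs z u) (act_fun_dom z u).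

Lemma act_fiber z u j (b : 'I_(n j)) (r : seq J) : uniq r ->
  (forall i, i \notin r -> block z i j = 0) ->
  fiber (act z u) b = \sum_(i <- r) op_matrix (block z i j) (@fiber u i) b.
Proof. exact: (@act_funE z u (dom_pair b)). Qed.

Lemma act_linear_r z (x : R[i]) u v : act z (x *: u + v) = x *: act z u + act z v.
Proof.
have [r ur hr] := annular_degrees z.
apply: induced_eq => j b; rewrite [RHS]/fiber l2_valL -!/(fiber _ _).
rewrite !(act_fiber _ _ ur); do ?by move=> i; exact: degrees_l hr.
by rewrite scaler_sumr -big_split; apply: eq_bigr => i _; exact: op_matrixLr.
Qed.

Lemma act_bounded z : bounded_operator (act z).
Proof.
have [r ur hr] := annular_degrees z.
apply: (l2_bounded (r := fibers r)); last first.
- move=> [j b]; have -> : (fun u => l2_val (act z u) (existT _ j b)) =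
      (fun u => \sum_(i <- r) op_matrix (block z i j) (@fiber u i) b).
    by apply/funext => u; apply: act_fiber => // i; exact: degrees_l hr.
  apply: bounded_sum => i; apply: bounded_sum => a.
  exact: (bounded_comp (op_bounded U _) (l2_coord_bounded _ _)).
- by move=> u t; exact: act_fun_out.
- exact: fibers_uniq.
- by move=> x u v; exact: act_linear_r.
Qed.

Lemma act_linear_l (x : R[i]) (y z : annular D Z) u :
  act (x *: y + z) u = x *: act y u + act z u.
Proof.
have [ry _ hry] := annular_degrees y; have [rz _ hrz] := annular_degrees z.
have ur := undup_uniq (ry ++ rz).
have hr i : i \notin undup (ry ++ rz) -> i \notin ry /\ i \notin rz.
  by rewrite mem_undup mem_cat negb_or => /andP.
apply: induced_eq => j b; rewrite [RHS]/fiber l2_valL -!/(fiber _ _).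
rewrite (act_fiber (z := y) _ _ ur); last by move=> i /hr[h _]; exact: degrees_l hry h.
rewrite (act_fiber (z := z) _ _ ur); last by move=> i /hr[_ h]; exact: degrees_l hrz h.
rewrite (act_fiber _ _ ur); last first.
  move=> i /hr[h1 h2].
  by rewrite blockL (degrees_l _ hry h1) (degrees_l _ hrz h2) scaler0 addr0.
rewrite scaler_sumr -big_split; apply: eq_bigr => i _ /=.
by rewrite blockL op_matrixLl.
Qed.

Lemma act_mul (y z : annular D Z) u : act (annular_mul y z) u = act y (act z u).
Proof.
have [ry _ hry] := annular_degrees y; have [rz _ hrz] := annular_degrees z.
set r := undup (ry ++ rz); have ur : uniq r by exact: undup_uniq.
have hr i : i \notin r -> i \notin ry /\ i \notin rz.
  by rewrite mem_undup mem_cat negb_or => /andP.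
have hy i j : i \notin r -> block y i j = 0 by move=> /hr[h _]; exact: degrees_l hry h.
have hz i j : i \notin r -> block z i j = 0 by move=> /hr[_ h]; exact: degrees_l hrz h.
have yz i j : block (annular_mul y z) i j = \sum_(s <- r) rmul (block y s j) (block z i s).
  by apply: block_mul => // s /hy ->; left.
apply: induced_eq => j b; rewrite (act_fiber _ _ ur); last first.
  by move=> i ir; rewrite yz big1// => s _; rewrite (hz _ _ ir) rmul0r.
rewrite (act_fiber _ _ ur) => [|i]; last exact: hy.
under eq_bigr => i _ do rewrite yz op_matrix_suml.
rewrite exchange_big /=; apply: eq_bigr => s _.
have -> : @fiber (act z u) s = fun a => \sum_(i <- r) op_matrix (block z i s) (@fiber u i) a.
  by apply/funext => a; apply: act_fiber => // i; exact: hz.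
by rewrite op_matrix_sumr; apply: eq_bigr => i _; rewrite op_matrix_mul.
Qed.

(** Only the fibers over the finitely many weights of [z] contribute, and there [op_matrix_star]
    applies block by block. *)
Lemma act_star (z : annular D Z) u v : hdot (act z u) v = hdot u (act (annular_star z) v).
Proof.
have [r ur hr] := annular_degrees z.
have hs i j : (i \notin r) || (j \notin r) -> block (annular_star z) i j = 0.
  by rewrite orbC => h; rewrite block_star hr// rs0.
rewrite (l2_hdot_finite (fibers_uniq ur)); last first.
  by move=> t tr; rewrite [l2_val (act z u) t](act_fun_out _ hr tr) hdot0l.
rewrite (l2_hdot_finite (fibers_uniq ur)); last first.
  by move=> t tr; rewrite [l2_val (act _ v) t](act_fun_out _ hs tr) hdot0r.
rewrite !big_fibers.
transitivity (\sum_(j <- r) \sum_(i <- r) \sum_b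
    hdot (op_matrix (block z i j) (@fiber u i) b) (@fiber v j b)).
  apply: eq_bigr => j _; rewrite [RHS]exchange_big /=; apply: eq_bigr => b _.
  rewrite -hdot_suml; congr (hdot _ _).
  by apply: act_fiber => // i; exact: degrees_l hr.
rewrite exchange_big /=; apply: eq_bigr => i _.
under eq_bigr => j _ do rewrite op_matrix_star -block_star.
rewrite exchange_big /=; apply: eq_bigr => a _; rewrite -hdot_sumr; congr (hdot _ _).
by apply/esym; apply: act_fiber => // j; exact: degrees_l hs.
Qed.

(** The unit of Z_j acts on the fiber over j by the very projection that fixes it. *)
Lemma act_nondegenerate u : (forall z, act z u = 0) -> u = 0.
Proof.
move=> h; apply: induced_eq => j b; rewrite -fiberP.
have := congr1 (fun v => @fiber v j b) (h (blk (ru D (Z j)))).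
rewrite (@act_fiber (blk (ru D (Z j))) u j b [:: j])// => [|i]; first by rewrite big_seq1 blkK.
by rewrite inE => /eqP ij; rewrite blk_neq// => -[].
Qed.

Definition induced : representation D Z :=
  Representation act_bounded act_linear_l act_mul act_star act_nondegenerate.

Lemma op_fiber j j' (c : ann D (Z j) (Z j')) (u : induced) b :
  @fiber (op c u) j' b = op_matrix c (@fiber u j) b.
Proof.
rewrite [LHS](@act_fiber (blk c) u j' b [:: j])// => [|i]; first by rewrite big_seq1 blkK.
by rewrite inE => /eqP ij; rewrite blk_neq// => -[].
Qed.

Lemma op_fiber_neq j j' (c : ann D (Z j) (Z j')) (u : induced) s (b : 'I_(n s)) :
  s <> j' -> fiber (op c u) b = 0.
Proof.
move=> sj; rewrite [LHS](@act_fiber (blk c) u s b [::])// ?big_nil// => i _.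
by rewrite blk_neq// => -[].
Qed.

End InducedSpace.

(** * Linking operators between a representation and the induced one *)

Section Linking.
Context {R : realType} {C : rigidTensorCategory R} {D : irrData C}.
Context {I J : choiceType} {Y : I -> C} {Z : J -> C} (W : domination Y Z).
Context (U : representation D Y).

Local Notation n := (dom_size W).
Local Notation w := (@dom_map _ _ _ _ _ _ W _).
Local Notation V := (induced W U).
Local Notation fib := (@fiber R C D I J Y Z W U).

(** [untag] places the column in the fiber over [j] and 0 in all others. *)
Definition link_fun i j (c : ann D (Y i) (Z j)) (x : U) (t : dom_index W) : U :=
  untag 0 (fun a : 'I_(n j) => op (lact (w a) c) x) t.

Lemma link_fun_same i j (c : ann D (Y i) (Z j)) x (a : 'I_(n j)) :
  link_fun c x (dom_pair a) = op (lact (w a) c) x.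
Proof. by rewrite /link_fun untagE. Qed.

Lemma link_fun_neq i j (c : ann D (Y i) (Z j)) x j' (a : 'I_(n j')) :
  j' <> j -> link_fun c x (dom_pair a) = 0.
Proof. by move=> /eqP jj; rewrite /link_fun untag_dflt. Qed.

Lemma op_matrix_link i j j' (d : ann D (Z j) (Z j')) (c : ann D (Y i) (Z j)) (x : U) (b : 'I_(n j')) :
  op_matrix d (fun a : 'I_(n j) => op (lact (w a) c) x) b = op (lact (w b) (rmul d c)) x.
Proof.
rewrite /op_matrix.
have := dom_sum_mid W (w b) d c 1_[Y i]; rewrite ract1 => <-.
rewrite op_suml; apply: eq_bigr => a _.
by rewrite op_op rmul_mid rmul_lact lactA ract1.
Qed.

Lemma link_fun_sqs i j (c : ann D (Y i) (Z j)) x : sqs (link_fun c x).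
Proof.
eexists; apply: (sqs_finite (r := fibers W [:: j])); first exact: fibers_uniq.
move=> [j' a]; rewrite mem_fibers inE => /eqP; exact: link_fun_neq.
Qed.

Lemma link_fun_dom i j (c : ann D (Y i) (Z j)) x : induced_dom (link_fun c x).
Proof.
move=> j' b; have [jj|jj] := pselect (j' = j); last first.
  by rewrite link_fun_neq// op_matrix0r// => a; exact: link_fun_neq.
subst j'; rewrite link_fun_same -{2}[c]rmul1l -op_matrix_link.
by congr op_matrix; apply/funext => a; exact: link_fun_same.
Qed.

(** With [colink], the off-diagonal corners of the linking algebra of Y and Z, acting between U and
    V. They are adjoint by [link_adj]; the other lemmas are their multiplication table with the
    operators of U and V. *)
Definition link i j (c : ann D (Y i) (Z j)) (x : U) : V :=
  l2_mk (K := induced_domain W U) (link_fun_sqs c x) (link_fun_dom c x).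

Definition colink i j (c : ann D (Z j) (Y i)) (v : V) : U :=
  \sum_a op (ract c (w a)^†) (fib v a).

Lemma link_fiber i j (c : ann D (Y i) (Z j)) x (a : 'I_(n j)) :
  fib (link c x) a = op (lact (w a) c) x.
Proof. exact: link_fun_same. Qed.

Lemma link_fiber_neq i j (c : ann D (Y i) (Z j)) x j' (a : 'I_(n j')) :
  j' <> j -> fib (link c x) a = 0.
Proof. exact: link_fun_neq. Qed.

Lemma linkL i j (c : ann D (Y i) (Z j)) (a : R[i]) x y :
  link c (a *: x + y) = a *: link c x + link c y.
Proof.
apply: induced_eq => j' b; rewrite [RHS]l2_valL -!/(fib _ _).
have [jj|jj] := pselect (j' = j); last by rewrite !link_fiber_neq// scaler0 addr0.
by subst j'; rewrite !link_fiber (op_bounded U (lact (w b) c)).1.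
Qed.

Lemma link_sumr i j (c : ann D (Y i) (Z j)) (K : Type) (r : seq K) (F : K -> U) :
  link c (\sum_(k <- r) F k) = \sum_(k <- r) link c (F k).
Proof.
have lD x y : link c (x + y) = link c x + link c y.
  by have := linkL c 1 x y; rewrite !scale1r.
have l0 : link c 0 = 0.
  by have := linkL c (-1) 0 0; rewrite !scaleN1r oppr0 addr0 addNr.
exact: (big_morph (link c) lD l0).
Qed.

Lemma link_suml i j (K : Type) (r : seq K) (c : K -> ann D (Y i) (Z j)) x :
  link (\sum_(k <- r) c k) x = \sum_(k <- r) link (c k) x.
Proof.
have lL (a : R[i]) (c1 c2 : ann D (Y i) (Z j)) :
    link (a *: c1 + c2) x = a *: link c1 x + link c2 x.
  apply: induced_eq => j' b; rewrite [RHS]l2_valL -!/(fib _ _).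
  have [jj|jj] := pselect (j' = j); last by rewrite !link_fiber_neq// scaler0 addr0.
  by subst j'; rewrite !link_fiber lact_linear opL.
have lD (c1 c2 : ann D (Y i) (Z j)) : link (c1 + c2) x = link c1 x + link c2 x.
  by have := lL 1 c1 c2; rewrite !scale1r.
have l0 : link (0 : ann D (Y i) (Z j)) x = 0.
  by have := lL (-1) 0 0; rewrite !scaleN1r oppr0 addr0 addNr.
exact: (big_morph (fun c => link c x) lD l0).
Qed.

Lemma link_op i i' j (c : ann D (Y i) (Z j)) (d : ann D (Y i') (Y i)) x :
  link c (op d x) = link (rmul c d) x.
Proof.
apply: induced_eq => j' b.
have [jj|jj] := pselect (j' = j); last by rewrite !link_fiber_neq.
by subst j'; rewrite !link_fiber op_op rmul_lact.
Qed.

Lemma link_op0 i i' i'' j (c : ann D (Y i) (Z j)) (d : ann D (Y i') (Y i'')) x :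
  i <> i'' -> link c (op d x) = 0.
Proof.
move=> ii; apply: induced_eq => j' b.
have [jj|jj] := pselect (j' = j); last by rewrite link_fiber_neq.
by subst j'; rewrite link_fiber op_op0.
Qed.

Lemma op_link i j j' (d : ann D (Z j) (Z j')) (c : ann D (Y i) (Z j)) x :
  op d (link c x) = link (rmul d c) x.
Proof.
apply: induced_eq => s b; have [sj|sj] := pselect (s = j'); last first.
  by rewrite op_fiber_neq// link_fiber_neq.
subst s; rewrite op_fiber link_fiber -op_matrix_link.
by congr op_matrix; apply/funext => a; exact: link_fiber.
Qed.

(** Here the middle object Z_j is cut into pieces, so [dom_sum] is used; in [link_colink] the middle
    object is Y_i and the summands match one by one. *)
Lemma colink_link i i' j (c : ann D (Z j) (Y i')) (d : ann D (Y i) (Z j)) x :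
  colink c (link d x) = op (rmul c d) x.
Proof.
rewrite /colink; have := dom_sum_mid W 1_[_] c d 1_[_]; rewrite ract1 lact1 => <-.
rewrite op_suml; apply: eq_bigr => a _.
by rewrite link_fiber op_op rmul_mid ract1 lact1 lactA.
Qed.

Lemma link_colink i j j' (c : ann D (Y i) (Z j')) (d : ann D (Z j) (Y i)) v :
  link c (colink d v) = op (rmul c d) v.
Proof.
apply: induced_eq => s b; have [sj|sj] := pselect (s = j'); last first.
  by rewrite op_fiber_neq// link_fiber_neq.
subst s; rewrite op_fiber link_fiber /colink op_sumr; apply: eq_bigr => a _.
by rewrite op_op rmul_ract rmul_lact.
Qed.

Lemma op_colink i i' j (c : ann D (Y i) (Y i')) (d : ann D (Z j) (Y i)) v :
  op c (colink d v) = colink (rmul c d) v.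
Proof.
rewrite /colink op_sumr; apply: eq_bigr => a _.
by rewrite op_op rmul_ract.
Qed.

Lemma link_adj i j (c : ann D (Y i) (Z j)) x v :
  hdot (link c x) v = hdot x (colink (rs c) v).
Proof.
rewrite (l2_hdot_finite (fibers_uniq W (isT : uniq [:: j]))); last first.
  move=> [j' a]; rewrite mem_fibers inE => /eqP jj.
  by rewrite [l2_val (link c x) _](link_fun_neq c x a jj) hdot0l.
rewrite big_fibers big_seq1 /colink hdot_sumr; apply: eq_bigr => a _.
rewrite [l2_val (link c x) _](link_fun_same c x a) op_star.
by have := rs_nat c (w a) 1_[Y i]; rewrite ract1 adj1 lact1 => ->.
Qed.

End Linking.

(** * Induction as an additive functor *)

Section InductionFunctor.
Context {R : realType} {C : rigidTensorCategory R} {D : irrData C}.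
Context {I J : choiceType} {Y : I -> C} {Z : J -> C} (W : domination Y Z).

Lemma intertwiner_op (U V : representation D Y) (f : intertwiner U V) i j
    (c : ann D (Y i) (Y j)) x : f (op c x) = op c (f x).
Proof. by have /is_intertwinerP[_ h] := intertwiner_funP f; exact: h. Qed.

Lemma intertwiner_bounded (U V : representation D Y) (f : intertwiner U V) :
  bounded_operator f.
Proof. by have /is_intertwinerP[] := intertwiner_funP f. Qed.

Section Map.
Context {U V : representation D Y} (f : intertwiner U V).

Lemma intertwiner_sum (K : Type) (r : seq K) (F : K -> U) :
  f (\sum_(k <- r) F k) = \sum_(k <- r) f (F k).
Proof.
have [fl _] := intertwiner_bounded f.
have fD x y : f (x + y) = f x + f y by have := fl 1 x y; rewrite !scale1r.
have f0 : f 0 = 0 by have := fl (-1) 0 0; rewrite !scaleN1r oppr0 addr0 addNr.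
exact: (big_morph f fD f0).
Qed.

Lemma link_intertwiner i j (c : ann D (Y i) (Z j)) x (t : dom_index W) :
  f (link_fun c x t) = link_fun c (f x) t.
Proof.
rewrite /link_fun /untag; case: eqP => [e|_]; first exact: intertwiner_op.
by have := intertwiner_sum [::] (fun _ : nat => 0); rewrite !big_nil.
Qed.

Lemma op_matrix_intertwiner j j' (c : ann D (Z j) (Z j'))
    (h : 'I_(dom_size W j) -> U) (b : 'I_(dom_size W j')) :
  f (op_matrix c h b) = op_matrix c (fun a => f (h a)) b.
Proof.
by rewrite /op_matrix intertwiner_sum; apply: eq_bigr => a _; rewrite intertwiner_op.
Qed.

Lemma induced_map_sqs :
  exists2 M : R[i], 0 <= M & forall (u : induced_space W U) r, uniq r ->
    \sum_(t <- r) `|f (l2_val u t)| ^+ 2 <= (M * `|u|) ^+ 2.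
Proof.
have [M M0 hM] := bounded_ge0 (intertwiner_bounded f); exists M => // u r ur.
apply: (@le_trans _ _ (\sum_(t <- r) M ^+ 2 * `|l2_val u t| ^+ 2)).
  by apply: ler_sum => t _; rewrite -exprMn ler_pXn2r ?nnegrE ?mulr_ge0.
by rewrite -mulr_sumr exprMn ler_wpM2l ?exprn_ge0// l2_sum_le.
Qed.

Lemma induced_map_dom (u : induced_space W U) :
  induced_dom (fun t : dom_index W => f (l2_val u t)).
Proof. by move=> j b; rewrite -op_matrix_intertwiner (l2_val_dom u). Qed.

Lemma induced_map_sqs1 (u : induced_space W U) : sqs (fun t => f (l2_val u t)).
Proof. by have [M _ h] := induced_map_sqs; exists ((M * `|u|) ^+ 2); exact: h. Qed.

Definition induced_map_fun (u : induced W U) : induced W V :=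
  l2_mk (K := induced_domain W V) (induced_map_sqs1 u) (induced_map_dom u).

Lemma induced_map_fiber u j (a : 'I_(dom_size W j)) :
  fiber (induced_map_fun u) a = f (fiber u a).
Proof. by []. Qed.

Lemma induced_map_subproof : induced_map_fun \in @is_intertwiner R C D J Z (induced W U) (induced W V).
Proof.
apply/is_intertwinerP; split; first split.
- move=> a u v; apply: induced_eq => j b; rewrite [RHS]l2_valL induced_map_fiber.
  by rewrite [fiber _ _]l2_valL (intertwiner_bounded f).1.
- have [M M0 h] := induced_map_sqs; exists M => u.
  by apply: l2_norm_le => [|r]; [exact: mulr_ge0|exact: h].
move=> z u; have [r ur hr] := annular_degrees z; apply: induced_eq => j b.
have hj i : i \notin r -> block z i j = 0 by exact: degrees_l hr.
rewrite induced_map_fiber [fiber (action z u) b](act_fiber _ _ ur hj).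
rewrite [RHS](act_fiber _ _ ur hj) intertwiner_sum; apply: eq_bigr => i _.
exact: op_matrix_intertwiner.
Qed.

Definition induced_map : intertwiner (induced W U) (induced W V) :=
  Intertwiner induced_map_subproof.

End Map.

Lemma induced_map1 (U : Rep D Y) : induced_map (hid U) = hid (induced W U : Rep D Z).
Proof. by apply: intertwiner_eq => u; exact: induced_eq. Qed.

Lemma induced_map_comp (U V X : Rep D Y) (g : hom V X) (f : hom U V) :
  induced_map (hcomp g f) = hcomp (induced_map g : hom (induced W V : Rep D Z) (induced W X))
    (induced_map f).
Proof. by apply: intertwiner_eq => u; exact: induced_eq. Qed.

Lemma induced_mapD (U V : Rep D Y) (f g : hom U V) :
  induced_map (f + g) = induced_map f + induced_map g.
Proof. by apply: intertwiner_eq => u; exact: induced_eq. Qed.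

Definition induction : additiveFunctor (Rep D Y) (Rep D Z) :=
  @AdditiveFunctor (Rep D Y) (Rep D Z) (induced W) (@induced_map)
    induced_map1 induced_map_comp induced_mapD.

(** The norm bound on preimages is the boundedness of the inverse, which is linear and intertwining
    by injectivity. *)
Lemma isometric_iso (U V : Rep D Y) (f : hom U V) :
  (forall x : U, (f : intertwiner U V) x = 0 -> x = 0) ->
  (forall v : V, exists2 x : U, (f : intertwiner U V) x = v & `|x| <= `|v|) -> is_iso f.
Proof.
move=> finj fsurj; pose f' : intertwiner U V := f.
have fl := (intertwiner_bounded f').1.
have inj x y : f' x = f' y -> x = y.
  move=> xy; apply/eqP; rewrite -subr_eq0; apply/eqP; apply: finj.
  by rewrite addrC -scaleN1r fl scaleN1r -/f' xy addNr.
have [g hg] := choice (fun v => let: ex_intro2 x h1 h2 := fsurj v in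
  ex_intro (fun x => f' x = v /\ `|x| <= `|v|) x (conj h1 h2)).
have gP : g \in @is_intertwiner _ _ D _ Y V U.
  apply/is_intertwinerP; split; first split.
  - by move=> a u v; apply: inj; rewrite fl !(hg _).1.
  - by exists 1 => v; rewrite mul1r; exact: (hg v).2.
  move=> z v; apply: inj; have /is_intertwinerP[_ ->] := intertwiner_funP f'.
  by rewrite !(hg _).1.
exists (Intertwiner gP); split; apply: intertwiner_eq => x /=.
  by apply: inj; rewrite (hg _).1.
exact: (hg x).1.
Qed.

End InductionFunctor.

(** * Inducing from Y to Z and back *)

Section Unit.
Context {R : realType} {C : rigidTensorCategory R} {D : irrData C}.
Context {I J : choiceType} {Y : I -> C} {Z : J -> C}.
Context (W : domination Y Z) (W' : domination Z Y) (U : representation D Y).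

Local Notation w' := (@dom_map _ _ _ _ _ _ W' _).
Local Notation V := (induced W U).
Local Notation UU := (induced W' V).

(** The morphism w'_b seen as an annular morphism in the component X_0. *)
Definition unit_elt i (b : 'I_(dom_size W' i)) : ann D (Y i) (Z (dom_target b)) :=
  lact (w' b) (ru D (Y i)).

Definition unit_fun (x : U) (t : dom_index W') : V :=
  link W (unit_elt (tagged t)) x.

Lemma rs_unit_elt i (b : 'I_(dom_size W' i)) : rs (unit_elt b) = ract (ru D (Y i)) (w' b)^†.
Proof. by have := rs_nat (ru D (Y i)) (w' b) 1_[Y i]; rewrite ract1 adj1 lact1 rs_ru. Qed.

Lemma rmul_rs_unit_elt i (b : 'I_(dom_size W' i)) :
  rmul (rs (unit_elt b)) (unit_elt b) = lact ((w' b)^† ∘ w' b) (ru D (Y i)).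
Proof. by rewrite rs_unit_elt rmul_mid rmul1l /unit_elt lactA. Qed.

(** By adjointness each square is the scalar product of x with w'_b^* w'_b x, and over the pieces of
    Y_i these operators add up to the unit. *)
Lemma unit_fun_sum (x : U) i :
  \sum_b `|unit_fun x (@dom_pair _ _ _ _ _ _ W' i b)| ^+ 2 = hdot x (deg i x).
Proof.
transitivity (\sum_b hdot x (op (lact ((@dom_map _ _ _ _ _ _ W' i b)^† ∘ w' b) (ru D (Y i))) x)).
  apply: eq_bigr => b _.
  have -> : unit_fun x (dom_pair b) = link W (unit_elt b) x by [].
  rewrite -[LHS](hdot_norm (link W (unit_elt b) x)).
  rewrite link_adj.
  rewrite colink_link.
  by rewrite rmul_rs_unit_elt.
by rewrite -hdot_sumr -op_suml -lact_suml dom_sum lact1.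
Qed.

(** The list of pieces is enlarged to whole fibers, over which the squares add up to the terms of
    Bessel's inequality. *)
Lemma unit_fun_le (x : U) (r : seq (dom_index W')) : uniq r ->
  \sum_(t <- r) `|unit_fun x t| ^+ 2 <= `|x| ^+ 2.
Proof.
move=> ur; pose ri := undup [seq tag t | t <- r].
have uri : uniq ri by exact: undup_uniq.
apply: (@le_trans _ _ (\sum_(t <- fibers W' ri) `|unit_fun x t| ^+ 2)).
  apply: sum_subset_le => //; first exact: fibers_uniq.
    by move=> t tr; rewrite mem_fibers mem_undup; apply: map_f.
  by move=> t; exact: exprn_ge0.
rewrite big_fibers; under eq_bigr => i _ do rewrite unit_fun_sum.
exact: bessel.
Qed.

Lemma rmul_unit_elt i (b : 'I_(dom_size W' i)) A (c : ann D A (Y i)) :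
  rmul (unit_elt b) c = lact (w' b) c.
Proof. by rewrite rmul_lact rmul1l. Qed.

(** With c = 1 this says that [unit_fun] is fixed by the matrices of the units; for general c it
    makes [unit_val] an intertwiner. *)
Lemma op_matrix_unit i j (c : ann D (Y i) (Y j)) x (b : 'I_(dom_size W' j)) :
  op_matrix c (fun a : 'I_(dom_size W' i) => unit_fun x (dom_pair a)) b =
  link W (lact (w' b) c) x.
Proof.
rewrite /op_matrix.
have := dom_sum_mid W' (w' b) c (ru D (Y i)) 1_[Y i]; rewrite ract1 rmul1r => E; rewrite -[in RHS]E.
rewrite link_suml; apply: eq_bigr => a _.
by rewrite op_link /unit_elt ract1 rmul_mid rmul_lact lactA.
Qed.

Lemma unit_fun_dom x : induced_dom (unit_fun x).
Proof. by move=> i b; rewrite op_matrix_unit. Qed.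

Definition unit_val (x : U) : UU :=
  l2_mk (K := induced_domain W' V) (ex_intro _ _ (@unit_fun_le x)) (@unit_fun_dom x).

Lemma unit_fiber x i (b : 'I_(dom_size W' i)) : fiber (unit_val x) b = link W (unit_elt b) x.
Proof. by []. Qed.

Lemma unit_intertwiner_subproof : unit_val \in @is_intertwiner R C D I Y U UU.
Proof.
apply/is_intertwinerP; split; first split.
- move=> a x y; apply: induced_eq => i b; rewrite [RHS]l2_valL -!/(fiber _ _).
  by rewrite !unit_fiber linkL.
- exists 1 => x; rewrite mul1r; apply: l2_norm_le => // r; exact: unit_fun_le.
move=> y x; apply: induced_eq => i b; have [r [ur ir hr]] := annular_degrees_in y i.
rewrite [RHS](act_fiber _ _ ur) => [|j]; last exact: degrees_l hr.
rewrite unit_fiber (actionE x ur hr) link_sumr; apply: eq_bigr => i0 _.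
rewrite op_matrix_unit link_sumr (bigD1_seq i)//= big1 ?addr0 => [|j ji].
  by rewrite link_op rmul_unit_elt.
by apply: link_op0 => ij; rewrite ij eqxx in ji.
Qed.

Definition unit_map : intertwiner U UU := Intertwiner unit_intertwiner_subproof.

Lemma unit_iso : is_iso (unit_map : hom (U : Rep D Y) (UU : Rep D Y)).
Proof.
apply: isometric_iso => [x|v] /=.
  move=> x0; apply: op_nondegenerate => i.
  have hb (b : 'I_(dom_size W' i)) : link W (unit_elt b) x = 0.
    by rewrite -unit_fiber x0.
  (* The adjoints of the component maps, applied to the components and summed, give back 1_i x. *)
  have : \sum_b colink (rs (@unit_elt i b)) (link W (unit_elt b) x) = 0.
    by rewrite big1// => b _; rewrite hb /colink big1// => a _; exact: op0r.
  under eq_bigr => b _ do rewrite colink_link rmul_rs_unit_elt.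
  by rewrite -op_suml -lact_suml dom_sum lact1.
(* The component of weight i of the preimage must be the sum of w'_b^* v_{i,b}; its image is v
   because v is fixed by the matrix of the unit of Y_i. *)
pose xi i : U := \sum_b colink (rs (unit_elt b)) (@fiber _ _ _ _ _ _ _ W' V v i b).
have link_xi i b : link W (@unit_elt i b) (xi i) = fiber v b.
  rewrite -fiberP /xi link_sumr; apply: eq_bigr => b0 _.
  by rewrite link_colink rmul_unit_elt rs_unit_elt lract.
have xi_norm i : `|xi i| ^+ 2 = \sum_b `|@fiber _ _ _ _ _ _ _ W' V v i b| ^+ 2.
  rewrite -hdot_norm {2}/xi hdot_sumr; apply: eq_bigr => b _.
  by rewrite -link_adj link_xi hdot_norm.
have [||r ur|x hx xv] := @glue _ _ _ _ _ U xi `|v|.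
- move=> i; rewrite /deg /xi op_sumr; apply: eq_bigr => b _.
  by rewrite op_colink rmul1l.
- exact: normr_ge0.
- under eq_bigr => i _ do rewrite xi_norm.
  rewrite -(big_fibers r (fun t : dom_index W' => `|l2_val v t| ^+ 2)).
  by apply: l2_sum_le; exact: fibers_uniq.
exists x => //; apply: (@induced_eq _ _ _ _ _ _ _ W' V) => i b; rewrite unit_fiber.
by rewrite -link_xi -hx link_op rmul1r.
Qed.

End Unit.

(** * Full weight sets dominate each other *)

Section Equivalence.
Context {R : realType} {C : rigidTensorCategory R}.

(** Since X is simple, [adj_positive] writes f^* f as |a|^2 times the identity, which provides the
    square root needed to normalize [f]. *)
Lemma simple_isometry (X S : C) (f : mor X S) : simple X -> f <> 0 ->
  exists v : mor X S, isometry v.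
Proof.
move=> sX f0; have [h hh] := adj_positive f; have [a ha] := sX.2 h.
rewrite {}ha adjZ adj1 compZm comp1m scalerA in hh.
have a0 : a != 0.
  apply/eqP => a0; apply: f0; apply/eqP; rewrite -normr_eq0 -sqrf_eq0.
  by rewrite -cstar_identity hh a0 mulr0 scale0r normr0.
exists (a^-1 *: f); rewrite /isometry adjZ compZm compmZ hh !scalerA fmorphV /=.
by rewrite mulrACA !mulVf ?conjC_eq0// mul1r scale1r.
Qed.

(** Decompose Z_j into simple objects by isometries u_a, embed each of these into some Y_t by an
    isometry v_a, and take v_a u_a^* as the pieces: v_a cancels, and the sum of u_a u_a^* is 1. *)
Lemma full_domination (I J : choiceType) (Y : I -> C) (Z : J -> C) :
  full Y -> exists W : domination Y Z, True.
Proof.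
move=> fY.
have piece j : exists (d : {n : nat & {t : 'I_n -> I & forall a, mor (Z j) (Y (t a))}}),
    \sum_a (projT2 (projT2 d) a)^† ∘ projT2 (projT2 d) a = 1_[Z j].
  have [n [S [u [sS [_ _ u1]]]]] := semisimple (Z j).
  have hv a : exists (tv : {t : I & mor (S a) (Y t)}), isometry (projT2 tv).
    by have [i [v hv]] := fY _ (sS a); exists (existT _ i v).
  pose tv a := projT1 (cid (hv a)); have htv a : isometry (projT2 (tv a)) := projT2 (cid (hv a)).
  exists (existT _ n (existT _ (fun a => projT1 (tv a))
    (fun a => projT2 (tv a) ∘ (u a)^†))) => /=.
  rewrite -u1; apply: eq_bigr => a _.
  by rewrite adj_comp adjK -compA (compA _ (projT2 (tv a))) htv comp1m.
pose d j := projT1 (cid (piece j)).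
have hd j : \sum_a (projT2 (projT2 (d j)) a)^† ∘ projT2 (projT2 (d j)) a = 1_[Z j].
  exact: projT2 (cid (piece j)).
by exists (Domination (dom_map := fun j => projT2 (projT2 (d j))) hd).
Qed.

Lemma full_irr (D : irrData C) : full (irr D).
Proof.
move=> X sX; pose k : Irr C := exist _ (iso_class X) (mem_set (ex_intro2 _ _ _ sX erefl)).
exists k; have [f [g [gf _]]] : isomorphic X (irr D k) := irr_in D k.
apply: (simple_isometry (f := f)) => // f0; apply: sX.1.
by rewrite -gf f0 compm0.
Qed.

Lemma full_equivalent (D : irrData C) (I J : choiceType) (Y : I -> C) (Z : J -> C) :
  full Y -> full Z -> additively_equivalent (Rep D Y) (Rep D Z).
Proof.
have unit_inv (I' J' : choiceType) (Y' : I' -> C) (Z' : J' -> C)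
    (W : domination Y' Z') (W' : domination Z' Y') :
    exists eta : forall U : Rep D Y', hom (induction W' (induction W U)) U,
      (forall U, is_iso (eta U)) /\
      forall (U V : Rep D Y') (f : hom U V),
        hcomp f (eta U) = hcomp (eta V) (fmap (induction W') (fmap (induction W) f)).
  pose E (U : Rep D Y') : hom U (induction W' (induction W U)) := unit_map W W' U.
  (* An equivalence asks for maps towards U, so the inverses of the units are taken. *)
  pose eta (U : Rep D Y') := projT1 (cid (unit_iso W W' U)).
  have heta (U : Rep D Y') : hcomp (eta U) (E U) = hid U /\
      hcomp (E U) (eta U) = hid (induction W' (induction W U)).
    exact: projT2 (cid (unit_iso W W' U)).
  exists eta; split=> [U|U V f].
    by have [h1 h2] := heta U; exists (E U).
  have [h1 h2] := heta U; have [h1' h2'] := heta V.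
  (* Both sides are compared coordinate by coordinate, twice, where naturality is the commutation of
     [f] with the operators of the representation. It then passes to the inverses. *)
  have nat : hcomp (E V) f = hcomp (fmap (induction W') (fmap (induction W) f)) (E U).
    apply: intertwiner_eq => x; apply: induced_eq => i b; apply: induced_eq => j a.
    by apply/esym; exact: link_intertwiner.
  rewrite -[LHS]hcomp1f -h1' -hcompA [hcomp _ (hcomp f _)]hcompA nat -!hcompA h2.
  by rewrite hcompf1.
move=> fY fZ; have [W _] := full_domination Z fY; have [W' _] := full_domination Y fZ.
exists (induction W), (induction W'); split; exact: unit_inv.
Qed.

End Equivalence.

(* The tube algebra is the annular algebra with weight set Irr(C) and
   representatives X_k. *)
Theorem theorem4p2 (R : realType) (C : rigidTensorCategory R)
  (hcount : countable (Irr C))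
  (D : irrData C)
  (L : set (set C)) (hL : L `<=` Obj_classes C)
  (Y : L -> C) (hY : forall i : L, val i (Y i))
  (hfull : full Y) :
  additively_equivalent (Rep D Y) (Rep D (irr D)).
Proof. exact: full_equivalent hfull (full_irr D). Qed.
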